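(* Let $k$ be a field, let $\Phi=\mathbf{Z}^r$ be equipped with a total group order, let $S=k[[u_1,\dots,u_N]]$, and let $w$ be a weight on $S$ with values in $\Phi_{\ge 0}$ such that $w(u_1),\dots,w(u_N)$ generate the group $\Phi$ and $w(u_i)>0$ for $i=1,\dots,N$. Let $F_1,\dots,F_s\in S$ be an overweight deformation of a prime binomial ideal $(u^{m^\ell}-\lambda_\ell u^{n^\ell})_{1\le \ell\le s}$, $\lambda_\ell\in k^*$, and put $R=S/(F_1,\dots,F_s)$, with quotient map $\pi\colon S\to R$. a) The overweight deformation determines a rational valuation $\nu$ of the ring $R$ with value group $\Phi$, and the associated graded ring of $R$ is $$\mathrm{gr}_\nu R=k[U_1,\dots,U_N]/(U^{m^1}-\lambda_1U^{n^1},\dots,U^{m^s}-\lambda_sU^{n^s}).$$ The graded map associated to $\pi$, with respect to the filtration by weight on $S$ and the filtration by $\nu$ on $R$, is the natural surjection $$\mathrm{gr}_w\pi\colon \mathrm{gr}_wS=k[U_1,\dots,U_N]\to k[U_1,\dots,U_N]/(U^{m^1}-\lambda_1U^{n^1},\dots,U^{m^s}-\lambda_sU^{n^s})=\mathrm{gr}_\nu R .$$ b) Assume that $k$ is algebraically closed. Then there exist birational toric maps $\pi(\Sigma)\colon Z(\Sigma)\to\mathbf{A}^N(k)$ which are embedded pseudo-resolutions of the irreducible affine binomial variety $\mathrm{Spec}\,\mathrm{gr}_\nu R\subset \mathbf{A}^N(k)$ and such that the strict transform by $\pi(\Sigma)$ of the formal subspace $X\subset\mathbf{A}^N(k)$ defined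 by the ideal $(F_1,\dots,F_s)$ is regular and transversal to the toric boundary at the point picked by $\nu$.
   Context: Weight: a weight on $k[[u_1,\dots,u_N]]$ (or $k[U_1,\dots,U_N]$) with values in a totally ordered abelian group $\Phi$ of finite rational rank is a nonzero group homomorphism $b\colon\mathbf{Z}^N\to\Phi$ with $b(\mathbf{N}^N)\subset\Phi_{\ge0}$; one sets $w(u^m)=w(m)=b(m)$, and the weight of a series is the least weight of its terms. With $\mathcal{Q}_\phi$ (resp. $\mathcal{Q}^+_\phi$) the ideal of series of weight $\ge\phi$ (resp. $>\phi$), $\mathrm{gr}_wS=\bigoplus_{\phi\in\Phi_{\ge0}}\mathcal{Q}_\phi/\mathcal{Q}_\phi^+=k[U_1,\dots,U_N]$ with $U_i$ the initial form of $u_i$, $\deg U_i=w(u_i)$. Overweight deformation: the datum of a prime binomial ideal $(u^{m^\ell}-\lambda_\ell u^{n^\ell})_{1\le\ell\le s}$, $\lambda_\ell\in k^*$, of $S$ such that the vectors $m^\ell-n^\ell\in\mathbf{Z}^N$ generate the lattice of relations between the $w(u_i)$ (so $w(m^\ell)=w(n^\ell)$), together with series $F_\ell=u^{m^\ell}-\lambda_\ell u^{n^\ell}+\sum_{w(p)>w(m^\ell)}c^{(\ell)}_pu^p\in S$ ($1\le \ell\le s$, $c_p^{(\ell)}\in k$) whose initial forms for the weight generate the ideal of initial forms of all the elements of the ideal $(F_1,\dots,F_s)$. The valuation determined by the overweight deformation is the map given for $x\in R\setminus\{0\}$ by $\nu(x)=\max\{w(\tilde x): \tilde x\in S,\ \pi(\tilde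 x)=x\}$. A valuation of $R$ whose valuation ring dominates $R$ is rational if the residue field extension is trivial; $\mathrm{gr}_\nu R=\bigoplus_{\phi\in\Phi_{\ge 0}}\mathcal{P}_\phi/\mathcal{P}^+_\phi$ with $\mathcal{P}_\phi=\{x\in R:\nu(x)\ge\phi\}$ and $\mathcal{P}^+_\phi=\{x\in R:\nu(x)>\phi\}$. Toric maps: $\Sigma$ denotes a regular fan with support the first orthant $\mathbf{R}^N_{\ge0}$ (of the dual of the space of exponents), $Z(\Sigma)$ the corresponding nonsingular toric variety and $\pi(\Sigma)\colon Z(\Sigma)\to\mathbf{A}^N(k)$ the corresponding proper birational toric map; on the chart of an $N$-dimensional cone $\sigma=\langle a^1,\dots,a^N\rangle$ it is $u_i\mapsto y_1^{a^1_i}\cdots y_N^{a^N_i}$. The toric boundary is the complement of the torus. An embedded pseudo-resolution of an affine toric variety $X_0\subset\mathbf{A}^N(k)$ is such a map for which the strict transform of $X_0$ is nonsingular and transversal to the toric boundary (it need not be an isomorphism outside the singular locus). The strict transform $X'$ of $X$ is the closure, in $Z(\Sigma)\times_{\mathbf{A}^N(k)}\mathrm{Spec}\,S$, of the part of the inverse image of $X$ lying over $u_1\cdots u_N\neq0$; the point picked by $\nu$ is the center of $\nu$ on $X'$. $X'$ is transversal to the toric boundary at a point if the local equations of the components of the toric boundary through that point restrict on $X'$ to part of a regular system of parameters.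
   Formalization: Each binomial is assumed to have two distinct monomials, and the prime binomial ideal to contain no variable u_i; otherwise the claim fails, e.g. for N=2, w=(1,1) and (u_1-u_2, u_1-2u_2)=(u_1,u_2), where R=k has no valuation with value group Z. *)

(* Defs.v *)
From HB Require Import structures.
From mathcomp Require Import all_boot all_order all_algebra.
From mathcomp Require Import mathcomp_extra boolp classical_sets reals.
From mathcomp Require Import finmap mpoly.

Set Implicit Arguments.
Unset Strict Implicit.
Unset Printing Implicit Defensive.

Import Order.TTheory GRing.Theory Num.Theory.
Local Open Scope ring_scope.
Local Open Scope classical_set_scope.
Local Open Scope quotient_scope.

Record mseries (N : nat) (k : comNzRingType) :=
  MSeries { coef : 'X_{1..N} -> k }.

Section MSeriesRing.
Variables (N : nat) (k : comNzRingType).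
Local Notation S := (mseries N k).
Implicit Types f g h : S.

Lemma mseriesP f g : coef f =1 coef g -> f = g.
Proof. by case: f g => [f] [g] /= /funext ->. Qed.

HB.instance Definition _ := gen_eqMixin S.
HB.instance Definition _ := gen_choiceMixin S.

Definition ms_zero : S := MSeries (fun=> 0).
Definition ms_one : S := MSeries (fun m => (m == 0%MM)%:R).
Definition ms_opp f : S := MSeries (fun m => - coef f m).
Definition ms_add f g : S := MSeries (fun m => coef f m + coef g m).
Definition ms_mul f g : S := MSeries (fun m =>
  \sum_(p : 'X_{1..N < (mdeg m).+1, (mdeg m).+1} | m == (p.1 + p.2)%MM)
    coef f p.1 * coef g p.2).

Lemma ms_addA : associative ms_add.
Proof. by move=> f g h; apply: mseriesP => m /=; rewrite addrA. Qed.
Lemma ms_addC : commutative ms_add.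
Proof. by move=> f g; apply: mseriesP => m /=; rewrite addrC. Qed.
Lemma ms_add0 : left_id ms_zero ms_add.
Proof. by move=> f; apply: mseriesP => m /=; rewrite add0r. Qed.
Lemma ms_addN : left_inverse ms_zero ms_opp ms_add.
Proof. by move=> f; apply: mseriesP => m /=; rewrite addNr. Qed.

HB.instance Definition _ :=
  GRing.isZmodule.Build S ms_addA ms_addC ms_add0 ms_addN.

Definition ms_trunc d f : {mpoly k[N]} :=
  \sum_(m : 'X_{1..N < d}) coef f m *: 'X_[m].

Lemma ms_truncE d f m : (mdeg m < d)%N -> (ms_trunc d f)@_m = coef f m.
Proof. by move=> lt_md; rewrite /ms_trunc mcoeff_mpoly. Qed.

Lemma ms_mulE d f g m : (mdeg m < d)%N ->
  coef (ms_mul f g) m = (ms_trunc d f * ms_trunc d g)@_m.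
Proof.
move=> lt_md; rewrite mcoeffM /=; apply: eq_bigr => -[p q] /= _.
by rewrite !ms_truncE // (leq_ltn_trans _ lt_md) // -ltnS bmdeg.
Qed.

Lemma ms_truncM d f g m (p : {mpoly k[N]}) : (mdeg m < d)%N ->
  (ms_trunc d (ms_mul f g) * p)@_m = (ms_trunc d f * ms_trunc d g * p)@_m.
Proof.
move=> lt_md; rewrite !(mcoeffM _ p); apply: eq_bigr => -[q1 q2] /= _.
have lt_qd : (mdeg q1 < d)%N by rewrite (leq_ltn_trans _ lt_md) // -ltnS bmdeg.
by rewrite ms_truncE // (ms_mulE _ _ lt_qd).
Qed.

Lemma ms_mulC : commutative ms_mul.
Proof.
move=> f g; apply: mseriesP => m.
by rewrite !(ms_mulE _ _ (ltnSn (mdeg m))) mulrC.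
Qed.

Lemma ms_mulA : associative ms_mul.
Proof.
move=> f g h; apply: mseriesP => m; have lt_m := ltnSn (mdeg m).
rewrite !(ms_mulE _ _ lt_m) (ms_truncM _ _ _ lt_m) mulrC.
by rewrite (ms_truncM _ _ _ lt_m) mulrC mulrA.
Qed.

Lemma ms_mul1 : left_id ms_one ms_mul.
Proof.
move=> f; apply: mseriesP => m; have lt_m := ltnSn (mdeg m).
have -> : coef (ms_mul ms_one f) m = (1 * ms_trunc (mdeg m).+1 f)@_m.
  rewrite (ms_mulE _ _ lt_m) !mcoeffM; apply: eq_bigr => -[p q] /= _.
  by rewrite ms_truncE ?bmdeg //= mcoeff1.
by rewrite mul1r ms_truncE.
Qed.

Lemma ms_mulD : left_distributive ms_mul +%R.
Proof.
move=> f g h; apply: mseriesP => m /=; rewrite -big_split /=.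
by apply: eq_bigr => p _; rewrite mulrDl.
Qed.

Lemma ms_one_neq0 : ms_one != 0 :> S.
Proof.
apply/eqP => /(congr1 (fun f : S => coef f 0%MM)) /= /eqP.
by rewrite eqxx oner_eq0.
Qed.

HB.instance Definition _ := GRing.Zmodule_isComNzRing.Build S
  ms_mulA ms_mulC ms_mul1 ms_mulD ms_one_neq0.

Definition series_of_poly (p : {mpoly k[N]}) : S := MSeries (fun m => p@_m).

End MSeriesRing.

Section Ideals.
Variable A : comPzRingType.
Implicit Types (E I : set A).

Definition ideal_span E : set A := [set x | exists n (c g : 'I_n -> A),
  (forall i, E (g i)) /\ x = \sum_i c i * g i].

(** If [V] is the closed subscheme of [Spec A] with equations [E], this is the
    kernel of [A -> (A / (E))_t], that is, the ideal of the scheme-theoretic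
    closure in [Spec A] of the part of [V] where [t != 0]. *)
Definition closure_ideal E (t : A) : set A :=
  [set g | exists n, ideal_span E (t ^+ n * g)].

Definition prime_ideal I : Prop :=
  [/\ ideal_span I `<=` I, ~ I 1 & forall x y, I (x * y) -> I x \/ I y].

Definition ideal_pred E : {pred A} := fun x => `[< ideal_span E x >].

Lemma ideal_pred_zmod E : zmod_closed (ideal_pred E).
Proof.
split=> [|x y].
  rewrite unfold_in; apply/asboolP.
  by exists 0%N, (fun=> 0), (fun=> 0); split=> [[]//|]; rewrite big_ord0.
rewrite !unfold_in => /asboolP [n [c [g [Eg ->]]]] /asboolP [n' [c' [g' [Eg' ->]]]].
apply/asboolP; exists (n + n')%N.
exists (fun i => match split i with inl j => c j | inr j => - c' j end).
exists (fun i => match split i with inl j => g j | inr j => g' j end).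
split=> [i|]; first by case: (split i).
rewrite big_split_ord -sumrN; congr (_ + _); apply: eq_bigr => i _.
  by rewrite (unsplitK (inl i)).
by rewrite (unsplitK (inr i)) mulNr.
Qed.

HB.instance Definition _ E :=
  GRing.isZmodClosed.Build A (ideal_pred E) (ideal_pred_zmod E).

Lemma ideal_predM E a x : x \in ideal_pred E -> a * x \in ideal_pred E.
Proof.
rewrite !unfold_in => /asboolP [n [c [g [Eg ->]]]]; apply/asboolP.
exists n, (fun i => a * c i), g; split=> //.
by rewrite mulr_sumr; apply: eq_bigr => i _; rewrite mulrA.
Qed.

(** The ring [A / (E)].  The library's [{ideal_quot I}] asks for a proper
    ideal; here the quotient may be the zero ring. *)
Definition quotient E := Quotient.quot (ideal_pred E).

End Ideals.

Section QuotientRing.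
Variables (A : comPzRingType) (E : set A).
Local Notation Q := (quotient E).

HB.instance Definition _ := Choice.on Q.
HB.instance Definition _ := GRing.Zmodule.on Q.

Definition quo (x : A) : Q := \pi_(Quotient.quot (ideal_pred E)) x.

Lemma quoP x y : quo x = quo y <-> ideal_span E (x - y).
Proof.
split=> [/eqP|Exy].
  by rewrite -Quotient.idealrBE unfold_in => /asboolP.
by apply/eqP; rewrite -Quotient.idealrBE unfold_in; apply/asboolP.
Qed.

Lemma quo_repr (x : Q) : quo (repr x) = x.
Proof. exact: reprK. Qed.

Lemma quo_surj (x : Q) : exists y, quo y = x.
Proof. by exists (repr x); exact: quo_repr. Qed.

Lemma quo_zmod_morphism : zmod_morphism quo.
Proof. exact: (raddfB (\pi_(Quotient.quot (ideal_pred E)))). Qed.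

HB.instance Definition _ := GRing.isZmodMorphism.Build A Q quo quo_zmod_morphism.

Definition quo_one : Q := quo 1.
Definition quo_mul (x y : Q) : Q := quo (repr x * repr y).

Lemma quo_mulE x y : quo_mul (quo x) (quo y) = quo (x * y).
Proof.
have spanM a z : ideal_span E z -> ideal_span E (a * z).
  move=> Ez; apply/asboolP; apply: (@ideal_predM A E a z).
  by rewrite unfold_in; apply/asboolP.
have spanD z z' : ideal_span E z -> ideal_span E z' -> ideal_span E (z + z').
  move=> Ez Ez'; apply/asboolP; apply: (@rpredD A (ideal_pred E) z z').
    by rewrite unfold_in; apply/asboolP.
  by rewrite unfold_in; apply/asboolP.
apply/quoP; set x' := repr _; set y' := repr _.
have -> : x' * y' - x * y = x' * (y' - y) + y * (x' - x).
  by rewrite !mulrBr (mulrC y x') addrA subrK (mulrC y).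
by apply: spanD; apply: spanM; apply/quoP; rewrite quo_repr.
Qed.

Lemma quo_mulA : associative quo_mul.
Proof.
move=> x y z; case: (quo_surj x) (quo_surj y) (quo_surj z) => [x' <-] [y' <-] [z' <-].
by rewrite !quo_mulE mulrA.
Qed.
Lemma quo_mulC : commutative quo_mul.
Proof.
by move=> x y; case: (quo_surj x) (quo_surj y) => [x' <-] [y' <-]; rewrite !quo_mulE mulrC.
Qed.
Lemma quo_mul1 : left_id quo_one quo_mul.
Proof. by move=> x; case: (quo_surj x) => [x' <-]; rewrite quo_mulE mul1r. Qed.
Lemma quo_mulD : left_distributive quo_mul +%R.
Proof.
move=> x y z; case: (quo_surj x) (quo_surj y) (quo_surj z) => [x' <-] [y' <-] [z' <-].
by rewrite -raddfD !quo_mulE mulrDl raddfD.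
Qed.

HB.instance Definition _ := GRing.Zmodule_isComPzRing.Build Q
  quo_mulA quo_mulC quo_mul1 quo_mulD.

Lemma quo_monoid_morphism : monoid_morphism quo.
Proof. by split=> // x y; rewrite -[RHS]/(quo_mul _ _) quo_mulE. Qed.

HB.instance Definition _ :=
  GRing.isMonoidMorphism.Build A Q quo quo_monoid_morphism.

End QuotientRing.

Arguments quo {A} E x.

Record group_order (Phi : zmodType) := GroupOrder {
  gle :> rel Phi;
  gle_refl : reflexive gle;
  gle_anti : antisymmetric gle;
  gle_trans : transitive gle;
  gle_total : total gle;
  gle_add : forall z x y, gle x y -> gle (z + x) (z + y) }.

Definition glt (Phi : zmodType) (O : group_order Phi) (x y : Phi) : Prop :=
  O x y /\ x <> y.

Definition zvec (N : nat) (m : 'X_{1..N}) : 'rV[int]_N := \row_i (m i)%:Z.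

Section Weights.
Variables (N : nat) (Phi : zmodType) (O : group_order Phi).
Variable w : {additive 'rV[int]_N -> Phi}.

Definition wt (m : 'X_{1..N}) : Phi := w (zvec m).

Definition is_weight : Prop :=
  (exists z, w z <> 0) /\ forall m : 'X_{1..N}, O 0 (wt m).

Variable k : comNzRingType.
Local Notation S := (mseries N k).

Definition weight_ge (phi : Phi) : set S :=
  [set x | forall m, coef x m <> 0 -> O phi (wt m)].

Definition weight_gt (phi : Phi) : set S :=
  [set x | forall m, coef x m <> 0 -> glt O phi (wt m)].

Definition has_weight (x : S) (phi : Phi) : Prop :=
  weight_ge phi x /\ exists m, coef x m <> 0 /\ wt m = phi.

(** The sum of the terms of weight [phi] of [x], as an element of
    [gr_w S = k[U_1, .., U_N]].  When all [wt U_(i)] are positive, only finitely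
    many monomials have weight [phi], so that such a polynomial exists. *)
Definition weight_part (phi : Phi) (x : S) : {mpoly k[N]} :=
  xget 0 [set g | forall m, g@_m = if wt m == phi then coef x m else 0].

Definition initial_forms (E : set S) : set {mpoly k[N]} :=
  [set g | exists x phi, [/\ E x, has_weight x phi & g = weight_part phi x]].

End Weights.

Section Overweight.
Variables (k : fieldType) (N s : nat).
Local Notation S := (mseries N k).

Definition lbinomial (m n : 'X_{1..N}) (lambda : k) : {mpoly k[N]} :=
  'X_[m] - lambda *: 'X_[n].

Definition binomials (m n : 'I_s -> 'X_{1..N}) (lambda : 'I_s -> k) :
  set {mpoly k[N]} := [set lbinomial (m l) (n l) (lambda l) | l in setT].

(** The two monomials of a binomial are distinct, and a prime binomial ideal
    defines a toric variety meeting the torus, i.e. it contains no variable: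
    e.g. [(u_1 - u_2, u_1 - 2 u_2) = (u_1, u_2)] is excluded. *)
Definition prime_binomial_ideal
    (m n : 'I_s -> 'X_{1..N}) (lambda : 'I_s -> k) : Prop :=
  let I := ideal_span (@series_of_poly N k @` binomials m n lambda) in
  [/\ forall l, lambda l <> 0,
      forall l, m l <> n l,
      prime_ideal I
    & forall i, ~ I (series_of_poly 'X_i)].

Definition overweight_deformation (Phi : zmodType) (O : group_order Phi)
    (w : {additive 'rV[int]_N -> Phi})
    (m n : 'I_s -> 'X_{1..N}) (lambda : 'I_s -> k) (F : 'I_s -> S) : Prop :=
  [/\ prime_binomial_ideal m n lambda,
      forall z : 'rV[int]_N, w z = 0 <->
        exists c : 'I_s -> int, z = \sum_l (zvec (m l) - zvec (n l)) *~ c l,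
      forall l p,
        coef (F l - series_of_poly (lbinomial (m l) (n l) (lambda l))) p <> 0 ->
        glt O (wt w (m l)) (wt w p)
    & ideal_span (initial_forms O w (range F)) =
      ideal_span (initial_forms O w (ideal_span (range F)))].

End Overweight.

Section Valuations.
Variables (Phi : zmodType) (O : group_order Phi).

Section Field.
Variables (K : fieldType) (v : K -> Phi).

(** The value of [v] at [0] is irrelevant. *)
Definition is_valuation : Prop :=
  (forall x y, x != 0 -> y != 0 -> v (x * y) = v x + v y) /\
  (forall x y phi, x != 0 -> y != 0 -> x + y != 0 ->
     O phi (v x) -> O phi (v y) -> O phi (v (x + y))).

Definition value_group_full : Prop := forall phi, exists2 x, x != 0 & v x = phi.

Definition valuation_ring : set K := [set x | x = 0 \/ O 0 (v x)].
Definition valuation_max : set K := [set x | x = 0 \/ glt O 0 (v x)].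

Variables (R : comPzRingType) (iota : {rmorphism R -> K}).

Definition is_fraction_field : Prop :=
  injective iota /\
  forall z, exists x y, iota y <> 0 /\ z = iota x / iota y.

(** The maximal ideal of [valuation_ring] contracts to the set of nonunits of
    [R]; since it contracts to an ideal, [R] is then local. *)
Definition dominates : Prop :=
  forall x, valuation_ring (iota x) /\
    (valuation_max (iota x) <-> ~ exists y, x * y = 1).

Definition rational_valuation : Prop :=
  dominates /\
  forall z, valuation_ring z -> exists x, valuation_max (z - iota x).

Definition val_ge (phi : Phi) : set R :=
  [set x | x = 0 \/ O phi (v (iota x))].
Definition val_gt (phi : Phi) : set R :=
  [set x | x = 0 \/ glt O phi (v (iota x))].

End Field.

(** [G], with the maps sending [x] in [P phi] to the class of [x], is the graded
    ring [\bigoplus_(phi >= 0) P phi / P' phi]: each [ini phi] induces an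
    injection of [P phi / P' phi] in [G], products are induced by those of [A],
    and [G] is the direct sum of the images. *)
Definition is_associated_graded (A G : comPzRingType) (P P' : Phi -> set A)
    (ini : Phi -> A -> G) : Prop :=
  [/\ forall phi x y, O 0 phi -> P phi x -> P phi y ->
        P phi (x - y) /\ ini phi (x - y) = ini phi x - ini phi y,
      forall phi x, O 0 phi -> P phi x -> (ini phi x = 0 <-> P' phi x),
      P 0 1 /\ ini 0 1 = 1,
      forall phi psi x y, O 0 phi -> O 0 psi -> P phi x -> P psi y ->
        P (phi + psi) (x * y) /\ ini (phi + psi) (x * y) = ini phi x * ini psi y
    & (forall g : G, exists (D : seq Phi) (x : Phi -> A),
         [/\ uniq D, forall phi, phi \in D -> O 0 phi /\ P phi (x phi)
           & g = \sum_(phi <- D) ini phi (x phi)]) /\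
      (forall (D : seq Phi) (x : Phi -> A), uniq D ->
         (forall phi, phi \in D -> O 0 phi /\ P phi (x phi)) ->
         \sum_(phi <- D) ini phi (x phi) = 0 ->
         forall phi, phi \in D -> ini phi (x phi) = 0)].

(** [h : G -> H] is the graded map associated to the filtered map [f]. *)
Definition is_graded_map (A B G H : comPzRingType)
    (P P' : Phi -> set A) (iniA : Phi -> A -> G)
    (Q Q' : Phi -> set B) (iniB : Phi -> B -> H)
    (f : A -> B) (h : G -> H) : Prop :=
  forall phi x, O 0 phi -> P phi x ->
    [/\ Q phi (f x), P' phi x -> Q' phi (f x) & h (iniA phi x) = iniB phi (f x)].

End Valuations.

(** [phi = max {w y | pi y = x}] *)
Definition is_max_weight (N : nat) (k : comNzRingType) (Phi : zmodType)
    (O : group_order Phi) (w : {additive 'rV[int]_N -> Phi})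
    (R : Type) (pi : mseries N k -> R) (x : R) (phi : Phi) : Prop :=
  (exists y, pi y = x /\ has_weight O w y phi) /\
  forall y psi, pi y = x -> has_weight O w y psi -> O psi phi.

Section Regular.
Variable A : comPzRingType.
Implicit Types p : set A.

(** Chains of primes below [p] correspond to chains of primes of [A_p]. *)
Definition prime_chain p (d : nat) : Prop :=
  exists q : nat -> set A,
    (forall i, (i <= d)%N -> prime_ideal (q i) /\ q i `<=` p) /\
    (forall i, (i < d)%N -> q i `<=` q i.+1 /\ q i <> q i.+1).

Definition local_dim p (d : nat) : Prop :=
  prime_chain p d /\ forall e, prime_chain p e -> (e <= d)%N.

(** [xs] is a regular system of parameters of the local ring [A_p]: as many
    elements of [p] as the dimension of [A_p], generating [p A_p].  There is no
    loss in taking them in [A], since the elements of [p A_p] are, up to units,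
    images of elements of [p].  Noetherianity of [A_p] is not repeated: the
    rings considered below are quotients of polynomial rings over [k] or over
    [k[[u_1, .., u_N]]]. *)
Definition regular_parameters p (xs : seq A) : Prop :=
  [/\ prime_ideal p, local_dim p (size xs),
      forall x, x \in xs -> p x
    & forall x, p x -> exists2 t, ~ p t & ideal_span [set y | y \in xs] (t * x)].

Definition regular_at p : Prop := exists xs, regular_parameters p xs.

(** [z j], [j < N], are local equations of the components of a divisor; those of
    the components through [p] are part of a regular system of parameters. *)
Definition transversal_at (N : nat) (z : 'I_N -> A) p : Prop :=
  exists xs, regular_parameters p
    ([seq z j | j <- enum 'I_N & `[< p (z j) >]] ++ xs).

End Regular.

Section Fans.
Variables (RR : realType) (N : nat).

(** A regular cone contained in the first orthant is given by the finite set
    of its primitive generators, which are vectors of [N^N]. *)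
Local Notation cone_t := {fset 'X_{1..N}}.

Definition cone_pts (sigma : cone_t) : set 'rV[RR]_N :=
  [set x | exists c : 'X_{1..N} -> RR, (forall a, 0 <= c a) /\
    x = \sum_(a <- enum_fset sigma) c a *: \row_i (a i)%:R].

Definition regular_cone (sigma : cone_t) : Prop :=
  exists2 M : 'M[int]_N, M \in unitmx &
    forall a, a \in sigma -> exists j, row j M = zvec a.

(** The faces of a regular cone are the cones on the subsets of its set of
    generators. *)
Definition regular_fan (Sigma : {fset cone_t}) : Prop :=
  [/\ forall sigma, sigma \in Sigma -> regular_cone sigma,
      forall sigma tau : cone_t,
        sigma \in Sigma -> (tau `<=` sigma)%fset -> tau \in Sigma
    & forall sigma tau, sigma \in Sigma -> tau \in Sigma ->
        exists rho : cone_t, [/\ (rho `<=` sigma)%fset, (rho `<=` tau)%fset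
          & cone_pts sigma `&` cone_pts tau = cone_pts rho]].

Definition support_orthant (Sigma : {fset cone_t}) : Prop :=
  forall x : 'rV[RR]_N, (forall i, 0 <= x 0 i) <->
    exists2 sigma, sigma \in Sigma & cone_pts sigma x.

(** [a] lists the generators [a^1, .., a^N] of an [N]-dimensional cone. *)
Definition is_chart (Sigma : {fset cone_t}) (a : 'I_N -> 'X_{1..N}) : Prop :=
  injective a /\ exists2 sigma, sigma \in Sigma &
    forall b, b \in sigma <-> exists j, b = a j.

End Fans.

(** The [N]-dimensional cones of a fan with support the first orthant give
    affine charts covering [Z(Sigma)], so that regularity and transversality
    are expressed on these charts. *)

Section Charts.
Variables (N : nat) (a : 'I_N -> 'X_{1..N}).

(** [u_i |-> y_1 ^ (a^1 i) .. y_N ^ (a^N i)] *)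
Definition chart_mon (i : 'I_N) : 'X_{1..N} := [multinom a j i | j < N].

Section Affine.
Variable k : fieldType.

Definition chart_map (p : {mpoly k[N]}) : {mpoly k[N]} :=
  p \mPo [tuple 'X_[chart_mon i] | i < N].

(** Coordinate ring of the strict transform in [Spec k[y_1, .., y_N]] of the
    subvariety of [A^N] with ideal generated by [J]: the closure of the part of
    its inverse image lying over [u_1 .. u_N != 0]. *)
Definition toric_strict (J : set {mpoly k[N]}) : comPzRingType :=
  quotient (closure_ideal (chart_map @` J) (\prod_i 'X_[chart_mon i])).

Definition toric_coord (J : set {mpoly k[N]}) (j : 'I_N) : toric_strict J :=
  quo _ 'X_j.

End Affine.

Section Formal.
Variable k : fieldType.
Local Notation S := (mseries N k).

(** The chart of [Z(Sigma) x_(A^N) Spec S] is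
    [Spec (S[y_1, .., y_N] / (u_i - y_1 ^ (a^1 i) .. y_N ^ (a^N i))_i)]; the
    inverse image of [X] is defined in it by the [F l]. *)
Definition total_equations (E : set S) : set {mpoly S[N]} :=
  [set (series_of_poly 'X_i)%:MP - 'X_[chart_mon i] | i in setT] `|`
  [set f%:MP | f in E].

Definition formal_strict (E : set S) : comPzRingType :=
  quotient (closure_ideal (total_equations E)
                          (\prod_i (series_of_poly 'X_i)%:MP)).

Definition formal_coord (E : set S) (j : 'I_N) : formal_strict E := quo _ 'X_j.

Definition formal_const (E : set S) (x : S) : formal_strict E := quo _ x%:MP.

(** [p] is the center, on this chart of the strict transform of [X], of the
    valuation [v] of the fraction field [K] of [R = S / (E)]: [f] is the
    generic point [Spec K -> X'] above [iota : R -> K]. *)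
Definition is_center (Phi : zmodType) (O : group_order Phi) (E : set S)
    (K : fieldType) (iota : {rmorphism quotient E -> K}) (v : K -> Phi)
    (p : set (formal_strict E)) : Prop :=
  exists f : {rmorphism formal_strict E -> K},
    [/\ forall x : S, f (formal_const E x) = iota (quo E x),
        forall g, valuation_ring O v (f g)
      & p = [set g | valuation_max O v (f g)]].

End Formal.
End Charts.

Definition embedded_pseudo_resolution (k : fieldType) (N : nat)
    (Sigma : {fset {fset 'X_{1..N}}}) (J : set {mpoly k[N]}) : Prop :=
  forall a, is_chart Sigma a ->
  forall p : set (toric_strict a J), prime_ideal p ->
    regular_at p /\ transversal_at (@toric_coord N a k J) p.

(* Main.v *)
Require Import Defs.
From HB Require Import structures.
From mathcomp Require Import all_boot all_order all_algebra.
From mathcomp Require Import mathcomp_extra boolp classical_sets reals.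
From mathcomp Require Import finmap mpoly.
From mathcomp Require Import perm generic_quotient.
From mathcomp Require Import zify ring lra.

(** Every element of [S] is congruent modulo [(F)] to a series with at most one
    monomial of each weight (rewrite by the binomials and iterate); evaluating
    initial forms at a point [c] of the torus of the binomial variety detects
    membership in the binomial ideal.  Hence the initial form of such a normal
    form is nonzero in [gr_w S / (binomials)], which is a domain, and [nu] is the
    weight of the normal form.

    The fan is a subdivision of the orthant compatible with the linear forms
    [m l - n l] and [m l - g], where [g] runs over the minimal exponents of
    [F l] minus its binomial.  On a chart meeting [nu], let [tau] be the set of the
    coordinates of positive value.  Divided by a monomial, [F l] becomes a
    binomial in the coordinates outside [tau] plus terms in the ideal generated by
    the coordinates in [tau]; hence the latter generate the center of [nu].
    They are parameters because the argument for [nu] applies to any order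
    on the weights for which they have positive value, and lexicographic orders
    give valuations whose convex subgroups cut out a chain of [#|tau|] primes below
    the center, while Krull's height theorem gives the upper bound.  The toric part
    follows from the presentation of the charts as localized polynomial rings. *)

Set Implicit Arguments.
Unset Strict Implicit.
Unset Printing Implicit Defensive.

Import Order.TTheory GRing.Theory Num.Theory.
Local Open Scope ring_scope.
Local Open Scope classical_set_scope.

(** * Ideals, Krull's height theorem *)

(** The obstacle is convergence. In a value group of rank greater than one, infinitely many weights
    may lie below a given one, so a rewriting that merely raises weights could send infinitely many
    terms to the same monomial. The fan removes this obstacle and therefore enters already in a). On
    a chart where [nu] has a center, the exponents of the [y_j], [j] in [tau], depend only on the
    weight of a monomial in the [u_i]; they embed the weights in a free monoid, compatibly with the
    order. Rewriting lowers none of these exponents and raises their sum, and this sum bounds the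
    degree. That a normal form in [(F)] is zero is proved from the initial forms for the given
    order, but the statement does not mention an order. This is what allows the construction of [nu]
    to be repeated for lexicographic orders, for which nothing is assumed about initial forms. *)

Section IdealBasics.
Variable A : comPzRingType.
Implicit Types (E I J : set A) (x y : A).

Definition is_ideal I :=
  [/\ I 0, forall x y, I x -> I y -> I (x + y) & forall a x, I x -> I (a * x)].

Lemma ideal0 I : is_ideal I -> I 0. Proof. by case. Qed.
Lemma idealD I x y : is_ideal I -> I x -> I y -> I (x + y).
Proof. by case=> _ h _; apply: h. Qed.
Lemma idealMl I a x : is_ideal I -> I x -> I (a * x).
Proof. by case=> _ _; apply. Qed.
Lemma idealMr I a x : is_ideal I -> I x -> I (x * a).
Proof. by move=> hI Ix; rewrite mulrC; apply: idealMl. Qed.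
Lemma idealN I x : is_ideal I -> I x -> I (- x).
Proof. by move=> hI Ix; rewrite -mulN1r; apply: idealMl. Qed.
Lemma idealB I x y : is_ideal I -> I x -> I y -> I (x - y).
Proof. by move=> hI Ix Iy; apply: idealD => //; apply: idealN. Qed.
Lemma ideal_addK I x y : is_ideal I -> I y -> I (x + y) -> I x.
Proof. by move=> hI Iy Ixy; rewrite -(addrK y x); apply: idealB. Qed.
Lemma ideal_sum I (T : Type) (r : seq T) (P : pred T) (F : T -> A) :
  is_ideal I -> (forall i, P i -> I (F i)) -> I (\sum_(i <- r | P i) F i).
Proof.
move=> hI IF; apply: (big_ind I) => //; first exact: ideal0.
by move=> x y; apply: idealD.
Qed.

Lemma span_ideal E : is_ideal (ideal_span E).
Proof.
have eP x : reflect (ideal_span E x) (x \in ideal_pred E) by exact: asboolP.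
split=> [|x y /eP Ex /eP Ey|a x /eP Ex]; apply/eP.
- exact: rpred0.
- exact: rpredD.
- exact: ideal_predM.
Qed.

Lemma subset_span E : E `<=` ideal_span E.
Proof.
move=> x Ex; exists 1%N, (fun=> 1), (fun=> x); split=> //.
by rewrite big_ord1 mul1r.
Qed.

Lemma span_min E I : is_ideal I -> E `<=` I -> ideal_span E `<=` I.
Proof.
move=> hI EI x [n [c [g [Eg ->]]]]; apply: ideal_sum => // i _.
by apply: idealMl => //; apply: EI.
Qed.

Lemma span_sub E E' : E `<=` E' -> ideal_span E `<=` ideal_span E'.
Proof.
by move=> EE'; apply: span_min; [exact: span_ideal | move=> x /EE' /subset_span].
Qed.

Lemma is_idealP I : is_ideal I <-> ideal_span I `<=` I.
Proof.
split=> [hI|hI]; first exact: span_min.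
have [s0 sD sM] := span_ideal I.
split=> [|x y Ix Iy|a x Ix]; apply: hI => //.
- by apply: sD; apply: subset_span.
- by apply: sM; apply: subset_span.
Qed.

Lemma prime_is_ideal p : prime_ideal p -> is_ideal p.
Proof. by case=> /is_idealP. Qed.

Lemma prime_exp (p : set A) x n : prime_ideal p -> p (x ^+ n) -> p x.
Proof.
move=> [_ p1 pM]; elim: n => [|n IH]; first by rewrite expr0.
by rewrite exprS => /pM [].
Qed.

Lemma primeM (p : set A) (s t : A) : prime_ideal p -> ~ p s -> ~ p t -> ~ p (s * t).
Proof. by move=> [_ _ pM] ps pt /pM []. Qed.

Lemma span_seqP (s : seq A) x :
  ideal_span [set y | y \in s] x <->
  exists c : 'I_(size s) -> A, x = \sum_i c i * s`_i.
Proof.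
split; last first.
  by move=> [c ->]; exists (size s), c, (fun i => s`_i); split=> // i; apply: mem_nth.
pose Q := [set x | exists c : 'I_(size s) -> A, x = \sum_i c i * s`_i].
suff hQ : is_ideal Q.
  apply: (span_min hQ) => y ys; have lt : (index y s < size s)%N by rewrite index_mem.
  exists (fun i => (i == Ordinal lt)%:R); rewrite (bigD1 (Ordinal lt)) //= eqxx mul1r.
  rewrite big1 ?addr0 ?nth_index // => i /negbTE -> ; exact: mul0r.
split=> [|_ _ [c ->] [d ->]|a _ [c ->]].
- by exists (fun=> 0); rewrite big1 // => i _; exact: mul0r.
- by exists (fun i => c i + d i); rewrite -big_split; apply: eq_bigr => i _; rewrite mulrDl.
- by exists (fun i => a * c i); rewrite mulr_sumr; apply: eq_bigr => i _; rewrite mulrA.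
Qed.

Definition noetherian := forall I, is_ideal I ->
  exists s : seq A, (forall x, x \in s -> I x) /\ I `<=` ideal_span [set y | y \in s].

(** Without a maximal member, choice yields a strictly ascending sequence in the family; its union
    is an ideal, and finitely many generators of the union already lie in one term. *)
Lemma noetherian_max (Fam : set (set A)) :
  noetherian -> (forall I, Fam I -> is_ideal I) -> (exists I, Fam I) ->
  exists2 I, Fam I & forall J, Fam J -> I `<=` J -> J `<=` I.
Proof.
move=> noeth Fideal [I0 FI0]; apply: contrapT => nomax.
have next (I : {I | Fam I}) : exists J : {I | Fam I},
    sval I `<=` sval J /\ ~ (sval J `<=` sval I).
  case: I => I FI /=; apply: contrapT => hI; apply: nomax; exists I => // J FJ IJ.
  by apply: contrapT => JI; apply: hI; exists (exist _ J FJ).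
have [nx nxP] := choice next.
pose ch i := sval (iter i nx (exist _ I0 FI0)).
have chF i : Fam (ch i) by rewrite /ch; case: (iter _ _ _).
have chS i : ch i `<=` ch i.+1 by case: (nxP (iter i nx (exist _ I0 FI0))).
have chN i : ~ (ch i.+1 `<=` ch i) by case: (nxP (iter i nx (exist _ I0 FI0))).
have chm i j : (i <= j)%N -> ch i `<=` ch j.
  elim: j => [|j IH]; first by rewrite leqn0 => /eqP ->.
  rewrite leq_eqVlt => /predU1P[-> //|/IH ij x /ij /chS //].
pose U := [set x | exists i, ch i x].
have hU : is_ideal U.
  split=> [|x y [i xi] [j yj]|a x [i xi]].
  - by exists 0%N; apply: ideal0; apply: Fideal.
  - exists (maxn i j); apply: idealD; first exact: Fideal.
      exact: chm (leq_maxl _ _) _ xi.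
    exact: chm (leq_maxr _ _) _ yj.
  - by exists i; apply: idealMl => //; apply: Fideal.
have [s [sU Us]] := noeth U hU.
have [i si] : exists i, forall x, x \in s -> ch i x.
  elim: s sU {Us} => [|x s IH] sU; first by exists 0%N.
  have [y ys|i ih] := IH; first by apply: sU; rewrite inE ys orbT.
  have [j xj] := sU x (mem_head _ _).
  exists (maxn i j) => y; rewrite inE => /predU1P[->|/ih yi].
    exact: chm (leq_maxr _ _) _ xj.
  exact: chm (leq_maxl _ _) _ yi.
apply: (chN i) => x xi; apply: (span_min (Fideal _ (chF i)) si); apply: Us.
by exists i.+1.
Qed.

(** [satur p I] is the contraction of [I A_p] to [A]. *)
Definition saturated (p I : set A) := forall (t x : A), ~ p t -> I (t * x) -> I x.
Definition satur (p I : set A) := [set x | exists2 t, ~ p t & I (t * x)].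
Definition addI I J := [set x | exists y z, [/\ I y, J z & x = y + z]].
Definition princ x : set A := [set y | exists a, y = a * x].

Lemma princ_ideal x : is_ideal (princ x).
Proof.
split=> [|_ _ [a ->] [b ->]|a _ [b ->]].
- by exists 0; rewrite mul0r.
- by exists (a + b); rewrite mulrDl.
- by exists (a * b); rewrite mulrA.
Qed.

Lemma addI_ideal I J : is_ideal I -> is_ideal J -> is_ideal (addI I J).
Proof.
move=> hI hJ; split=> [|_ _ [y [z [Iy Jz ->]]] [y' [z' [Iy' Jz' ->]]]|a _ [y [z [Iy Jz ->]]]].
- by exists 0, 0; rewrite addr0; split=> //; apply: ideal0.
- by exists (y + y'), (z + z'); rewrite addrACA; split=> //; apply: idealD.
- by exists (a * y), (a * z); rewrite mulrDr; split=> //; apply: idealMl.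
Qed.

Lemma sub_addIl I J : is_ideal J -> I `<=` addI I J.
Proof. by move=> hJ x Ix; exists x, 0; rewrite addr0; split=> //; apply: ideal0. Qed.
Lemma sub_addIr I J : is_ideal I -> J `<=` addI I J.
Proof. by move=> hJ x Ix; exists 0, x; rewrite add0r; split=> //; apply: ideal0. Qed.

Lemma satur_ideal p I : prime_ideal p -> is_ideal I -> is_ideal (satur p I).
Proof.
move=> pp hI; have [_ p1 _] := pp.
split=> [|x y [t pt Itx] [t' pt' Ity]|a x [t pt Itx]].
- by exists 1 => //; rewrite mulr0; apply: ideal0.
- exists (t * t'); first exact: primeM.
  have -> : t * t' * (x + y) = t' * (t * x) + t * (t' * y) by ring.
  by apply: idealD => //; apply: idealMl.
- by exists t => //; rewrite mulrCA; apply: idealMl.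
Qed.

Lemma sub_satur p I : prime_ideal p -> I `<=` satur p I.
Proof. by move=> [_ p1 _] x Ix; exists 1; rewrite ?mul1r. Qed.

Lemma saturK p I : prime_ideal p -> saturated p (satur p I).
Proof.
move=> pp t x pt [t' pt']; rewrite mulrA => Itx.
by exists (t' * t) => //; apply: primeM.
Qed.

Lemma satur_min p I J : saturated p J -> I `<=` J -> satur p I `<=` J.
Proof. by move=> sJ IJ x [t pt /IJ]; apply: sJ. Qed.

End IdealBasics.

Section Krull.
Variable A : comPzRingType.
Hypothesis noeth : noetherian A.
Implicit Types (E I J B p q : set A) (x y z : A).

(** This is the Artinian property of [A_p / J], in the form needed: a descending chain pauses. Take
    [K] maximal among the ideals above which a chain without pause exists, and [y] outside [K] with
    [p y] contained in [K]. Chains above [K + (y)] do pause, and adding [y] to the terms of a chain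
    that avoids it identifies no two of them. *)
Lemma primary_dcc p J (Ch : nat -> set A) :
  prime_ideal p -> is_ideal J -> saturated p J ->
  (forall z, p z -> exists n, J (z ^+ n)) ->
  (forall n, [/\ is_ideal (Ch n), saturated p (Ch n), J `<=` Ch n & Ch n.+1 `<=` Ch n]) ->
  exists n, Ch n `<=` Ch n.+1.
Proof.
move=> pp hJ sJ pJ hCh; apply: contrapT => bad.
pose isch J (Ch : nat -> set A) := forall n,
  [/\ is_ideal (Ch n), saturated p (Ch n), J `<=` Ch n & Ch n.+1 `<=` Ch n].
pose Fam := [set J | [/\ is_ideal J, saturated p J,
  (forall z, p z -> exists n, J (z ^+ n)) &
  exists2 Ch, isch J Ch & ~ exists n, Ch n `<=` Ch n.+1]].
have [| |K [hK sK pK [{}Ch {}hCh {}bad]] Kmax] := @noetherian_max A Fam noeth.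
- by move=> I [].
- by exists J; split=> //; exists Ch.
move: J hJ sJ pJ => _ _ _ _.
have K1 : ~ K 1.
  move=> K1; apply: bad; exists 0%N => x _.
  by have [_ _ KC _] := hCh 1%N; apply: KC; rewrite -(mulr1 x); apply: idealMl.
pose colon y := [set z | K (z * y)].
have hcolon y : is_ideal (colon y).
  split=> [|u v hu hv|a u hu]; rewrite /colon /=.
  - by rewrite mul0r; apply: ideal0.
  - by rewrite mulrDl; apply: idealD.
  - by rewrite -mulrA; apply: idealMl.
have [| |_ [y Ky <-] ymax] :=
    @noetherian_max A [set colon y | y in [set y | ~ K y]] noeth.
- by move=> _ [y _ <-].
- by exists (colon 1), 1.
(* If [z * y] were outside [K], maximality would give [colon (z * y) = colon y], and no power of [z]
   could send [y] into [K]. *)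
have py z : p z -> K (z * y).
  move=> pz; apply: contrapT => Kzy.
  have sub : colon (z * y) `<=` colon y.
    apply: ymax; first by exists (z * y).
    by move=> u hu; rewrite /colon /= mulrCA; apply: idealMl.
  have nzn n : ~ K (z ^+ n * y).
    elim: n => [|n IH]; first by rewrite expr0 mul1r.
    by move=> h; apply: IH; apply: sub; rewrite /colon /= mulrA -exprSr.
  by have [n Kn] := pK z pz; apply: (nzn n); apply: idealMr.
pose K' := satur p (addI K (princ y)).
have hKy : is_ideal (addI K (princ y)) by apply: addI_ideal => //; apply: princ_ideal.
have hK' : is_ideal K' by apply: satur_ideal.
have sK' : saturated p K' by apply: saturK.
have KK' : K `<=` K'.
  by move=> x Kx; apply: sub_satur => //; apply: sub_addIl => //; apply: princ_ideal.
have K'y : K' y.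
  by apply: sub_satur => //; apply: sub_addIr => //; exists 1; rewrite mul1r.
have good Ch' : isch K' Ch' -> exists n, Ch' n `<=` Ch' n.+1.
  move=> hCh'; apply: contrapT => bad'.
  suff /Kmax/(_ KK')/(_ y K'y) : Fam K' by [].
  split=> //; last by exists Ch'.
  by move=> z /pK [n Kn]; exists n; apply: KK'.
have [ally|/existsNP [n0 Cn0]] := pselect (forall n, Ch n y).
  apply: bad; apply: good => n; have [h1 h2 h3 h4] := hCh n; split=> //.
  apply: satur_min => // _ [u [_ [Ku [a ->] ->]]].
  by apply: idealD => //; [apply: h3 | apply: idealMl].
have Cn n : ~ Ch (n0 + n)%N y.
  elim: n => [|n IH]; rewrite ?addn0 // addnS => h; apply: IH.
  by have [_ _ _] := hCh (n0 + n)%N; apply.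
have [|n hn] := @good (fun n => satur p (addI (Ch (n0 + n)%N) (princ y))).
  move=> n; have [hC sC KC Cdec] := hCh (n0 + n)%N.
  have hCy m : is_ideal (addI (Ch m) (princ y)).
    by apply: addI_ideal; [case: (hCh m) | exact: princ_ideal].
  split; first exact: satur_ideal.
  - exact: saturK.
  - apply: satur_min; first exact: saturK.
    move=> _ [u [v [Ku yv ->]]]; apply: sub_satur => //; exists u, v; split=> //.
    exact: KC.
  - apply: satur_min; first exact: saturK.
    move=> _ [u [v [Ku yv ->]]]; apply: sub_satur => //; exists u, v; split=> //.
    by rewrite addnS in Ku; apply: Cdec.
apply: bad; exists (n0 + n)%N => x Cx; have [hC sC KC Cdec] := hCh (n0 + n)%N.
have [hC' sC' KC' _] := hCh (n0 + n).+1.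
have [|t pt [b [_ [Cb [c ->] tx]]]] := hn x.
  by apply: sub_satur => //; apply: sub_addIl => //; apply: princ_ideal.
rewrite addnS in Cb; apply: (sC' t) => //; rewrite tx; apply: idealD => //.
(* If [c] were outside [p], saturation would put [y] in the chain; so [c] is in [p] and [c * y] is
   in [K]. *)
apply: KC'; apply: py; apply: contrapT => pc; apply: (Cn n); apply: (sC c) => //.
have -> : c * y = t * x - b by rewrite tx; ring.
by apply: idealB => //; [apply: idealMl | apply: Cdec].
Qed.

(** If [N A_p] is contained in [M A_p + p N A_p], then it is contained in [M A_p]. *)
Lemma nakayama p M N :
  prime_ideal p -> is_ideal M -> is_ideal N -> saturated p M ->
  (forall x, N x -> exists t m c, [/\ ~ p t, M m,
     ideal_span [set u | exists z y, [/\ p z, N y & u = z * y]] c & t * x = m + c]) ->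
  N `<=` M.
Proof.
move=> pp hM hN sM hNM; apply: contrapT => NM; have hp := prime_is_ideal pp.
have [| |K [hK sK MK NK] Kmax] := @noetherian_max A
    [set K | [/\ is_ideal K, saturated p K, M `<=` K & ~ (N `<=` K)]] noeth.
- by move=> I [].
- by exists M; split.
apply: NK => x Nx; have [t [m [c [pt Mm pNc tx]]]] := hNM x Nx.
apply: (sK t) => //; rewrite tx; apply: idealD => //; first exact: MK.
apply: (span_min hK) pNc => _ [z [y [pz Ny ->]]].
pose K' := satur p (addI K (princ (z * y))).
have hKzy : is_ideal (addI K (princ (z * y))) by apply: addI_ideal => //; apply: princ_ideal.
have KK' : K `<=` K'.
  by move=> w Kw; apply: sub_satur => //; apply: sub_addIl => //; apply: princ_ideal.
have [NK'|NK'] := pselect (N `<=` K'); last first.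
  apply: (Kmax K') => //; last first.
    by apply: sub_satur => //; apply: sub_addIr => //; exists 1; rewrite mul1r.
  by split=> //; [exact: satur_ideal | exact: saturK | move=> w /MK /KK'].
have [t' pt' [u [_ [Ku [a ->] ty]]]] := NK' y Ny.
(* In [t' * y = u + a * (z * y)] the factor [t' - a * z] of [y] is outside [p], because [z] is in
   [p]. *)
apply: idealMl => //; apply: (sK (t' - a * z)).
  move=> h; apply: pt'; rewrite -(subrK (a * z) t'); apply: idealD => //.
  exact: idealMl.
by rewrite mulrBl ty; have -> : u + a * (z * y) - a * z * y = u by ring.
Qed.

Fixpoint ipow q n : set A := if n is n'.+1 then
  ideal_span [set u | exists z y, [/\ q z, ipow q n' y & u = z * y]] else setT.

Lemma ipow_ideal q n : is_ideal (ipow q n).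
Proof. by case: n => [|n] //=; exact: span_ideal. Qed.

Lemma ipow_dec q n : ipow q n.+1 `<=` ipow q n.
Proof.
by apply: span_min; [exact: ipow_ideal | move=> _ [z [y [_ h ->]]]; apply: idealMl => //; exact: ipow_ideal].
Qed.

Lemma ipow_exp q n z : q z -> ipow q n (z ^+ n).
Proof.
move=> qz; elim: n => [|n IH] //; rewrite exprS; apply: subset_span.
by exists z, (z ^+ n).
Qed.

(** [q] is minimal over [B] when some power of each of its elements lies in
    [B A_q]. *)
Definition minimal_over q B :=
  forall z, q z -> exists n, satur q B (z ^+ n).

(** Krull's principal ideal theorem modulo [B], by symbolic powers. The ideals [Q n + (x)] pause at
    [p] because [p] is minimal over [B + (x)]; Nakayama's lemma at [p] gives [Q n = Q n.+1], and
    Nakayama's lemma at [q] then puts [q^n] in [B A_q]. *)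
Lemma principal_ideal_thm p q B x :
  prime_ideal p -> prime_ideal q -> is_ideal B -> B `<=` q -> q `<=` p ->
  p x -> ~ q x -> minimal_over p (addI B (princ x)) -> minimal_over q B.
Proof.
move=> pp pq hB Bq qp px qx pmin.
have [hq hp] := (prime_is_ideal pq, prime_is_ideal pp).
have np_q t : ~ p t -> ~ q t by move=> pt /qp.
pose Q n := satur q (addI B (ipow q n)).
have hBQ n : is_ideal (addI B (ipow q n)) by apply: addI_ideal => //; apply: ipow_ideal.
have hQ n : is_ideal (Q n) by apply: satur_ideal.
have sQ n : saturated q (Q n) by apply: saturK.
have BQ n : B `<=` Q n.
  by move=> b Bb; apply: sub_satur => //; apply: sub_addIl => //; apply: ipow_ideal.
have Qdec n : Q n.+1 `<=` Q n.
  apply: satur_min => // _ [b [u [Bb qu ->]]].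
  by apply: sub_satur => //; exists b, u; split=> //; apply: ipow_dec.
pose Ch n := satur p (addI (Q n) (princ x)).
have hQx n : is_ideal (addI (Q n) (princ x)) by apply: addI_ideal => //; apply: princ_ideal.
have hBx : is_ideal (addI B (princ x)) by apply: addI_ideal => //; apply: princ_ideal.
have [||||n hn] := @primary_dcc p (satur p (addI B (princ x))) Ch pp.
- exact: satur_ideal.
- exact: saturK.
- exact: pmin.
- move=> n; split; first exact: satur_ideal.
  + exact: saturK.
  + apply: satur_min; first exact: saturK.
    by move=> _ [b [u [Bb xu ->]]]; apply: sub_satur => //; exists b, u; split=> //; apply: BQ.
  + apply: satur_min; first exact: saturK.
    by move=> _ [b [u [Bb xu ->]]]; apply: sub_satur => //; exists b, u; split=> //; apply: Qdec.
(* An element of [Q n] is, up to a factor outside [p], of the form [b + c * x] with [b] in [Q n.+1];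
   then [c] itself is in [Q n], since [x] is outside [q] and [Q n] is saturated at [q]. *)
have QQ : Q n `<=` Q n.+1.
  apply: (@nakayama p) => //.
    by move=> t y /np_q; apply: sQ.
  move=> y Qy; have [|t pt [b [_ [Qb [c ->] ty]]]] := hn y.
    by apply: sub_satur => //; apply: sub_addIl => //; apply: princ_ideal.
  exists t, b, (c * x); split=> //; apply: subset_span; exists x, c; split=> //; last exact: mulrC.
  apply: (sQ n x) => //; have -> : x * c = t * y - b by rewrite ty; ring.
  by apply: idealB => //; [apply: idealMl | apply: Qdec].
have qB : ipow q n `<=` satur q B.
  apply: (@nakayama q) => //.
  - exact: satur_ideal.
  - exact: ipow_ideal.
  - exact: saturK.
  - move=> y qy; have [|s qs [b [c [Bb qc sy]]]] := QQ y.
      by apply: sub_satur => //; apply: sub_addIr.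
    by exists s, b, c; split=> //; apply: sub_satur.
by move=> z qz; exists n; apply: qB; apply: ipow_exp.
Qed.

Definition radical I := [set z | exists n, I (z ^+ n)].

Lemma radical_ideal I : is_ideal I -> is_ideal (radical I).
Proof.
move=> hI; split=> [|x y [n xn] [m ym]|a x [n xn]].
- by exists 1%N; rewrite expr1; apply: ideal0.
- exists (n + m)%N; rewrite exprDn; apply: ideal_sum => // i _.
  rewrite -mulr_natl; apply: idealMl => //.
  have [le|lt] := leqP m i.
    by rewrite -(subnKC le) exprD; apply: idealMl => //; apply: idealMr.
  have le : (n <= n + m - i)%N by lia.
  by rewrite -(subnKC le) exprD; apply: idealMr => //; apply: idealMr.
- by exists n; rewrite exprMn; apply: idealMl.
Qed.

(** Take [q] maximal among the saturated ideals containing [B] and no power of [z]. Two elements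
    outside [q] each enlarge it to an ideal containing a power of [z] at [p], so their product is
    outside [q]. Saturation forces [q] into [p]: an element of [q] outside [p] would give [1]. *)
Lemma max_avoiding_prime p B z :
  prime_ideal p -> is_ideal B -> saturated p B -> ~ radical B z ->
  exists q, [/\ prime_ideal q, B `<=` q, q `<=` p & ~ q z].
Proof.
move=> pp hB sB Bz.
have [| |q [hq sq Bq qz] qmax] := @noetherian_max A
    [set I | [/\ is_ideal I, saturated p I, B `<=` I & ~ radical I z]] noeth.
- by move=> I [].
- by exists B; split.
have q1 : ~ q 1 by move=> q1; apply: qz; exists 0%N.
have big x : ~ q x -> radical (satur p (addI q (princ x))) z.
  move=> qx; apply: contrapT => nz; apply: qx.
  have hqx : is_ideal (addI q (princ x)) by apply: addI_ideal => //; apply: princ_ideal.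
  apply: (qmax (satur p (addI q (princ x)))).
  - split=> //; first exact: satur_ideal.
      exact: saturK.
    by move=> b /Bq qb; apply: sub_satur => //; apply: sub_addIl => //; apply: princ_ideal.
  - by move=> b qb; apply: sub_satur => //; apply: sub_addIl => //; apply: princ_ideal.
  - by apply: sub_satur => //; apply: sub_addIr => //; exists 1; rewrite mul1r.
exists q; split=> //.
- split; first exact/is_idealP.
    exact: q1.
  move=> x y qxy; apply: contrapT => /not_orP [/big [n [t pt [a [_ [qa [c ->] tz]]]]]].
  move=> /big [m [t' pt' [a' [_ [qa' [c' ->] tz']]]]].
  apply: qz; exists (n + m)%N; apply: (sq (t * t')); first exact: primeM.
  have -> : t * t' * z ^+ (n + m) = (t * z ^+ n) * (t' * z ^+ m) by rewrite exprD; ring.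
  rewrite tz tz'.
  have -> : (a + c * x) * (a' + c' * y) = a * (a' + c' * y) + c * x * a' + c * c' * (x * y) by ring.
  by do 2?apply: idealD => //; [apply: idealMr | apply: idealMl | apply: idealMl].
- move=> x qx; apply: contrapT => px; apply: q1; apply: (sq x) => //.
  by rewrite mulr1.
- by move=> h; apply: qz; exists 1%N; rewrite expr1.
Qed.

(** Induction on [e] by an exchange of generators. Let [q'] be maximal among the primes strictly
    below [p] and above [q e], and [x] in [xs] outside [q']. Since [p] is minimal over [q' + (x)],
    every other generator has a power congruent modulo [x], at [p], to an element of [q']. These
    elements are one fewer than [xs], and [q'] is minimal over them by the principal ideal
    theorem. *)
Lemma krull_height p (xs : seq A) e :
  prime_ideal p -> (forall x, x \in xs -> p x) ->
  minimal_over p (ideal_span [set y | y \in xs]) -> prime_chain p e ->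
  (e <= size xs)%N.
Proof.
elim: e p xs => [|e IH] // p xs pp xsp pmin [q [qP qlt]].
have hp := prime_is_ideal pp.
have [||q' [pq' qq' [q'p nq'p]] q'max] := @noetherian_max A
    [set I | [/\ prime_ideal I, q e `<=` I & I `<=` p /\ I <> p]] noeth.
- by move=> I [/prime_is_ideal].
- have [pqe qep] := qP e (leqnSn e); have [pqe1 qe1p] := qP e.+1 (leqnn _).
  have [sub ne] := qlt e (ltnSn e).
  by exists (q e); split=> //; split=> // eqp; apply: ne; rewrite eqEsubset; split=> //; rewrite eqp.
have hq' := prime_is_ideal pq'.
have [x xxs q'x] : exists2 x, x \in xs & ~ q' x.
  apply: contrapT => hx; apply: nq'p; rewrite eqEsubset; split=> // z /pmin [n [t pt tz]].
  have sub : ideal_span [set y | y \in xs] `<=` q'.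
    by apply: span_min => // y yxs; apply: contrapT => q'y; apply: hx; exists y.
  have [_ _ q'M] := pq'; have [/q'p //|/(prime_exp pq') //] := q'M _ _ (sub _ tz).
have px := xsp x xxs.
have hq'x : is_ideal (addI q' (princ x)) by apply: addI_ideal => //; apply: princ_ideal.
have pminx : minimal_over p (addI q' (princ x)).
  move=> z pz; apply: contrapT => nz.
  have [|||r [pr qr rp rz]] := @max_avoiding_prime p (satur p (addI q' (princ x))) z pp.
  - exact: satur_ideal.
  - exact: saturK.
  - exact: nz.
  have {}qr : addI q' (princ x) `<=` r by move=> y hy; apply: qr; apply: sub_satur.
  have q'r : q' `<=` r by move=> y hy; apply: qr; apply: sub_addIl => //; apply: princ_ideal.
  apply: q'x; apply: (q'max r) => //.
    by split=> // [y /qq' /q'r //|]; split=> // rpE; apply: rz; rewrite rpE.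
  by apply: qr; apply: sub_addIr => //; exists 1; rewrite mul1r.
have red y : exists b, y \in xs ->
    [/\ q' b & exists t n c, ~ p t /\ t * y ^+ n = b + c * x].
  have [yxs|] := boolP (y \in xs); last by exists 0.
  have [n [t pt [b [_ [q'b [c ->] e1]]]]] := pminx y (xsp y yxs).
  by exists b => _; split=> //; exists t, n, c.
have [b bP] := choice red.
pose bs := [seq b y | y <- rem x xs].
have size_bs : size bs = (size xs).-1 by rewrite size_map size_rem.
have remP y : y \in rem x xs -> y \in xs by apply: mem_rem.
pose B := ideal_span [set y | y \in bs].
have hB : is_ideal B by apply: span_ideal.
have Bq' : B `<=` q'.
  by apply: span_min => // _ /mapP [y /remP /bP [q'b _] ->].
have hBx : is_ideal (addI B (princ x)) by apply: addI_ideal => //; apply: princ_ideal.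
have sBx : is_ideal (satur p (addI B (princ x))) by apply: satur_ideal.
have pminB : minimal_over p (addI B (princ x)).
  have hrad := radical_ideal sBx.
  have sub : ideal_span [set y | y \in xs] `<=` radical (satur p (addI B (princ x))).
    apply: span_min => // y yxs; have [->|yx] := eqVneq y x.
      exists 1%N; rewrite expr1; apply: sub_satur => //; apply: sub_addIr => //.
      by exists 1; rewrite mul1r.
    have yrem : y \in rem x xs.
      by have : y \in xs := yxs; rewrite (perm_mem (perm_to_rem xxs)) inE (negbTE yx).
    have [_ [t [n [c [pt tE]]]]] := bP y yxs.
    exists n, t => //; rewrite tE; exists (b y), (c * x); split=> //; last by exists c.
    by apply: subset_span; apply: (map_f b yrem).
  move=> z /pmin [n [t pt /sub [m [t' pt' h]]]].
  exists (n * m)%N, (t' * t ^+ m); first by apply: primeM => // /(prime_exp pp).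
  by rewrite exprM -mulrA -exprMn.
have qmin := principal_ideal_thm pp pq' hB Bq' q'p px q'x pminB.
have : (e <= size bs)%N.
  apply: (IH q') => //; first by move=> _ /mapP [y /remP /bP [q'b _] ->].
  exists q; split=> i ie; last by apply: qlt; lia.
  split; first by have [|h _] := qP i; [lia | exact: h].
  have chm : forall j, (i <= j)%N -> (j <= e)%N -> q i `<=` q j.
    elim=> [|j IHj]; first by rewrite leqn0 => /eqP -> _ y.
    rewrite leq_eqVlt => /predU1P[-> _ y //|ij je y /IHj h]; have [|sub _] := qlt j; first lia.
    by apply: sub; apply: h => //; lia.
  by move=> y /(chm e ie (leqnn e)) /qq'.
rewrite size_bs; case: xs xxs {xsp pmin red bP bs size_bs remP B hB Bq' hBx sBx pminB qmin} => //=.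
Qed.

End Krull.

(** * Noetherian rings and Hilbert's basis theorem *)

Section HilbertBasis.

Lemma noetherian_surj (A B : comPzRingType) (g : {rmorphism A -> B}) :
  (forall y, exists x, g x = y) -> noetherian A -> noetherian B.
Proof.
move=> gsurj noeth I hI.
have hJ : is_ideal (g @^-1` I).
  split=> [|x y|a x] /=.
  - by rewrite rmorph0; apply: ideal0.
  - by rewrite rmorphD; apply: idealD.
  - by rewrite rmorphM; apply: idealMl.
have [s [sI Is]] := noeth _ hJ.
exists (map g s); split=> [_ /mapP [x /sI xI ->] //|y].
have [x <-] := gsurj y => /(Is x) [n [c [h [hs ->]]]].
exists n, (fun i => g (c i)), (fun i => g (h i)); split=> [i|].
  exact: (map_f g (hs i)).
by rewrite rmorph_sum; apply: eq_bigr => i _; rewrite rmorphM.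
Qed.

Lemma noetherian_field (k : fieldType) : noetherian k.
Proof.
move=> I hI; have [[x Ix x0]|h] := pselect (exists2 x, I x & x <> 0).
  exists [:: x]; split=> [y|y Iy]; first by rewrite inE => /eqP ->.
  exists 1%N, (fun=> y / x), (fun=> x); split=> [i|]; first exact: mem_head.
  by rewrite big_ord1 divfK //; apply/eqP.
exists [::]; split=> // x Ix; have -> : x = 0 by apply: contrapT => x0; apply: h; exists x.
exact: ideal0 (span_ideal _).
Qed.

(** The ideals [L d] of coefficients of [X^d] in the elements of [I] of degree at most [d] increase
    and are constant from some [D] on. Lifts of generators of [L d], [d <= D], generate [I]: the top
    coefficient is cancelled by induction on the size. *)
Lemma hilbert_basis (B : comNzRingType) : noetherian B -> noetherian {poly B}.
Proof.
move=> noeth I hI.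
pose L d := [set c | exists f : {poly B}, [/\ I f, (size f <= d.+1)%N & f`_d = c]].
have hL d : is_ideal (L d).
  split=> [|_ _ [f [If sf <-]] [g [Ig sg <-]]|a _ [f [If sf <-]]].
  - by exists 0; rewrite size_poly0 coef0; split=> //; apply: ideal0.
  - exists (f + g); rewrite coefD; split=> //; first exact: idealD.
    by rewrite (leq_trans (size_polyD _ _)) // geq_max sf.
  - exists (a%:P * f); rewrite coefCM; split=> //; first exact: idealMl.
    by rewrite mul_polyC (leq_trans (size_scale_leq _ _)).
have Lm d e : (d <= e)%N -> L d `<=` L e.
  move=> de _ [f [If sf <-]]; exists ('X^(e - d) * f); split; first exact: idealMl.
    apply/leq_sizeP => j ej; rewrite coefXnM; case: ltnP => // dj.
    by apply: (leq_sizeP _ _ sf); lia.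
  by rewrite coefXnM ltnNge leq_subr /= subKn.
have gens d : exists t : seq {poly B}, (forall f, f \in t -> I f /\ (size f <= d.+1)%N) /\
    L d `<=` ideal_span [set y | y \in [seq f`_d | f : {poly B} <- t]].
  have [s [sL Ls]] := noeth _ (hL d).
  have ex c : exists f : {poly B}, c \in s -> [/\ I f, (size f <= d.+1)%N & f`_d = c].
    have [/sL [f hf]|_] := boolP (c \in s); first by exists f.
    by exists 0.
  have [F FP] := choice ex; exists (map F s); split=> [_ /mapP [c /FP [h1 h2 _] ->] //|c /Ls].
  apply: span_sub => x /= xs; apply/mapP; exists (F x); first exact: map_f.
  by have [_ _ ->] := FP x xs.
have [t tP] := choice gens.
pose U := [set c | exists d, L d c].
have hU : is_ideal U.
  split=> [|x y [d xd] [e ye]|a x [d xd]].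
  - by exists 0%N; apply: ideal0.
  - exists (maxn d e); apply: idealD; first exact: hL.
      exact: Lm (leq_maxl _ _) _ xd.
    exact: Lm (leq_maxr _ _) _ ye.
  - by exists d; apply: idealMl.
have [s [sU Us]] := noeth U hU.
have [D sD] : exists D, forall x, x \in s -> L D x.
  elim: s sU {Us} => [|x s IH] sU; first by exists 0%N.
  have [y ys|i ih] := IH; first by apply: sU; rewrite inE ys orbT.
  have [j xj] := sU x (mem_head _ _).
  exists (maxn i j) => y; rewrite inE => /predU1P[->|/ih yi].
    exact: Lm (leq_maxr _ _) _ xj.
  exact: Lm (leq_maxl _ _) _ yi.
have UD : U `<=` L D by move=> x /Us; apply: span_min.
pose G := flatten [seq t d | d <- iota 0 D.+1].
have hG := span_ideal [set y | y \in G].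
have GI f : f \in G -> I f.
  by case/flattenP => _ /mapP [d _ ->] /(tP d).1 [].
have tG d : (d <= D)%N -> [set y | y \in t d] `<=` [set y | y \in G].
  move=> dD y yt; apply/flattenP; exists (t d) => //.
  by apply: map_f; rewrite mem_iota.
exists G; split=> // f If.
have [n] := ubnP (size f); elim: n => // n IH in f If *; rewrite ltnS => sf.
case: n IH sf => [|n] IH sf.
  have -> : f = 0 by apply/eqP; rewrite -size_poly_leq0.
  exact: ideal0.
pose e := minn n D.
have eD : (e <= D)%N by rewrite geq_minr.
have en : (e <= n)%N by rewrite geq_minl.
have Lf : L n f`_n by exists f.
have {Lf} Le : L e f`_n.
  rewrite /e; case: (leqP n D) => // Dn; apply: UD; by exists n.
have := (span_seqP _ _).1 ((tP e).2 _ Le); rewrite size_map => -[c cE].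
pose g := \sum_(i < size (t e)) (c i)%:P * 'X^(n - e) * (t e)`_i.
have Gg : ideal_span [set y | y \in G] g.
  apply: ideal_sum => // i _; apply: (idealMl _ hG); apply: subset_span.
  by apply: (tG e eD); apply: mem_nth.
have Ig : I g by apply: (span_min hI GI) Gg.
have sg : (size g <= n.+1)%N.
  apply/leq_sizeP => j nj; rewrite coef_sum big1 // => i _.
  rewrite -mulrA coefCM coefXnM; case: ltnP => ej; first by rewrite mulr0.
  have [_ sz] := (tP e).1 _ (mem_nth 0 (ltn_ord i)).
  by rewrite (leq_sizeP _ _ sz) ?mulr0 //; lia.
have gn : g`_n = f`_n.
  rewrite cE coef_sum; apply: eq_bigr => i _.
  rewrite (nth_map 0) // -mulrA coefCM coefXnM ltnNge leq_subr /=.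
  by rewrite subKn.
rewrite -(subrK g f); apply: idealD => //; apply: IH; first exact: idealB.
rewrite ltnS; apply/leq_sizeP => j nj; rewrite coefB.
have [<-|ne] := eqVneq n j; first by rewrite gn subrr.
by rewrite (leq_sizeP _ _ sf) ?(leq_sizeP _ _ sg) ?subrr //; lia.
Qed.

(** That [ys] generates [A] as an algebra is stated as an induction principle. Evaluation at the
    head of [ys] turns [A] into an algebra over [{poly B}] generated by the tail. *)
Lemma noetherian_generated (A B : comNzRingType) (g : {rmorphism B -> A}) (ys : seq A) :
  noetherian B ->
  (forall Q : set A, (forall b, Q (g b)) -> (forall y, y \in ys -> Q y) ->
     (forall x y, Q x -> Q y -> Q (x + y)) -> (forall x y, Q x -> Q y -> Q (x * y)) ->
     forall x, Q x) ->
  noetherian A.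
Proof.
elim: ys B g => [|y ys IH] B g noeth gen.
  apply: (@noetherian_surj _ _ g) noeth; apply: gen => //.
  - by move=> b; exists b.
  - by move=> _ _ [a <-] [b <-]; exists (a + b); rewrite rmorphD.
  - by move=> _ _ [a <-] [b <-]; exists (a * b); rewrite rmorphM.
have cg : commr_rmorph g y by move=> b; apply: mulrC.
apply: (IH {poly B} (horner_morph cg)); first exact: hilbert_basis.
move=> Q Qg Qys QD QM; apply: gen => // [b|z].
  by have := Qg b%:P; rewrite /= horner_morphC.
rewrite inE => /predU1P[->|]; last exact: Qys.
by have := Qg 'X; rewrite /= horner_morphX.
Qed.

Lemma noetherian_mpoly (B : comNzRingType) n : noetherian B -> noetherian {mpoly B[n]}.
Proof.
move=> noeth; apply: (@noetherian_generated _ B (@mpolyC n B) [seq 'X_i | i : 'I_n]) noeth _.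
move=> Q QC QX QD QM.
have QXm m : Q 'X_[m].
  rewrite mpolyXE_id; apply: (big_ind Q) => // [|i _]; first by rewrite -mpolyC1; exact: QC.
  elim: (m i) => [|e IH]; first by rewrite expr0 -mpolyC1; exact: QC.
  rewrite exprS; apply: QM => //; apply: QX; apply/mapP; exists i => //.
  by rewrite mem_enum.
move=> p; rewrite [p]mpolyE; apply: (big_ind Q) => // [|m _].
  by rewrite -mpolyC0; exact: QC.
by rewrite -mul_mpolyC; apply: QM => //; exact: QC.
Qed.

Lemma noetherian_quotient (A : comPzRingType) (E : set A) :
  noetherian A -> noetherian (quotient E).
Proof. exact: (@noetherian_surj _ _ (quo E) (@quo_surj _ E)). Qed.

End HilbertBasis.

(** * Power series *)

Section Dickson.
Variable N : nat.
Local Notation X := 'X_{1..N}.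

(** Induction on the number [n] of coordinates compared. If [K] bounds the next coordinate on the
    finite set found for [n], that set still serves the exponents whose next coordinate is at least
    [K]; the others are split according to the value of that coordinate. *)
Lemma dickson (E : set X) :
  exists s : seq X, (forall e, e \in s -> E e) /\
    forall m, E m -> exists2 e, e \in s & (e <= m)%MM.
Proof.
suff H n : forall E : set X, exists s : seq X, (forall e, e \in s -> E e) /\
    forall m, E m -> exists2 e, e \in s & forall i : 'I_N, (i < n)%N -> (e i <= m i)%N.
  have [s [sE Es]] := H N E; exists s; split=> // m /Es [e es le].
  by exists e => //; apply/mnm_lepP => i; apply: le.
elim: n => [|n IH] {}E.
  have [[m Em]|h] := pselect (exists m, E m).
    by exists [:: m]; split=> [e|m' _]; [rewrite inE => /eqP -> | exists m; rewrite ?mem_head].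
  by exists [::]; split=> // m Em; case: h; exists m.
have [s [sE Es]] := IH E.
have [nN|Nn] := ltnP n N; last first.
  exists s; split=> // m /Es [e es le]; exists e => // i _; apply: le.
  exact: leq_trans (ltn_ord i) Nn.
pose j := Ordinal nN; pose K := (\max_(e <- s) e j)%N.
have [t tP] := choice (fun v => IH [set m | E m /\ m j = v]).
exists (s ++ flatten [seq t v | v <- iota 0 K]); split=> [e|m Em].
  rewrite mem_cat => /orP[/sE //|/flattenP [_ /mapP [v _ ->] /(tP v).1 []]] //.
have [le|lt] := leqP K (m j).
  have [e es em] := Es m Em; exists e; first by rewrite mem_cat es.
  move=> i; rewrite ltnS leq_eqVlt => /predU1P[ij|/em //].
  have -> : i = j by apply: val_inj.
  apply: leq_trans le; rewrite /K; elim: s es {sE Es em K} => //= x s IHs.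
  by rewrite inE big_cons leq_max => /predU1P[->|/IHs ->]; rewrite ?leqnn ?orbT.
have [e et em] := (tP (m j)).2 m (conj Em erefl); exists e.
  rewrite mem_cat; apply/orP; right; apply/flattenP; exists (t (m j)) => //.
  by apply: map_f; rewrite mem_iota.
move=> i; rewrite ltnS leq_eqVlt => /predU1P[ij|/em //].
have -> : i = j by apply: val_inj.
by have [_ ->] := (tP (m j)).1 e et.
Qed.

End Dickson.

Section SeriesBasics.
Variables (N : nat) (k : comNzRingType).
Local Notation S := (mseries N k).
Local Notation X := 'X_{1..N}.
Implicit Types (f g h : S) (m p q e : X).

Lemma coefD f g m : coef (f + g) m = coef f m + coef g m. Proof. by []. Qed.
Lemma coefN f m : coef (- f) m = - coef f m. Proof. by []. Qed.
Lemma coefB f g m : coef (f - g) m = coef f m - coef g m. Proof. by []. Qed.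
Lemma coef0 m : coef (0 : S) m = 0. Proof. by []. Qed.
Lemma coef1 m : coef (1 : S) m = (m == 0%MM)%:R. Proof. by []. Qed.
Lemma coef_sum (T : Type) (r : seq T) (P : pred T) (F : T -> S) m :
  coef (\sum_(i <- r | P i) F i) m = \sum_(i <- r | P i) coef (F i) m.
Proof. exact: (big_morph (fun f => coef f m) (fun f g => coefD f g m) (coef0 m)). Qed.

Lemma coefM f g m : coef (f * g) m =
  \sum_(p : 'X_{1..N < (mdeg m).+1, (mdeg m).+1} | m == (p.1 + p.2)%MM)
    coef f p.1 * coef g p.2.
Proof. by []. Qed.

Lemma coefM_supp f g m : coef (f * g) m <> 0 ->
  exists p q, [/\ m = (p + q)%MM, coef f p <> 0 & coef g q <> 0].
Proof.
move=> nz; apply: contrapT => h; apply: nz; rewrite coefM big1 // => -[p q] /= /eqP mE.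
apply: contrapT => nz; apply: h; exists p, q; split=> // z; apply: nz.
  by rewrite z mul0r.
by rewrite z mulr0.
Qed.

Lemma series_of_poly_zmod : zmod_morphism (@series_of_poly N k).
Proof. by move=> p q; apply: mseriesP => m; rewrite coefB /= mcoeffB. Qed.
HB.instance Definition _ :=
  GRing.isZmodMorphism.Build {mpoly k[N]} S (@series_of_poly N k) series_of_poly_zmod.
Lemma series_of_poly_monoid : monoid_morphism (@series_of_poly N k).
Proof.
split=> [|p q]; apply: mseriesP => m; first by rewrite coef1 /= mcoeff1.
by rewrite coefM /= mcoeffM.
Qed.
HB.instance Definition _ :=
  GRing.isMonoidMorphism.Build {mpoly k[N]} S (@series_of_poly N k) series_of_poly_monoid.

Definition sX m : S := series_of_poly 'X_[m].

Lemma coef_sX m p : coef (sX m) p = (m == p)%:R.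
Proof. by rewrite /= mcoeffX. Qed.
Lemma sXD m p : sX (m + p)%MM = sX m * sX p.
Proof. by rewrite /sX mpolyXD rmorphM. Qed.
Lemma sX0 : sX 0%MM = 1.
Proof. by rewrite /sX mpolyX0 rmorph1. Qed.

Definition sC (c : k) : S := series_of_poly c%:MP.

Lemma coef_sC c m : coef (sC c) m = c * (m == 0%MM)%:R.
Proof. by rewrite /= mcoeffC. Qed.
Lemma sCM c d : sC (c * d) = sC c * sC d.
Proof. by rewrite /sC mpolyCM rmorphM. Qed.
Lemma series_of_polyZ c (p : {mpoly k[N]}) :
  series_of_poly (c *: p) = sC c * series_of_poly p.
Proof. by rewrite -mul_mpolyC rmorphM. Qed.

Definition shift e f : S := MSeries (fun m => coef f (m + e)%MM).

Lemma coef_sXM e f m : coef (sX e * f) m = if (e <= m)%MM then coef f (m - e)%MM else 0.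
Proof.
case: ifP => em; last first.
  apply: contrapT => /coefM_supp [p [q [mE]]]; rewrite coef_sX.
  by case: eqP => // pe _ _; move: em; rewrite mE pe lem_addr.
have b1 : (mdeg e < (mdeg m).+1)%N by rewrite ltnS -(submK em) mdegD leq_addl.
have b2 : (mdeg (m - e)%MM < (mdeg m).+1)%N by rewrite ltnS mdegB.
rewrite coefM (bigD1 (BMultinom b1, BMultinom b2)) /=; last by rewrite addmC submK.
rewrite mcoeffX eqxx mul1r big1 ?addr0 // => -[p q] /= /andP [/eqP mE ne].
rewrite mcoeffX; case: eqP => [ep|_]; last by rewrite mul0r.
case/eqP: ne; congr (_, _); apply: val_inj => //=.
by rewrite [X in (X - _)%MM]mE ep addmC addmK.
Qed.

Lemma coef_sCM c f m : coef (sC c * f) m = c * coef f m.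
Proof.
have b1 : (mdeg (0%MM : X) < (mdeg m).+1)%N by rewrite mdeg0.
have b2 : (mdeg m < (mdeg m).+1)%N by [].
rewrite coefM (bigD1 (BMultinom b1, BMultinom b2)) /=; last by rewrite add0m.
rewrite mcoeffC eqxx mulr1 big1 ?addr0 // => -[p q] /= /andP [/eqP mE ne].
rewrite mcoeffC; case: eqP => [ep|_]; last by rewrite mulr0 mul0r.
case/eqP: ne; congr (_, _); apply: val_inj => //=.
by rewrite [RHS]mE ep add0m.
Qed.

(** Subtracting [sX e * shift e f] deletes exactly the terms of [f] divisible by [u^e], infinitely
    many at once. *)
Lemma split_generators (es : seq X) f :
  (forall m, coef f m <> 0 -> exists2 e, e \in es & (e <= m)%MM) ->
  exists g : nat -> S, f = \sum_(i < size es) sX (nth 0%MM es i) * g i.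
Proof.
elim: es f => [|e es IH] f hf.
  exists (fun=> 0); rewrite big_ord0; apply: mseriesP => m.
  by apply: contrapT => /hf [].
have [|g gE] := IH (f - sX e * shift e f).
  move=> m; rewrite coefB coef_sXM; case: ifP => [em|em].
    by rewrite /= submK // subrr.
  by rewrite subr0 => /hf [e']; rewrite inE => /predU1P[->|]; [rewrite em | exists e'].
exists (fun i => if i is j.+1 then g j else shift e f).
by rewrite big_ord_recl -[f in LHS](subrK (sX e * shift e f)) gE addrC.
Qed.

End SeriesBasics.

Section Approximation.
Variables (N : nat) (k : comNzRingType) (lw : 'X_{1..N} -> nat).
Hypothesis lwD : forall m p, lw (m + p)%MM = (lw m + lw p)%N.
Local Notation S := (mseries N k).
Local Notation X := 'X_{1..N}.
Implicit Types (f g h : S) (m p q : X).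

Definition ordge d f := forall m, coef f m <> 0 -> (d <= lw m)%N.

Lemma ordge_lt d f m : ordge d f -> (lw m < d)%N -> coef f m = 0.
Proof. by move=> fd md; apply: contrapT => /fd; rewrite leqNgt md. Qed.

Lemma ordge0 d : ordge d 0.
Proof. by move=> m. Qed.

Lemma ordgeD d f g : ordge d f -> ordge d g -> ordge d (f + g).
Proof.
move=> fd gd m; rewrite coefD => nz; rewrite leqNgt; apply/negP => lt; apply: nz.
by rewrite (ordge_lt fd) ?(ordge_lt gd) ?addr0.
Qed.

Lemma ordgeN d f : ordge d f -> ordge d (- f).
Proof. by move=> fd m; rewrite coefN => nz; apply: fd => z; apply: nz; rewrite z oppr0. Qed.

Lemma ordgeB d f g : ordge d f -> ordge d g -> ordge d (f - g).
Proof. by move=> fd gd; apply: ordgeD => //; apply: ordgeN. Qed.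

Lemma ordgeM d e f g : ordge d f -> ordge e g -> ordge (d + e) (f * g).
Proof.
move=> fd ge m /coefM_supp [p [q [-> /fd hp /ge hq]]].
by rewrite lwD leq_add.
Qed.

Lemma ordge_leq d e f : (d <= e)%N -> ordge e f -> ordge d f.
Proof. by move=> de fe m /fe; apply: leq_trans. Qed.

Lemma ordge_sum d (T : Type) (r : seq T) (F : T -> S) :
  (forall i, ordge d (F i)) -> ordge d (\sum_(i <- r) F i).
Proof. by move=> h; apply: (big_ind (ordge d)) => //; exact: ordgeD. Qed.

Lemma ordge_eq0 f : (forall d, ordge d f) -> f = 0.
Proof.
by move=> h; apply: mseriesP => m; apply: (ordge_lt (h (lw m).+1)).
Qed.

(** Only the [H d] with [d <= lw m + c] can reach the monomial [m], so each coefficient of the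
    infinite sum is a finite sum. *)
Lemma series_sum c (H : nat -> S) : (forall d, ordge (d - c) (H d)) ->
  exists2 h, (forall n, ordge (n - c) (h - \sum_(d < n) H d)) &
    forall m, coef h m <> 0 -> exists d, coef (H d) m <> 0.
Proof.
move=> Hd; exists (MSeries (fun m => \sum_(d < (lw m + c).+1) coef (H d) m)); last first.
  move=> m nz; apply: contrapT => h; apply: nz => /=; rewrite big1 // => d _.
  by apply: contrapT => nz; apply: h; exists d.
move=> n m; rewrite coefB coef_sum /= => nz; rewrite leqNgt; apply/negP => lt; apply: nz.
have le : ((lw m + c).+1 <= n)%N by lia.
rewrite -(big_mkord xpredT (fun d => coef (H d) m)).
rewrite -(big_mkord xpredT (fun d => coef (H d) m)).
rewrite (big_cat_nat (leq0n _) le) /=.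
have -> : \sum_((lw m + c).+1 <= d < n) coef (H d) m = 0.
  by rewrite big_nat_cond big1 // => d /andP [/andP [h1 h2] _]; apply: (ordge_lt (Hd d)); lia.
by rewrite addr0 subrr.
Qed.

(** Successive approximation for the filtration by [lw]. The set [P] is an invariant of the
    remainders, [M] a condition on the monomials of the result, and [c] the fixed loss of order
    allowed in the multipliers of the [F l], small enough for these multipliers to be summed. *)
Lemma series_approx (s : nat) (F : 'I_s -> S) (c : nat) (M : set X) (P : set S) :
  (forall d f, P f -> ordge d f -> exists (h : 'I_s -> S) (g : S),
     [/\ forall l, ordge (d - c) (h l), ordge d g, forall m, coef g m <> 0 -> M m,
         P (f - g - \sum_l h l * F l) & ordge d.+1 (f - g - \sum_l h l * F l)]) ->
  forall f, P f -> exists (h : 'I_s -> S) (g : S),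
    (forall m, coef g m <> 0 -> M m) /\ f = g + \sum_l h l * F l.
Proof.
move=> step f Pf.
have step' (df : nat * S) : exists hg : ('I_s -> S) * S, P df.2 -> ordge df.1 df.2 ->
     [/\ forall l, ordge (df.1 - c) (hg.1 l), ordge df.1 hg.2, forall m, coef hg.2 m <> 0 -> M m,
         P (df.2 - hg.2 - \sum_l hg.1 l * F l) & ordge df.1.+1 (df.2 - hg.2 - \sum_l hg.1 l * F l)].
  case: df => d x; have [[Px xd]|h] := pselect (P x /\ ordge d x); last first.
    by exists (fun=> 0, 0) => /= Px xd; case: h.
  by have [h [g ?]] := step d x Px xd; exists (h, g).
have [C hC] := choice step'.
pose fix fs d := if d is d'.+1 then
  let hg := C (d', fs d') in fs d' - hg.2 - \sum_l hg.1 l * F l else f.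
have fsP d : P (fs d) /\ ordge d (fs d).
  elim: d => [|d [Pd od]]; first by split=> // m.
  by have [] := hC (d, fs d) Pd od.
pose H d := (C (d, fs d)).1; pose G d := (C (d, fs d)).2.
have hH d l : ordge (d - c) (H d l).
  by have [h _ _ _ _] := hC (d, fs d) (fsP d).1 (fsP d).2; exact: h.
have hG d : ordge (d - 0) (G d).
  by rewrite subn0; have [] := hC (d, fs d) (fsP d).1 (fsP d).2.
have GM d m : coef (G d) m <> 0 -> M m.
  by have [_ _ h _ _] := hC (d, fs d) (fsP d).1 (fsP d).2; exact: h.
have fE n : f = fs n + \sum_(d < n) G d + \sum_l (\sum_(d < n) H d l) * F l.
  elim: n => [|n IH].
    by rewrite big_ord0 big1 ?addr0 // => l _; rewrite big_ord0 mul0r.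
  rewrite {1}IH /= -/(H n) -/(G n) big_ord_recr /=.
  have -> : \sum_l (\sum_(d < n.+1) H d l) * F l =
      \sum_l (\sum_(d < n) H d l) * F l + \sum_l H n l * F l.
    by rewrite -big_split; apply: eq_bigr => l _; rewrite big_ord_recr mulrDl.
  rewrite -/(H n); ring.
have hsum l : exists h, forall n, ordge (n - c) (h - \sum_(d < n) H d l).
  by have [h ? _] := @series_sum c (fun d => H d l) (fun d => hH d l); exists h.
have {hsum} [h hh] := choice hsum.
have [g gg gM] := series_sum hG.
exists h, g; split; first by move=> m /gM [d /GM].
apply/eqP; rewrite -subr_eq0; apply/eqP/ordge_eq0 => d.
(* The comparison is made after [d + c] steps, so that each of the three errors has order at least
   [d] in spite of the loss [c]. *)
have -> : f - (g + \sum_l h l * F l) = fs (d + c)%N - (g - \sum_(d < d + c) G d)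
    - \sum_l (h l - \sum_(d < d + c) H d l) * F l.
  rewrite [in LHS](fE (d + c)%N).
  have -> : \sum_l (h l - \sum_(d < d + c) H d l) * F l =
      \sum_l h l * F l - \sum_l (\sum_(d < d + c) H d l) * F l.
    by rewrite -sumrB; apply: eq_bigr => l _; rewrite mulrBl.
  ring.
apply: ordgeB; first apply: ordgeB.
- by apply: (@ordge_leq _ (d + c)%N); [lia | case: (fsP (d + c)%N)].
- by apply: (@ordge_leq _ (d + c - 0)%N); [lia | exact: gg].
- apply: ordge_sum => l; apply: (@ordge_leq _ (d + 0)%N); first by lia.
  apply: ordgeM; last by move=> m.
  by apply: (@ordge_leq _ (d + c - c)%N); [lia | exact: hh].
Qed.

End Approximation.

Section FieldSeries.
Variables (N : nat) (k : fieldType).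
Local Notation S := (mseries N k).
Local Notation X := 'X_{1..N}.

Lemma series_unit (f : S) : coef f 0%MM <> 0 -> exists g, f * g = 1.
Proof.
(* With [M] empty the remainder [g] must vanish, and [1] becomes a multiple of [f]; each step
   divides by the constant term of [f]. *)
move=> f0; have [||h [g [gM eq]]] := @series_approx N k _ (@mdegD N) 1 (fun=> f) 0 set0 setT _ 1.
- move=> d x _ xd; exists (fun=> sC N (coef f 0%MM)^-1 * x), 0; split=> //.
  + by move=> _ m; rewrite coef_sCM => nz; rewrite subn0; apply: xd => z; apply: nz; rewrite z mulr0.
  + rewrite subr0 big_ord1.
    have -> : x - sC N (coef f 0%MM)^-1 * x * f = x * (1 - sC N (coef f 0%MM)^-1 * f) by ring.
    rewrite -addn1; apply: ordgeM => //; first exact: mdegD.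
    move=> m; rewrite lt0n mdeg_eq0 => nz; apply/eqP => m0; apply: nz.
    by rewrite coefB coef1 coef_sCM m0 eqxx mulVf ?subrr //; apply/eqP.
- by [].
have g0 : g = 0 by apply: mseriesP => m; apply: contrapT => /gM.
by exists (h ord0); rewrite eq g0 add0r big_ord1 mulrC.
Qed.

(** The initial exponents of the elements of [I], for the monomial order compatible with the degree,
    have finitely many minimal ones; elements of [I] with these initial exponents generate it.
    Division is finite within one degree ([kill]), and approximation passes to the limit. *)
Lemma noetherian_series : noetherian S.
Proof.
move=> I hI.
pose islead (f : S) (m : X) := coef f m <> 0 /\ forall m', (m' < m)%O -> coef f m' = 0.
have leadP (f : S) m0 : coef f m0 <> 0 -> exists2 m, islead f m & (m <= m0)%O.
  elim/(well_founded_ind (@ltom_wf N)): m0 => m IH nz.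
  have [[m' [lt nz']]|h] := pselect (exists m', (m' < m)%O /\ coef f m' <> 0).
    have [m'' h le] := IH m' lt nz'; exists m'' => //.
    exact: le_trans le (ltW lt).
  exists m => //; split=> // m' lt; apply: contrapT => nz'; apply: h; by exists m'.
pose E := [set m | exists2 f, I f & islead f m].
have [es [esE Ees]] := dickson E.
have ex e : exists f, e \in es -> I f /\ islead f e.
  have [/esE [f If fe]|_] := boolP (e \in es); first by exists f.
  by exists 0.
have {ex} [B BP] := choice ex.
pose F (l : 'I_(size es)) := B (nth 0%MM es l).
have FP l : I (F l) /\ islead (F l) (nth 0%MM es l) by apply: BP; apply: mem_nth.
(* Dividing a term of degree [d] by some [u^e] leaves a multiplier of degree at least [d - c]. *)
pose c := (\max_(e <- es) mdeg e)%N.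
have cP e : e \in es -> (mdeg e <= c)%N.
  by move=> ees; rewrite /c (big_rem e ees) /= leq_maxl.
have monid x y : islead x y -> forall m, coef x m <> 0 -> (y <= m)%O.
  by move=> [_ h] m nz; rewrite leNgt; apply/negP => /h.
have kill d (f : S) : I f -> ordge mdeg d f -> exists h : 'I_(size es) -> S,
    (forall l, ordge mdeg (d - c) (h l)) /\ ordge mdeg d.+1 (f - \sum_l h l * F l).
  (* [Z f] counts the exponents of degree [d] at or above some exponent of [f] of degree [d]. It
     drops when the initial term is cancelled. *)
  pose Z (f : S) := #|[set m : 'X_{1..N < d.+1} | (mdeg m == d) &&
     `[< exists m' : X, [/\ (m' <= m)%O, mdeg m' = d & coef f m' <> 0] >] ]%SET|.
  have [n] := ubnP (Z f); elim: n => // n IH in f *; rewrite ltnS => Zn If fd.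
  have [done|nd] := pselect (ordge mdeg d.+1 f).
    exists (fun=> 0); split; first by move=> l; apply: ordge0.
    by rewrite big1 ?subr0 // => l _; rewrite mul0r.
  have [m1 [nz1 d1]] : exists m, coef f m <> 0 /\ mdeg m = d.
    apply: contrapT => h; apply: nd => m nz; rewrite ltn_neqAle fd // andbT.
    by apply/eqP => dm; apply: h; exists m.
  have [m0 lm0 le01] := leadP f m1 nz1.
  have d0 : mdeg m0 = d.
    by apply/eqP; rewrite eqn_leq fd ?andbT; [rewrite -d1; apply: lemc_mdeg | case: lm0].
  have [|e ees em0] := Ees m0; first by exists f.
  have lt_e : (index e es < size es)%N by rewrite index_mem.
  pose l0 := Ordinal lt_e.
  have Fl0 : nth 0%MM es l0 = e by rewrite nth_index.
  have [IF leF] := FP l0; rewrite Fl0 in leF.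
  pose a := coef f m0 / coef (F l0) e.
  pose q := sC N a * sX k (m0 - e)%MM.
  pose f' := f - q * F l0.
  have qF m : coef (q * F l0) m =
     a * (if (m0 - e <= m)%MM then coef (F l0) (m - (m0 - e))%MM else 0).
    by rewrite /q -mulrA coef_sCM coef_sXM.
  have qFlt m : (m < m0)%O -> coef (q * F l0) m = 0.
    move=> mm0; rewrite qF; case: ifP => le; last by rewrite mulr0.
    case: leF => _ ->; rewrite ?mulr0 //.
    by rewrite -(ltmc_add2l _ _ (m0 - e)%MM) submK // [(e + _)%MM]addmC submK.
  have qF0 : coef (q * F l0) m0 = coef f m0.
    rewrite qF lem_subr submBA // [X in (X - _)%MM]addmC addmK /a divfK //.
    by apply/eqP; case: leF.
  have qd : ordge mdeg d (q * F l0).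
    move=> m nz; rewrite leqNgt; apply/negP => lt; apply: nz; apply: qFlt.
    by apply: lt_mdeg_ltmc; rewrite d0.
  have f'd : ordge mdeg d f' by apply: ordgeB.
  have If' : I f' by apply: idealB => //; apply: idealMl.
  have Zf' : (Z f' < n)%N.
    apply: leq_trans Zn; apply: proper_card; apply/properP; split.
      apply/fintype.subsetP => m; rewrite !inE => /andP [-> /asboolP [m' [m'm dm' nz]]] /=.
      apply/asboolP; exists m0; split=> //; last by case: lm0.
      apply: le_trans m'm; rewrite leNgt; apply/negP => lt; apply: nz.
      by rewrite coefB qFlt // subr0; case: lm0 => _ ->.
    have b0 : (mdeg m0 < d.+1)%N by rewrite d0.
    exists (BMultinom b0); rewrite !inE d0 eqxx /=.
      by apply/asboolP; exists m0; split=> //; case: lm0.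
    apply/asboolP => -[m' [m'm dm' nz]]; suff : coef f' m' = 0 by []; rewrite coefB.
    move: m'm; rewrite le_eqVlt => /predU1P[->|lt]; first by rewrite qF0 subrr.
    by rewrite qFlt // subr0; case: lm0 => _ ->.
  have [h [hd fh]] := IH f' Zf' If' f'd.
  exists (fun l => h l + if l == l0 then q else 0); split.
    move=> l; apply: ordgeD => //; case: eqP => _; last exact: ordge0.
    move=> m; rewrite /q coef_sCM coef_sX; case: eqP => [<- _|_]; last by rewrite mulr0.
    by rewrite -d0 -{1}(submK em0) mdegD; have := cP e ees; lia.
  have -> : \sum_l (h l + (if l == l0 then q else 0)) * F l = \sum_l h l * F l + q * F l0.
    rewrite (eq_bigr (fun l => h l * F l + (if l == l0 then q * F l else 0))).
      by rewrite big_split -big_mkcond big_pred1_eq.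
    by move=> l _; rewrite mulrDl; case: eqP => _ //; rewrite mul0r.
  by have -> : f - (\sum_l h l * F l + q * F l0) = f' - \sum_l h l * F l by rewrite /f'; ring.
exists (codom F); split=> [_ /codomP [l ->]|f If]; first by case: (FP l).
have [|h [g [gM ->]]] := @series_approx N k _ (@mdegD N) _ F c set0 I _ f If.
  move=> d x Ix xd; have [h [hd xh]] := kill d x Ix xd.
  exists h, 0; rewrite subr0; split=> //; apply: idealB => //.
  by apply: ideal_sum => // l _; apply: idealMl => //; case: (FP l).
have -> : g = 0 by apply: mseriesP => m; apply: contrapT => /gM.
rewrite add0r; apply: ideal_sum => [|l _]; first exact: span_ideal.
apply: idealMl; first exact: span_ideal.
by apply: subset_span; exact: codom_f.
Qed.

End FieldSeries.

(** * Regular fans *)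

Section OrderedGroup.
Variables (Phi : zmodType) (O : group_order Phi).
Implicit Types x y z : Phi.

Lemma gle_sub0 x y : O x y <-> O 0 (y - x).
Proof.
split=> h; first by have := gle_add (- x) h; rewrite addNr addrC.
by have := gle_add x h; rewrite addr0 addrC subrK.
Qed.
Lemma gleD x y x' y' : O x x' -> O y y' -> O (x + y) (x' + y').
Proof.
move=> hx hy; apply: gle_trans (gle_add x hy) _.
by rewrite ![_ + y']addrC; apply: gle_add.
Qed.
Lemma gleD0 x y : O 0 x -> O 0 y -> O 0 (x + y).
Proof. by move=> hx hy; have := gleD hx hy; rewrite addr0. Qed.
Lemma gle_eq x y : O x y -> O y x -> x = y.
Proof. by move=> h h'; apply: (gle_anti (g := O)); rewrite h h'. Qed.
Lemma gle_mulrn x n : O 0 x -> O 0 (x *+ n).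
Proof.
move=> hx; elim: n => [|n IH]; first exact: gle_refl.
by rewrite mulrS; apply: gleD0.
Qed.
Lemma gle_sum (T : Type) (r : seq T) (F : T -> Phi) :
  (forall i, O 0 (F i)) -> O 0 (\sum_(i <- r) F i).
Proof. by move=> h; apply: (big_ind (O 0)) => //; [exact: gle_refl | exact: gleD0]. Qed.
Lemma glt_gle x y : glt O x y -> O x y. Proof. by case. Qed.
Lemma glt_le_trans x y z : glt O x y -> O y z -> glt O x z.
Proof.
move=> [xy ne] yz; split; first exact: gle_trans yz.
by move=> xz; apply: ne; apply: gle_eq => //; rewrite xz.
Qed.
Lemma gle_lt_trans x y z : O x y -> glt O y z -> glt O x z.
Proof.
move=> xy [yz ne]; split; first exact: gle_trans yz.
by move=> xz; apply: ne; apply: gle_eq => //; rewrite -xz.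
Qed.
Lemma gltN x y : glt O x y -> O y x -> False.
Proof. by move=> [xy ne] yx; apply: ne; apply: gle_eq. Qed.
Lemma gltNge x y : ~ O y x -> glt O x y.
Proof.
move=> h; split; last by move=> e; apply: h; rewrite e; apply: gle_refl.
by have /orP[] := gle_total O x y.
Qed.
Lemma glt_add z x y : glt O x y -> glt O (z + x) (z + y).
Proof. by move=> [xy ne]; split; [exact: gle_add | move=> /addrI]. Qed.
Lemma gltD x y x' y' : glt O x x' -> O y y' -> glt O (x + y) (x' + y').
Proof.
move=> hx hy; apply: gle_lt_trans (gle_add x hy) _.
by rewrite ![_ + y']addrC; apply: glt_add.
Qed.
End OrderedGroup.

(** With this order real points of the orthant are weights like any others, and one covering
    property serves both for the support of the fan and for valuations. *)
Definition real_order (RR : realType) : group_order RR.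
Proof.
exists (fun x y : RR => x <= y) => //.
- by move=> x y; apply: le_anti.
- by move=> y x z; apply: le_trans.
- by move=> x y; apply: le_total.
- by move=> z x y h; rewrite lerD2l.
Defined.

Section Fan.
Variables (RR : realType) (N : nat).
Local Notation X := 'X_{1..N}.
Local Notation cone_t := {fset X}.
Implicit Types (sigma tau rho : cone_t) (Sigma : {fset cone_t}) (a b x y : X).

(** A combinatorial form of regular fans covering the orthant, stable under subdivision. Coordinates
    on a cone are functions on all exponents vanishing outside its generators. By [gf_uniq] the
    coordinates of a real point do not depend on the cone, so that cones meet along faces. The
    covering [gf_exh] is required for every ordered group, because a weight of higher rank is not a
    real point. *)
Record good_fan Sigma : Prop := GoodFan {
  gf_reg : forall sigma, sigma \in Sigma -> regular_cone sigma;
  gf_face : forall sigma tau, sigma \in Sigma -> (tau `<=` sigma)%fset -> tau \in Sigma;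
  gf_uniq : forall sigma tau (c d : X -> RR), sigma \in Sigma -> tau \in Sigma ->
    (forall x, 0 <= c x) -> (forall x, 0 <= d x) ->
    (forall x, x \notin sigma -> c x = 0) -> (forall x, x \notin tau -> d x = 0) ->
    (forall i, \sum_(x <- enum_fset sigma) c x *+ x i =
               \sum_(x <- enum_fset tau) d x *+ x i) -> c =1 d;
  gf_exh : forall (Phi : zmodType) (O : group_order Phi) (p : 'I_N -> Phi),
    (forall i, O 0 (p i)) -> exists sigma (c : X -> Phi),
    [/\ sigma \in Sigma, #|` sigma | = N, forall x, O 0 (c x),
        forall x, x \notin sigma -> c x = 0
      & forall i, p i = \sum_(x <- enum_fset sigma) c x *+ x i] }.

Lemma fset_sum_sub (Phi : zmodType) sigma tau (F : X -> Phi) :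
  (sigma `<=` tau)%fset -> (forall x, x \notin sigma -> F x = 0) ->
  \sum_(x <- enum_fset sigma) F x = \sum_(x <- enum_fset tau) F x.
Proof. by move=> st F0; apply: big_fset_incl => // x _ /F0. Qed.

Lemma fset_sum1 (Phi : zmodType) tau a (e : Phi) i : a \in tau ->
  \sum_(x <- enum_fset tau) (if x == a then e else 0) *+ x i = e *+ a i.
Proof.
move=> at_; rewrite (bigD1_seq a) ?fset_uniq //= eqxx big1 ?addr0 // => x /negbTE ->.
by rewrite mul0rn.
Qed.

(** Adds to the coordinates [c] the relation [e a + e b - e (a + b) = 0]; this passes between a cone
    and its subdivision. *)
Definition move_val (Phi : zmodType) a b (e : Phi) (c : X -> Phi) x : Phi :=
  c x + (if x == a then e else 0) + (if x == b then e else 0)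
      - (if x == (a + b)%MM then e else 0).

Lemma move_val_sum (Phi : zmodType) tau a b (e : Phi) (c : X -> Phi) i :
  a \in tau -> b \in tau -> (a + b)%MM \in tau ->
  \sum_(x <- enum_fset tau) move_val a b e c x *+ x i = \sum_(x <- enum_fset tau) c x *+ x i.
Proof.
move=> ha hb hab.
under eq_bigr do rewrite /move_val mulrnBl !mulrnDl.
rewrite sumrB !big_split /= !fset_sum1 // mnmDE mulrnDr.
by rewrite -[X in X - _]addrA addrK.
Qed.

Definition nab a b sigma := ~~ ((a \in sigma) && (b \in sigma)).

(** The stellar subdivision along the face spanned by [a] and [b], with new ray [a + b]: the cones
    not containing both, and the joins of [a + b] with those of them that span a cone of [Sigma]
    together with [a] and [b]. *)
Definition star a b Sigma : {fset cone_t} :=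
  ([fset sigma in Sigma | nab a b sigma] `|`
   [fset ((a + b)%MM |` rho) | rho in [fset rho in Sigma |
      nab a b rho && ((a |` (b |` rho)) \in Sigma)]])%fset.

Lemma in_star a b Sigma sigma : sigma \in star a b Sigma <->
  (sigma \in Sigma /\ nab a b sigma) \/
  exists rho, [/\ rho \in Sigma, nab a b rho, (a |` (b |` rho))%fset \in Sigma
                & sigma = ((a + b)%MM |` rho)%fset].
Proof.
split.
  rewrite in_fsetU => /orP[|].
    by rewrite !inE /= => /andP [h1 h2]; left.
  case/imfsetP => rho /=; rewrite !inE /= => /and3P [h1 h2 h3] ->.
  by right; exists rho.
case=> [[h1 h2]|[rho [h1 h2 h3 ->]]]; rewrite in_fsetU; apply/orP; [left|right].
  by rewrite !inE /= h1.
by apply/imfsetP; exists rho => //=; rewrite !inE /= h1 h2.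
Qed.

Section Star.
Variables (Sigma : {fset cone_t}) (a b : X).
Hypotheses (gS : good_fan Sigma) (ab : a != b) (habS : [fset a; b]%fset \in Sigma).
Local Notation c0 := (a + b)%MM.

(** Otherwise the point [a + b] would have two systems of coordinates: 1 on itself, or 1 on each of
    [a] and [b]. *)
Lemma star_new sigma : sigma \in Sigma -> c0 \notin sigma.
Proof.
move=> sS; apply/negP => c0s.
have s1 : [fset c0]%fset \in Sigma.
  by apply: (gf_face gS) sS _; rewrite fsub1set.
have h : (fun x => (x == c0)%:R : RR) =1 (fun x => (x == a)%:R + (x == b)%:R).
  apply: (gf_uniq gS s1 habS) => //.
  - by move=> x; rewrite addr_ge0.
  - by move=> x; rewrite inE => /negbTE ->.
  - by move=> x; rewrite !inE negb_or => /andP [/negbTE -> /negbTE ->]; rewrite addr0.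
  - move=> i; rewrite big_seq_fset1 eqxx big_fsetU1 ?inE //= big_seq_fset1 !eqxx.
    by rewrite (negbTE ab) eq_sym (negbTE ab) add0r addr0 mnmDE mulrnDr.
have ba : b != a by rewrite eq_sym.
have := h a; have := h b.
rewrite /= !eqxx (negbTE ab) (negbTE ba) add0r addr0.
case: eqP => [bc|_ /eqP]; last by rewrite eq_sym oner_eq0.
case: eqP => [ac _ _|_ _ /eqP]; last by rewrite eq_sym oner_eq0.
by move: (ab); rewrite {1}ac -bc eqxx.
Qed.

Lemma c0a : c0 != a.
Proof. by apply: contraNneq (star_new habS) => ->; rewrite !inE eqxx. Qed.
Lemma c0b : c0 != b.
Proof. by apply: contraNneq (star_new habS) => ->; rewrite !inE eqxx orbT. Qed.

Lemma star_reg sigma : sigma \in star a b Sigma -> regular_cone sigma.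
Proof.
case/in_star => [[sS _]|[rho [rS nr abr ->]]]; first exact: (gf_reg gS).
have [M Mu Mr] := gf_reg gS abr.
have key x y : (x \in (a |` (b |` rho)))%fset -> (y \in (a |` (b |` rho)))%fset -> x != y ->
    y \notin rho ->
    exists2 M' : 'M[int]_N, M' \in unitmx &
      forall z, z \in ((x + y)%MM |` rho)%fset -> exists j, row j M' = zvec z.
  move=> xs ys xy yr.
  have [jx jxE] := Mr x xs; have [jy jyE] := Mr y ys.
  have jxy : jx != jy.
    apply: contraNneq xy => e; apply/eqP/mnmP => i; have := jxE; rewrite e jyE.
    by move/rowP/(_ i); rewrite !mxE => -[].
  pose E : 'M[int]_N := 1%:M + delta_mx jy jx.
  have EE : (1%:M - delta_mx jy jx) *m E = 1%:M.
    rewrite mulmxDr !mulmxBl !mul1mx mulmx1 (mul_delta_mx_0 _ _ _ jxy) subr0.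
    by rewrite subrK.
  exists (E *m M); first by rewrite unitmx_mul Mu andbT; have [] := mulmx1_unit EE.
  have rowE j : row j (E *m M) = row j M + (if j == jy then row jx M else 0).
    apply/rowP => i; rewrite mulmxDl mul1mx !mxE; congr (_ + _).
    case: eqP => [->|ne].
      rewrite !mxE (bigD1 jx) //= !mxE !eqxx mul1r big1 ?addr0 // => t /negbTE tj.
      by rewrite !mxE tj andbF mul0r.
    rewrite !mxE big1 // => t _; rewrite !mxE; case: eqP => //= _; exact: mul0r.
  move=> z; rewrite !inE => /orP[/eqP ->|zr].
    exists jy; rewrite rowE eqxx jxE jyE; apply/rowP => i.
    by rewrite !mxE mnmDE PoszD addrC.
  have [|j jE] := Mr z; first by rewrite !inE zr !orbT.
  exists j; rewrite rowE; case: eqP => [e|_]; last by rewrite addr0.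
  case/negP: yr; have -> // : y = z.
  apply/mnmP => i; have := jE; rewrite e jyE.
  by move/rowP/(_ i); rewrite !mxE => -[].
move: nr; rewrite /nab negb_and => /orP[ar|br].
  have [||||M' M'u M'r] := key b a; rewrite ?inE ?eqxx ?orbT //; first by rewrite eq_sym.
  by exists M' => // z zr; apply: M'r; rewrite addmC.
by apply: key; rewrite ?inE ?eqxx ?orbT.
Qed.

Lemma star_face sigma tau :
  sigma \in star a b Sigma -> (tau `<=` sigma)%fset -> tau \in star a b Sigma.
Proof.
have nabS sg tu : nab a b sg -> (tu `<=` sg)%fset -> nab a b tu.
  by move=> h /fsubsetP sub; apply: contra h => /andP [/sub -> /sub ->].
move=> /in_star sS ts; apply/in_star; case: sS => [[sS ns]|[rho [rS nr abr sE]]].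
  by left; split; [exact: (gf_face gS) ts | exact: nabS ts].
have [c0t|c0t] := boolP (c0 \in tau).
  right; exists (tau `\ c0)%fset.
  have sub : (tau `\ c0 `<=` rho)%fset.
    apply/fsubsetP => x; rewrite !inE => /andP [xc0 xt].
    by have := fsubsetP ts x xt; rewrite sE !inE (negbTE xc0).
  split.
  - exact: (gf_face gS) sub.
  - exact: nabS sub.
  - by apply: (gf_face gS) abr _; do 2!apply: fsetUS.
  - by rewrite fsetD1K.
have sub : (tau `<=` rho)%fset.
  apply/fsubsetP => x xt; have := fsubsetP ts x xt; rewrite sE !inE.
  by case: eqP => // xc0; rewrite xc0 (negbTE c0t) in xt.
by left; split; [exact: (gf_face gS) sub | exact: nabS sub].
Qed.

(** The coordinate on [a + b] is given back to [a] and [b]. Since one of [c a], [c b] vanishes, it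
    can be recovered as the minimum of the two resulting coordinates; this yields uniqueness in the
    subdivision. *)
Lemma star_old sigma (c : X -> RR) : sigma \in star a b Sigma ->
  (forall x, 0 <= c x) -> (forall x, x \notin sigma -> c x = 0) ->
  exists tau, [/\ tau \in Sigma, forall x, 0 <= move_val a b (c c0) c x,
    forall x, x \notin tau -> move_val a b (c c0) c x = 0,
    forall i, \sum_(x <- enum_fset sigma) c x *+ x i =
       \sum_(x <- enum_fset tau) move_val a b (c c0) c x *+ x i
  & c a = 0 \/ c b = 0].
Proof.
move=> sS cge0 c0s.
have mvge0 x : 0 <= move_val a b (c c0) c x.
  rewrite /move_val; case: (x =P c0) => [->|_].
    by rewrite (negbTE c0a) (negbTE c0b) !addr0 subrr.
  by rewrite subr0 !addr_ge0 //; case: ifP.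
case/in_star: sS => [[sS ns]|[rho [rS nr abr sE]]].
  have e0 : c c0 = 0 by apply: c0s; apply: star_new.
  have mvE x : move_val a b (c c0) c x = c x.
    by rewrite /move_val e0 !if_same !addr0 subr0.
  exists sigma; split=> // [x|i|]; rewrite ?mvE //; first exact: c0s.
    by apply: eq_bigr => x _; rewrite mvE.
  by move: ns; rewrite /nab negb_and => /orP[/c0s|/c0s]; [left|right].
have c0ab : c0 \notin (a |` (b |` rho))%fset by apply: star_new.
have mv0 x : x \notin (a |` (b |` rho))%fset -> move_val a b (c c0) c x = 0.
  rewrite !inE !negb_or => /and3P [/negbTE xa /negbTE xb xr].
  rewrite /move_val xa xb !addr0; case: eqP => [->|/eqP xc0]; first by rewrite subrr.
  by rewrite subr0; apply: c0s; rewrite sE !inE negb_or xc0.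
exists (a |` (b |` rho))%fset; split=> // [i|].
  have sub1 : (sigma `<=` (c0 |` (a |` (b |` rho))))%fset.
    by rewrite sE fsetUS // fsetUA fsubsetUr.
  rewrite (fset_sum_sub sub1) => [|x /c0s ->]; last exact: mul0rn.
  rewrite -(@move_val_sum _ _ a b (c c0) c) ?inE ?eqxx ?orbT //.
  apply: esym; apply: fset_sum_sub; first exact: fsubsetUr.
  by move=> x /mv0 ->; exact: mul0rn.
have c0rho : forall x, x != c0 -> x \notin rho -> c x = 0.
  by move=> x xc xr; apply: c0s; rewrite sE !inE negb_or xc.
move: nr; rewrite /nab negb_and => /orP[ar|br]; [left|right]; apply: c0rho => //.
  by rewrite eq_sym c0a.
by rewrite eq_sym c0b.
Qed.

Lemma star_uniq sigma tau (c d : X -> RR) :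
  sigma \in star a b Sigma -> tau \in star a b Sigma ->
  (forall x, 0 <= c x) -> (forall x, 0 <= d x) ->
  (forall x, x \notin sigma -> c x = 0) -> (forall x, x \notin tau -> d x = 0) ->
  (forall i, \sum_(x <- enum_fset sigma) c x *+ x i =
             \sum_(x <- enum_fset tau) d x *+ x i) -> c =1 d.
Proof.
move=> sS tS c_ge0 d_ge0 cs dt eq.
have [s' [s'S c1 c2 c3 cab]] := star_old sS c_ge0 cs.
have [t' [t'S d1 d2 d3 dab]] := star_old tS d_ge0 dt.
have h : move_val a b (c c0) c =1 move_val a b (d c0) d.
  by apply: (gf_uniq gS s'S t'S) => // i; rewrite -c3 -d3.
have hab : c a + c c0 = d a + d c0 /\ c b + c c0 = d b + d c0.
  have := h a; have := h b; rewrite /move_val !eqxx (negbTE ab) eq_sym (negbTE ab).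
  rewrite ![_ == c0]eq_sym (negbTE c0a) (negbTE c0b) !addr0 !subr0 => -> ->.
  by [].
have [ca cb] := hab.
have e0 : c c0 = d c0.
  have := (c_ge0 a, c_ge0 b, d_ge0 a, d_ge0 b).
  by case: cab => z; case: dab => z'; rewrite z in ca cb *; rewrite z' in ca cb *; case=> [[[? ?] ?] ?]; lra.
move=> x; have := h x; rewrite /move_val e0.
by rewrite -!addrA => /addIr.
Qed.

(** In a cone containing both [a] and [b], the smaller of the two coordinates is transferred to
    [a + b]. Totality of the order suffices to choose, whatever the group. *)
Lemma star_exh (Phi : zmodType) (O : group_order Phi) (p : 'I_N -> Phi) :
    (forall i, O 0 (p i)) -> exists sigma (c : X -> Phi),
    [/\ sigma \in star a b Sigma, #|` sigma | = N, forall x, O 0 (c x),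
        forall x, x \notin sigma -> c x = 0
      & forall i, p i = \sum_(x <- enum_fset sigma) c x *+ x i].
Proof.
move=> p0; have [sigma [c [sS cN c_ge0 cs pE]]] := gf_exh gS p0.
have [/andP [as_ bs]|ns] := boolP ((a \in sigma) && (b \in sigma)); last first.
  by exists sigma, c; split=> //; apply/in_star; left.
have c0s := star_new sS.
have key x y : x \in sigma -> y \in sigma -> x != y -> (x + y)%MM = c0 ->
    nab a b (sigma `\ y)%fset -> (a |` (b |` (sigma `\ y)))%fset = sigma -> O (c y) (c x) ->
    exists sigma (c : X -> Phi),
    [/\ sigma \in star a b Sigma, #|` sigma | = N, forall x, O 0 (c x),
        forall x, x \notin sigma -> c x = 0
      & forall i, p i = \sum_(x <- enum_fset sigma) c x *+ x i].
  move=> xs ys xy xyE nr rE le.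
  have xc0 : x != c0 by apply: contraNneq c0s => <-.
  have yc0 : y != c0 by apply: contraNneq c0s => <-.
  have mv0 z : z \notin (c0 |` (sigma `\ y))%fset -> move_val x y (- c y) c z = 0.
    rewrite !inE negb_or negb_and negbK => /andP [/negbTE zc0 /orP[/eqP ->|zs]].
      by rewrite /move_val eqxx eq_sym (negbTE xy) xyE (negbTE yc0) addr0 subrr subr0.
    rewrite /move_val xyE zc0 cs //.
    have -> : (z == x) = false by apply: contraNF zs => /eqP ->.
    have -> : (z == y) = false by apply: contraNF zs => /eqP ->.
    by rewrite !addr0 subr0.
  exists (c0 |` (sigma `\ y))%fset, (move_val x y (- c y) c); split=> //.
  - apply/in_star; right; exists (sigma `\ y)%fset; rewrite rE; split=> //.
    by apply: (gf_face gS) sS _; rewrite fsubD1set.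
  - apply: etrans cN; rewrite cardfsU1 !inE negb_and c0s orbT /=.
    by rewrite (cardfsD1 y sigma) ys.
  - move=> z; rewrite /move_val xyE; case: (z =P x) => [->|_].
      rewrite (negbTE xy) (negbTE xc0) addr0 subr0.
      exact: (iffLR (gle_sub0 O (c y) (c x)) le).
    case: (z =P y) => [->|_]; first by rewrite (negbTE yc0) addr0 subrr subr0; apply: gle_refl.
    rewrite !addr0; case: eqP => _; last by rewrite subr0.
    by rewrite opprK; apply: gleD0.
  - move=> i; rewrite pE (@fset_sum_sub _ sigma (c0 |` sigma)%fset).
    + have xs' : x \in (c0 |` sigma)%fset by rewrite !inE xs orbT.
      have ys' : y \in (c0 |` sigma)%fset by rewrite !inE ys orbT.
      have xys' : (x + y)%MM \in (c0 |` sigma)%fset by rewrite !inE xyE eqxx.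
      rewrite -(move_val_sum (- c y) c i xs' ys' xys').
      apply: esym; apply: fset_sum_sub; first by rewrite fsetUS // fsubD1set.
      by move=> z /mv0 ->; exact: mul0rn.
    + exact: fsubsetU1.
    + by move=> z /cs ->; exact: mul0rn.
have /orP[le|le] := gle_total O (c b) (c a).
  apply: (key a b) => //; first by rewrite /nab !inE eqxx andbF.
  by apply/fsetP => z; rewrite !inE; case: eqP => [->|_] //=; case: eqP => [->|_].
apply: (key b a) => //; rewrite ?[_ == a]eq_sym //; first by rewrite addmC.
  by rewrite /nab !inE eqxx.
by apply/fsetP => z; rewrite !inE; case: eqP => [->|_] //=; case: eqP => [->|_].
Qed.

Lemma star_good : good_fan (star a b Sigma).
Proof.
split; [exact: star_reg | exact: star_face | exact: star_uniq | exact: star_exh].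
Qed.

End Star.

Definition form_val (h : 'rV[int]_N) x : int := \sum_i h 0 i * (x i)%:Z.

Lemma form_valD h x y : form_val h (x + y)%MM = form_val h x + form_val h y.
Proof.
by rewrite /form_val -big_split; apply: eq_bigr => i _; rewrite mnmDE PoszD mulrDr.
Qed.

Definition compatible h Sigma := forall sigma, sigma \in Sigma ->
  (forall x, x \in sigma -> 0 <= form_val h x) \/
  (forall x, x \in sigma -> form_val h x <= 0).

Definition bad_pair h Sigma a b :=
  [/\ [fset a; b]%fset \in Sigma, 0 < form_val h a & form_val h b < 0].

Lemma compatible_bad h Sigma : good_fan Sigma ->
  (forall a b, ~ bad_pair h Sigma a b) -> compatible h Sigma.
Proof.
move=> gS nobad sigma sS.
have [h0|/existsNP [y /not_implyP [ys /negP]]] :=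
  pselect (forall x, x \in sigma -> 0 <= form_val h x); [by left | rewrite -ltNge => hy].
right=> x xs; rewrite leNgt; apply/negP => hx; apply: (nobad x y); split=> //.
by apply: (gf_face gS) sS _; rewrite fsubUset !fsub1set xs.
Qed.

Lemma star_compatible h Sigma a b :
  compatible h Sigma -> compatible h (star a b Sigma).
Proof.
move=> cS sigma /in_star [[/cS //]|[rho [rS _ abr ->]]].
have [ge0|le0] := cS _ abr; [left|right] => x; rewrite !inE => /orP[/eqP ->|xr].
- by rewrite form_valD addr_ge0 // ge0 // !inE eqxx ?orbT.
- by apply: ge0; rewrite !inE xr !orbT.
- have := le0 a; have := le0 b; rewrite !inE !eqxx orbT /= form_valD => /(_ isT) hb /(_ isT) ha.
  by rewrite -(addr0 0) lerD.
- by apply: le0; rewrite !inE xr !orbT.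
Qed.

(** A new bad pair contains [a + b], whose value lies strictly between those of [b] and [a].
    Replacing [a + b] by [a], or by [b], gives an old bad pair of strictly larger spread, still
    bounded by [M]. *)
Lemma star_bad h Sigma a b x y (M : nat) : good_fan Sigma -> bad_pair h Sigma a b ->
  (forall a b, bad_pair h Sigma a b -> form_val h a - form_val h b <= M%:Z) ->
  form_val h a - form_val h b = M%:Z -> bad_pair h (star a b Sigma) x y ->
  form_val h x - form_val h y < M%:Z \/ bad_pair h Sigma x y /\ (x, y) != (a, b).
Proof.
move=> gS [abS ha hb] hM abM [/in_star xyS hx hy].
have xy : x != y by apply: contraTneq hx => ->; rewrite -leNgt ltW.
case: xyS => [[xyS nxy]|[rho [rS nr abr xyE]]].
  right; split=> //; apply/eqP => -[xa yb]; move: nxy.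
  by rewrite /nab xa yb !inE !eqxx orbT.
have hc := form_valD h a b.
have inr z : z \in [fset x; y]%fset -> z = (a + b)%MM \/ z \in rho.
  by rewrite xyE !inE => /orP[/eqP|]; [left|right].
have c0xy : (a + b)%MM = x \/ (a + b)%MM = y.
  have : (a + b)%MM \in [fset x; y]%fset by rewrite xyE !inE eqxx.
  by rewrite !inE => /orP[/eqP|/eqP]; [left|right].
have pairS u v : u \in (a |` (b |` rho))%fset -> v \in (a |` (b |` rho))%fset ->
    [fset u; v]%fset \in Sigma.
  by move=> hu hv; apply: (gf_face gS) abr _; rewrite fsubUset !fsub1set hu.
left; case: c0xy => cE.
  have yr : y \in rho.
    have [|yc|//] := inr y; first by rewrite !inE eqxx orbT.
    by rewrite yc cE eqxx in xy.
  have : form_val h a - form_val h y <= M%:Z.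
    by apply: hM; split=> //; apply: pairS; rewrite !inE ?eqxx // yr !orbT.
  by move: hc; rewrite cE; lia.
have xr : x \in rho.
  have [|xc|//] := inr x; first by rewrite !inE eqxx.
  by rewrite xc cE eqxx in xy.
have : form_val h x - form_val h b <= M%:Z.
  by apply: hM; split=> //; apply: pairS; rewrite !inE ?eqxx ?xr ?orbT.
by move: hc; rewrite cE; lia.
Qed.

(** Subdividing at a bad pair of maximal spread [M] creates no new bad pair of
    spread at least [M], so that [(M, size l)] decreases. *)
Lemma refine_form h (M n : nat) Sigma (l : seq (X * X)) : good_fan Sigma ->
  (forall a b, bad_pair h Sigma a b -> form_val h a - form_val h b <= M%:Z) ->
  (forall a b, bad_pair h Sigma a b -> form_val h a - form_val h b = M%:Z -> (a, b) \in l) ->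
  (size l <= n)%N ->
  exists Sigma', [/\ good_fan Sigma', compatible h Sigma' &
    forall h', compatible h' Sigma -> compatible h' Sigma'].
Proof.
elim: M n Sigma l => [|M IHM] n Sigma l gS hM hl hn.
  exists Sigma; split=> //; apply: compatible_bad => // a b [h1 h2 h3].
  by have := hM a b (And3 h1 h2 h3); lia.
elim: n => [|n IHn] in Sigma l gS hM hl hn *; last first.
  have [[a [b [bad abM]]]|h0] := pselect (exists a b, bad_pair h Sigma a b /\
      form_val h a - form_val h b = M.+1%:Z); last first.
    by apply: (IHn Sigma [::]) => // a b bad e; case: h0; exists a, b.
  have [abS ha hb] := bad.
  have ab : a != b by apply: contraTneq ha => ->; rewrite -leNgt ltW.
  have gS' := star_good gS ab abS.
  have [|||Sigma' [h1 h2 h3]] := IHn (star a b Sigma) (rem (a, b) l) gS'.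
  - by move=> x y /(star_bad gS bad hM abM) [/ltW //|[/hM]].
  - move=> x y /(star_bad gS bad hM abM) [lt e|[bad' ne] e]; first by rewrite e ltxx in lt.
    have xyl := hl x y bad' e.
    by move: xyl; rewrite (perm_mem (perm_to_rem (hl a b bad abM))) inE (negbTE ne).
  - by rewrite size_rem; [rewrite -subn1 leq_subLR add1n | exact: hl].
  exists Sigma'; split=> // h' /(@star_compatible h' Sigma a b); exact: h3.
pose G := (\bigcup_(sigma <- Sigma) sigma)%fset.
pose l' := [seq (x, y) | x <- G, y <- G].
have lM a b : bad_pair h Sigma a b -> form_val h a - form_val h b <= M%:Z.
  move=> bad; have le := hM a b bad; rewrite leNgt; apply/negP => lt.
  have e : form_val h a - form_val h b = M.+1%:Z by lia.
  by have := hl a b bad e; move: hn; rewrite leqn0 size_eq0 => /eqP ->.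
apply: (IHM (size l') Sigma l') => // a b [abS _ _] _.
by apply/allpairsP; exists (a, b); split=> //; apply/bigfcupP;
  exists [fset a; b]%fset; rewrite ?abS // !inE eqxx ?orbT.
Qed.

Lemma refine_fan (H : seq 'rV[int]_N) Sigma : good_fan Sigma ->
  exists2 Sigma', good_fan Sigma' & forall h, h \in H -> compatible h Sigma'.
Proof.
elim: H Sigma => [|h H IH] Sigma gS; first by exists Sigma.
have [Sigma1 gS1 H1] := IH Sigma gS.
pose G := (\bigcup_(sigma <- Sigma1) sigma)%fset.
pose l := [seq (x, y) | x <- G, y <- G].
pose sp (p : X * X) := `|form_val h p.1 - form_val h p.2|%N.
have inl a b : bad_pair h Sigma1 a b -> (a, b) \in l.
  by case=> abS _ _; apply/allpairsP; exists (a, b); split=> //; apply/bigfcupP;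
    exists [fset a; b]%fset; rewrite ?abS // !inE eqxx ?orbT.
have [|||S2 [g2 c2 c3]] := @refine_form h (\max_(p <- l) sp p) (size l) Sigma1 l gS1.
- move=> a b bad; apply: (@le_trans _ _ (sp (a, b))%:Z); first by rewrite /sp /=; lia.
  by rewrite lez_nat (big_rem _ (inl a b bad)) /= leq_maxl.
- by move=> a b /inl.
- by [].
by exists S2 => // h'; rewrite inE => /predU1P[->|/H1 /c3].
Qed.

Lemma orthant_good : good_fan (fpowerset [fset U_(i)%MM | i in 'I_N])%fset.
Proof.
set G := [fset U_(i)%MM | i in 'I_N]%fset.
have inG x : x \in G -> exists i, x = U_(i)%MM.
  by case/imfsetP => i _ ->; exists i.
have evalG (Phi : zmodType) sigma (c : X -> Phi) i : (sigma `<=` G)%fset ->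
    (forall x, x \notin sigma -> c x = 0) ->
    \sum_(x <- enum_fset sigma) c x *+ x i = c U_(i)%MM.
  move=> sG cs; rewrite (@fset_sum_sub _ sigma G) //; last first.
    by move=> x /cs ->; rewrite mul0rn.
  have iG : U_(i)%MM \in G by apply/imfsetP; exists i.
  rewrite (bigD1_seq U_(i)%MM) ?fset_uniq //= mnm1E eqxx mulr1n big_seq_cond big1 ?addr0 //.
  move=> x /andP [/inG [j ->]]; rewrite mnm1E eq_mnm1 => /negbTE ->.
  exact: mulr0n.
split.
- move=> sigma; rewrite fpowersetE => /fsubsetP sG; exists 1%:M; first exact: unitmx1.
  move=> x /sG /inG [i ->]; exists i; apply/rowP => j.
  by rewrite !mxE mnm1E; case: eqP.
- by move=> sigma tau; rewrite !fpowersetE => sG ts; apply: fsubset_trans sG.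
- move=> sigma tau c d; rewrite !fpowersetE => sG tG _ _ cs dt eq x.
  have [/inG [i ->]|xG] := boolP (x \in G).
    by have := eq i; rewrite !evalG.
  by rewrite cs ?dt //; apply: contra xG; apply/fsubsetP.
- move=> Phi O p p0; exists G, (fun x => if [pick i | x == U_(i)%MM] is Some i then p i else 0).
  have pick i : [pick j | U_(i)%MM == U_(j)%MM :> X] = Some i.
    case: pickP => [j|/(_ i)]; last by rewrite eqxx.
    by rewrite eq_mnm1 => /eqP ->.
  have notG x : x \notin G -> [pick j | x == U_(j)%MM] = None.
    move=> xG; case: pickP => // j /eqP xj.
    by case/negP: xG; apply/imfsetP; exists j.
  split.
  + by rewrite fpowersetE.
  + rewrite card_imfset /=; last by move=> i j /eqP; rewrite eq_mnm1 => /eqP.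
    by rewrite -cardE card_ord.
  + by move=> x; case: pickP => [i _|_]; [exact: p0 | exact: gle_refl].
  + by move=> x /notG ->.
  + by move=> i; rewrite evalG // ?pick // => x /notG ->.
Qed.

Theorem exists_fan (H : seq 'rV[int]_N) :
  exists2 Sigma, good_fan Sigma & forall h, h \in H -> compatible h Sigma.
Proof. exact: refine_fan orthant_good. Qed.

Lemma cone_ptsP sigma (p : 'rV[RR]_N) : cone_pts sigma p <->
  exists c : X -> RR, [/\ forall x, 0 <= c x, forall x, x \notin sigma -> c x = 0 &
    forall i, p 0 i = \sum_(x <- enum_fset sigma) c x *+ x i].
Proof.
have sumE (c : X -> RR) i : (\sum_(x <- enum_fset sigma) c x *: \row_i (x i)%:R : 'rV[RR]_N) 0 i
    = \sum_(x <- enum_fset sigma) c x *+ x i.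
  by rewrite summxE; apply: eq_bigr => x _; rewrite !mxE mulr_natr.
split=> [[c [c0 ->]]|[c [c0 cs pE]]]; last first.
  by exists c; split=> //; apply/rowP => i; rewrite pE sumE.
exists (fun x => if x \in sigma then c x else 0); split.
- by move=> x; case: ifP.
- by move=> x /negbTE ->.
- by move=> i; rewrite sumE; apply: eq_big_seq => x ->.
Qed.

Lemma good_regular_fan Sigma : good_fan Sigma -> regular_fan RR Sigma.
Proof.
move=> gS; split; [exact: gf_reg | exact: gf_face |].
move=> sigma tau sS tS; exists (sigma `&` tau)%fset; split; [exact: fsubsetIl | exact: fsubsetIr|].
rewrite eqEsubset; split=> p.
  (* By uniqueness a common point has the same coordinates in both cones, so they are carried by the
     common generators. *)
  case=> /cone_ptsP [c [c0 cs pc]] /cone_ptsP [d [d0 dt pd]].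
  have cd : c =1 d by apply: (gf_uniq gS sS tS) => // i; rewrite -pc.
  have cst x : x \notin (sigma `&` tau)%fset -> c x = 0.
    by rewrite inE negb_and => /orP[/cs //|/dt]; rewrite cd.
  apply/cone_ptsP; exists c; split=> // i; rewrite pc; apply: esym; apply: fset_sum_sub.
    exact: fsubsetIl.
  by move=> x /cst ->; rewrite mul0rn.
have sub rho : (sigma `&` tau `<=` rho)%fset -> cone_pts (sigma `&` tau)%fset p -> cone_pts rho p.
  move=> st /cone_ptsP [c [c0 cs pE]]; apply/cone_ptsP; exists c; split=> //.
    by move=> x xr; apply: cs; apply: contra xr; apply/fsubsetP.
  by move=> i; rewrite pE; apply: fset_sum_sub => // x /cs ->; rewrite mul0rn.
by move=> h; split; apply: sub h; [exact: fsubsetIl | exact: fsubsetIr].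
Qed.

Lemma good_support Sigma : good_fan Sigma -> support_orthant RR Sigma.
Proof.
move=> gS p; split=> [p0|[sigma sS /cone_ptsP [c [c0 _ pE]]] i]; last first.
  by rewrite pE; apply: sumr_ge0 => x _; rewrite mulrn_wge0.
have [sigma [c [sS _ c0 cs pE]]] := gf_exh gS (O := real_order RR) p0.
by exists sigma => //; apply/cone_ptsP; exists c.
Qed.

End Fan.

(** * Weights and torus points *)

Section Zvec.
Variable N : nat.
Implicit Types p q : 'X_{1..N}.

Lemma zvecD p q : zvec (p + q)%MM = zvec p + zvec q.
Proof. by apply/rowP => i; rewrite !mxE mnmDE PoszD. Qed.
Lemma zvec0 : zvec (0%MM : 'X_{1..N}) = 0.
Proof. by apply/rowP => i; rewrite !mxE mnm0E. Qed.
Lemma zvecMn p n : zvec (p *+ n)%MM = zvec p *+ n.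
Proof. by elim: n => [|n IH]; rewrite ?mulm0n ?zvec0 // mulmS zvecD IH mulrS. Qed.
Lemma zvec_inj : injective (@zvec N).
Proof. by move=> p q /rowP h; apply/mnmP => i; have := h i; rewrite !mxE => -[]. Qed.
Lemma zvec_sum (T : Type) (r : seq T) (F : T -> 'X_{1..N}) :
  zvec (\sum_(i <- r) F i)%MM = \sum_(i <- r) zvec (F i).
Proof. exact: (big_morph _ zvecD zvec0). Qed.
Lemma zvecE p : zvec p = \sum_i zvec U_(i)%MM *+ p i.
Proof. by rewrite {1}[p]multinomUE_id zvec_sum; apply: eq_bigr => i _; rewrite zvecMn. Qed.

Lemma zvec_posneg (z : 'rV[int]_N) : exists p q : 'X_{1..N}, zvec p - zvec q = z.
Proof.
exists [multinom absz (Num.max (z 0 i) 0)%R | i < N], [multinom absz (Num.max (- z 0 i) 0)%R | i < N].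
apply/rowP => i; rewrite !mxE !mnmE. by set t := z 0 i; case: (ltP t 0); lia.
Qed.

Lemma zvec_basis (z : 'rV[int]_N) : z = \sum_i zvec U_(i)%MM *~ z 0 i.
Proof.
apply/rowP => j; rewrite summxE (bigD1 j) //= big1 => [|i ne]; rewrite -scaler_int !mxE mnm1E.
  by rewrite eqxx addr0 intz mulr1.
by rewrite (negbTE ne) mulr0.
Qed.

End Zvec.

Section WeightPart.
Variables (N : nat) (Phi : zmodType) (w : {additive 'rV[int]_N -> Phi}) (k : comNzRingType).
Local Notation S := (mseries N k).
Local Notation X := 'X_{1..N}.
Implicit Types (x y : S) (p q m : X) (phi psi : Phi) (g h : {mpoly k[N]}).

Lemma wtD p q : wt w (p + q)%MM = wt w p + wt w q.
Proof. by rewrite /wt zvecD raddfD. Qed.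
Lemma wt0 : wt w 0%MM = 0.
Proof. by rewrite /wt zvec0 raddf0. Qed.
Lemma wtE p : wt w p = \sum_i wt w U_(i)%MM *+ p i.
Proof. by rewrite {1}/wt zvecE raddf_sum; apply: eq_bigr => i _; rewrite raddfMn. Qed.

Definition fin_part phi x :=
  exists g : {mpoly k[N]}, forall m, g@_m = if wt w m == phi then coef x m else 0.

Lemma weight_partE phi x m : fin_part phi x ->
  (weight_part w phi x)@_m = if wt w m == phi then coef x m else 0.
Proof. by case=> g gE; rewrite /weight_part; case: xgetP => [h _ /(_ m)|/(_ g)]. Qed.

Lemma weight_part_eq phi x g :
  (forall m, g@_m = if wt w m == phi then coef x m else 0) -> weight_part w phi x = g.
Proof. by move=> gE; apply/mpolyP => m; rewrite weight_partE ?gE //; exists g. Qed.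

Lemma fin_part_bounded D phi x :
  (forall m, wt w m = phi -> coef x m <> 0 -> (mdeg m < D)%N) -> fin_part phi x.
Proof.
move=> xD; exists (\sum_(m : 'X_{1..N < D}) (if wt w m == phi then coef x m else 0) *: 'X_[m]).
move=> m; have [lt|le] := ltnP (mdeg m) D; 
  first by rewrite (mcoeff_mpoly (fun m => if wt w m == phi then coef x m else 0)).
rewrite raddf_sum big1 /= => [|p _]; last first.
  rewrite mcoeffZ mcoeffX; case: (bmnm p =P m) => [e|_]; last by rewrite mulr0.
  by have := bmdeg p; rewrite e ltnNge le.
case: eqP => // mphi; apply/esym; apply: contrapT => nz.
by have := xD m mphi nz; rewrite ltnNge le.
Qed.

Lemma fin_part_poly phi g : fin_part phi (series_of_poly g).
Proof.
apply: (@fin_part_bounded (msize g)) => m _ /eqP /=.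
by rewrite -mcoeff_msupp => /msize_mdeg_lt.
Qed.

Lemma weight_partB phi x y : fin_part phi x -> fin_part phi y ->
  weight_part w phi (x - y) = weight_part w phi x - weight_part w phi y.
Proof.
move=> fx fy; apply: weight_part_eq => m; rewrite mcoeffB !weight_partE // coefB.
by case: eqP; rewrite ?subrr.
Qed.

Lemma weight_partD phi x y : fin_part phi x -> fin_part phi y ->
  weight_part w phi (x + y) = weight_part w phi x + weight_part w phi y.
Proof.
move=> fx fy; apply: weight_part_eq => m; rewrite mcoeffD !weight_partE // coefD.
by case: eqP; rewrite ?addr0.
Qed.

Lemma weight_part0 phi : weight_part w phi (0 : S) = 0.
Proof. by apply: weight_part_eq => m; rewrite mcoeff0 if_same. Qed.

Lemma weight_partM phi psi x y : fin_part phi x -> fin_part psi y ->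
  (forall p q, coef x p <> 0 -> coef y q <> 0 -> wt w p + wt w q = phi + psi ->
     wt w p = phi /\ wt w q = psi) ->
  weight_part w (phi + psi) (x * y) = weight_part w phi x * weight_part w psi y.
Proof.
move=> fx fy sep; apply: weight_part_eq => m; rewrite mcoeffM coefM.
have [mE|ne] := eqVneq (wt w m) (phi + psi).
  apply: eq_bigr => -[p q] /= /eqP pq; rewrite !weight_partE //.
  have [->|/eqP px] := eqVneq (coef x p) 0; first by rewrite if_same !mul0r.
  have [->|/eqP qy] := eqVneq (coef y q) 0; first by rewrite if_same !mulr0.
  by have [|-> ->] := sep p q px qy; [rewrite -wtD -pq | rewrite !eqxx].
rewrite big1 // => -[p q] /= /eqP pq; rewrite !weight_partE //.
case: eqP => [pE|_]; last by rewrite mul0r.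
case: eqP => [qE|_]; last by rewrite mulr0.
by case/eqP: ne; rewrite -pE -qE -wtD -pq.
Qed.

Definition hpart phi g := weight_part w phi (series_of_poly g).

Lemma hpartE phi g m : (hpart phi g)@_m = if wt w m == phi then g@_m else 0.
Proof. by rewrite weight_partE //; apply: fin_part_poly. Qed.

Lemma hpartD phi g h : hpart phi (g + h) = hpart phi g + hpart phi h.
Proof. by apply/mpolyP => m; rewrite mcoeffD !hpartE mcoeffD; case: eqP; rewrite ?addr0. Qed.

Lemma hpart0 phi : hpart phi 0 = 0.
Proof. by apply/mpolyP => m; rewrite hpartE mcoeff0 if_same. Qed.

Lemma hpartZ phi a g : hpart phi (a *: g) = a *: hpart phi g.
Proof. by apply/mpolyP => m; rewrite mcoeffZ !hpartE mcoeffZ; case: eqP; rewrite ?mulr0. Qed.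

Lemma hpart_sum phi (T : Type) (r : seq T) (F : T -> {mpoly k[N]}) :
  hpart phi (\sum_(i <- r) F i) = \sum_(i <- r) hpart phi (F i).
Proof. exact: (big_morph _ (hpartD phi) (hpart0 phi)). Qed.

Lemma hpart_homog phi psi g : (forall m, g@_m <> 0 -> wt w m = psi) ->
  hpart phi g = if psi == phi then g else 0.
Proof.
move=> hg; apply/mpolyP => m; rewrite hpartE.
have [z|/eqP /hg ->] := eqVneq (g@_m) 0; last by case: eqP; rewrite ?mcoeff0.
by rewrite z if_same; case: eqP; rewrite ?mcoeff0.
Qed.

Lemma hpartX phi p : hpart phi 'X_[p] = if wt w p == phi then 'X_[p] else 0.
Proof.
apply: hpart_homog => m; rewrite mcoeffX.
by have [->|_] := eqVneq p m.
Qed.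

Lemma hpartMX phi p g : hpart phi ('X_[p] * g) = 'X_[p] * hpart (phi - wt w p) g.
Proof.
rewrite /hpart rmorphM -{1}(subrK (wt w p) phi) addrC weight_partM.
- by rewrite -/(hpart _ 'X_[p]) hpartX eqxx.
- exact: fin_part_poly.
- exact: fin_part_poly.
move=> q m /=; rewrite mcoeffX; have [<- _ _|//] := eqVneq p q.
by move/addrI.
Qed.

Lemma hpart_decomp g : g = \sum_(phi <- undup [seq wt w m | m <- msupp g]) hpart phi g.
Proof.
apply/mpolyP => m; rewrite raddf_sum /=.
have [ms|/memN_msupp_eq0 z] := boolP (m \in msupp g); last first.
  by rewrite z big1 // => phi _; rewrite hpartE z if_same.
rewrite (bigD1_seq (wt w m)) ?undup_uniq //=; last by rewrite mem_undup map_f.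
rewrite hpartE eqxx big1 ?addr0 // => phi ne.
by rewrite hpartE eq_sym (negbTE ne).
Qed.

End WeightPart.

Section TorusPoint.
Variables (N : nat) (Phi : zmodType) (w : {additive 'rV[int]_N -> Phi}) (k : fieldType).
Variable c : 'I_N -> k.
Hypothesis c_neq0 : forall i, c i != 0.
Local Notation X := 'X_{1..N}.
Implicit Types (p q m : X) (phi psi : Phi) (g h : {mpoly k[N]}).

Definition mono p : k := \prod_i c i ^+ p i.

Lemma monoD p q : mono (p + q)%MM = mono p * mono q.
Proof. by rewrite /mono -big_split; apply: eq_bigr => i _; rewrite mnmDE exprD. Qed.
Lemma mono_neq0 p : mono p != 0.
Proof. by apply/prodf_neq0 => i _; rewrite expf_neq0. Qed.
Lemma monoE p : ('X_[p]).@[c] = mono p.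
Proof. exact: mevalX. Qed.

(** The polynomials vanishing, one weight at a time, at [c]. *)
Definition vanish : set {mpoly k[N]} := [set g | forall phi, (hpart w phi g).@[c] = 0].

Lemma vanish_ideal : is_ideal vanish.
Proof.
split=> [phi|g h hg hh phi|g h hh phi].
- by rewrite hpart0 meval0.
- by rewrite hpartD mevalD hg hh addr0.
- rewrite [g]mpolyE mulr_suml hpart_sum raddf_sum big1_seq //= => m _.
  by rewrite -scalerAl hpartZ mevalZ hpartMX mevalM hh !mulr0.
Qed.

Lemma vanish_mulX p g : vanish ('X_[p] * g) -> vanish g.
Proof.
move=> h phi; have := h (phi + wt w p); rewrite hpartMX addrK mevalM monoE => /eqP.
by rewrite mulf_eq0 (negbTE (mono_neq0 p)) => /eqP.
Qed.

Lemma vanish_binomial p q a : wt w p = wt w q -> mono p = a * mono q ->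
  vanish ('X_[p] - a *: 'X_[q]).
Proof.
move=> pq e phi; rewrite (@hpart_homog _ _ _ _ phi (wt w q)).
  by case: eqP => _; rewrite ?meval0 // mevalB mevalZ !monoE e subrr.
move=> m; rewrite mcoeffB mcoeffZ !mcoeffX.
have [<- //|_] := eqVneq p m; have [<- //|_] := eqVneq q m.
by rewrite mulr0 subr0.
Qed.

(** A component [h] of one weight is the sum of the terms [h@_m ('X_[m] - (c^m / c^q) 'X_[q])] and
    of a multiple of ['X_[q]] whose coefficient is [h] evaluated at [c], divided by [c^q], that is,
    zero. *)
Lemma vanish_sub (I : set {mpoly k[N]}) : is_ideal I ->
  (forall p q, wt w p = wt w q -> I ('X_[p] - (mono p / mono q) *: 'X_[q])) ->
  vanish `<=` I.
Proof.
move=> hI Ibin g vg; rewrite [g](hpart_decomp w); apply: ideal_sum => // phi _.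
set h := hpart w phi g; have hphi m : h@_m <> 0 -> wt w m = phi.
  by rewrite /h hpartE; case: eqP.
have hc : h.@[c] = 0 by apply: vg.
have [->|h0] := eqVneq h 0; first exact: ideal0.
have [q qh] : exists q, q \in msupp h.
  by case E: (msupp h) => [|q r]; [move: h0; rewrite -msupp_eq0 E | exists q; rewrite mem_head].
have msE m : m \in msupp h -> wt w m = phi by rewrite mcoeff_msupp => /eqP /hphi.
have -> : h = \sum_(m <- msupp h) h@_m *: ('X_[m] - (mono m / mono q) *: 'X_[q]).
  under eq_bigr do rewrite scalerBr.
  rewrite sumrB -mpolyE.
  under eq_bigr do rewrite scalerA mulrA.
  rewrite -scaler_suml -mulr_suml.
  have -> : \sum_(m <- msupp h) h@_m * mono m = h.@[c] by rewrite mevalE.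
  by rewrite hc mul0r scale0r subr0.
rewrite big_seq_cond; apply: ideal_sum => // m /andP [/msE mphi _].
by rewrite -mul_mpolyC; apply: idealMl => //; apply: Ibin; rewrite mphi (msE q).
Qed.

End TorusPoint.

Lemma rowZ_int (n : nat) (a : int) (z : 'rV[int]_n) : a *: z = z *~ a.
Proof. by rewrite -scaler_int intz. Qed.

Section WeightSection.
Variables (N r : nat) (w : {additive 'rV[int]_N -> 'rV[int]_r}).
Hypothesis w_gen : forall phi, exists c : 'I_N -> int, phi = \sum_i wt w U_(i)%MM *~ c i.

Lemma weight_coords (z : 'rV[int]_N) : w z = \sum_i wt w U_(i)%MM *~ z 0 i.
Proof.
rewrite {1}[z]zvec_basis raddf_sum; apply: eq_bigr => i _.
exact: raddfMz.
Qed.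

(** The value group is free, so lifts of the basis vectors define a section of [w]. *)
Lemma weight_section : exists D : 'M[int]_(r, N), forall phi, w (phi *m D) = phi.
Proof.
have [C CE] := choice (fun j : 'I_r => w_gen (delta_mx 0 j)).
exists (\matrix_(j, i) C j i) => phi.
rewrite {1}[phi]row_sum_delta mulmx_suml raddf_sum [RHS]row_sum_delta.
apply: eq_bigr => j _; rewrite -scalemxAl -rowE !rowZ_int raddfMz; congr (_ *~ _).
rewrite CE weight_coords; apply: eq_bigr => i _; by rewrite !mxE.
Qed.

End WeightSection.

Section BinomialIdeal.
Variables (N r s : nat) (k : fieldType) (w : {additive 'rV[int]_N -> 'rV[int]_r}).
Variables (m n : 'I_s -> 'X_{1..N}) (lambda : 'I_s -> k).
Hypothesis w_gen : forall phi, exists c : 'I_N -> int, phi = \sum_i wt w U_(i)%MM *~ c i.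
Hypothesis w_ker : forall z : 'rV[int]_N, w z = 0 <->
  exists c : 'I_s -> int, z = \sum_l (zvec (m l) - zvec (n l)) *~ c l.
Hypothesis w_fin : forall phi (x : mseries N k), fin_part w phi x.
Hypothesis bin_prime : prime_binomial_ideal m n lambda.
Local Notation S := (mseries N k).
Local Notation X := 'X_{1..N}.
Local Notation J := (binomials m n lambda).
Local Notation IS := (ideal_span (@series_of_poly N k @` J)).
Implicit Types (p q t : X) (z : 'rV[int]_N).

Let IS_prime : prime_ideal IS. Proof. by case: bin_prime. Qed.
Let IS_ideal : is_ideal IS. Proof. exact: span_ideal. Qed.

Lemma wt_binomial l : wt w (m l) = wt w (n l).
Proof.
apply/eqP; rewrite -subr_eq0 /wt -raddfB; apply/eqP/w_ker.
exists (fun l' => (l' == l)%:Z); rewrite (bigD1 l) //= eqxx big1 ?addr0 // => l' /negbTE -> .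
by rewrite mulr0z.
Qed.

Lemma IS_no_mono p : ~ IS (sX k p).
Proof.
have [_ _ _ nX] := bin_prime; have [_ IS1 ISM] := IS_prime.
move: p; suff H d p : mdeg p = d -> ~ IS (sX k p) by move=> p; apply: H erefl.
elim: d p => [|d IH] p.
  by move/eqP; rewrite mdeg_eq0 => /eqP ->; rewrite sX0.
move=> dp; have [i pi] : exists i, (U_(i) <= p)%MM.
  apply: contrapT => h; suff p0 : p = 0%MM by rewrite p0 mdeg0 in dp.
  apply/mnmP => i; rewrite mnm0E; apply/eqP/negPn/negP => pi0.
  by apply: h; exists i; rewrite lep1mP.
rewrite -(submK pi) sXD => /ISM [|/nX //].
apply: IH; apply/eqP; rewrite -(eqn_add2r 1) -(mdeg1 i) -mdegD submK // dp.
by rewrite mdeg1 addn1.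
Qed.

(** [u^p = a u^q] modulo the binomials. *)
Definition brel p q a := IS (sX k p - sC N a * sX k q).

Lemma brel_refl p : brel p p 1.
Proof.
rewrite /brel; have -> : sC N (1 : k) = 1 by rewrite /sC mpolyC1 rmorph1.
by rewrite mul1r subrr; apply: ideal0.
Qed.

Lemma brelM p q a p' q' a' : brel p q a -> brel p' q' a' -> brel (p + p')%MM (q + q')%MM (a * a').
Proof.
move=> h h'; rewrite /brel !sXD sCM.
have -> : sX k p * sX k p' - sC N a * sC N a' * (sX k q * sX k q') =
  sX k p' * (sX k p - sC N a * sX k q) + sC N a * sX k q * (sX k p' - sC N a' * sX k q') by ring.
by apply: idealD => //; apply: idealMl.
Qed.

Lemma brel_bin l : brel (m l) (n l) (lambda l).
Proof.
rewrite /brel -series_of_polyZ -rmorphB; apply: subset_span.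
by exists (lbinomial (m l) (n l) (lambda l)) => //; exists l.
Qed.

Lemma brel_pow p q a e : brel p q a -> brel (p *+ e)%MM (q *+ e)%MM (a ^+ e).
Proof.
move=> h; elim: e => [|e IH]; first by rewrite !mulm0n expr0; apply: brel_refl.
by rewrite !mulmS exprS; apply: brelM.
Qed.

Lemma brel_sum (e : 'I_s -> nat) :
  brel (\sum_l m l *+ e l)%MM (\sum_l n l *+ e l)%MM (\prod_l lambda l ^+ e l).
Proof.
elim/big_rec3: _ => [|l a q p _ h]; first exact: brel_refl.
by apply: brelM h; apply: brel_pow; apply: brel_bin.
Qed.

Lemma brel_trans p q q' a a' : a != 0 -> brel p q a -> brel p q' a' -> brel q q' (a' / a).
Proof.
move=> a0 h h'; rewrite /brel.
have e : sC N a^-1 * sC N a = 1 by rewrite -sCM mulVf // /sC mpolyC1 rmorph1.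
have -> : sX k q - sC N (a' / a) * sX k q' =
  sC N a^-1 * ((sX k p - sC N a' * sX k q') - (sX k p - sC N a * sX k q)).
  rewrite sCM -{1}[sX k q]mul1r -e; ring.
by apply: idealMl => //; apply: idealB.
Qed.

Lemma brel_cancel p q t a : brel (p + t)%MM (q + t)%MM a -> brel p q a.
Proof.
rewrite /brel !sXD => h; have [_ _ ISM] := IS_prime.
have /ISM [/IS_no_mono //|//] : IS (sX k t * (sX k p - sC N a * sX k q)).
by have -> : sX k t * (sX k p - sC N a * sX k q) =
  sX k p * sX k t - sC N a * (sX k q * sX k t) by ring.
Qed.

Lemma brel_uniq p q a a' : brel p q a -> brel p q a' -> a = a'.
Proof.
move=> h h'; apply/eqP; rewrite -subr_eq0; apply/negPn/negP => ne; apply: (@IS_no_mono q).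
have e : sC N (a - a')^-1 * sC N (a - a') = 1 by rewrite -sCM mulVf // /sC mpolyC1 rmorph1.
have eB : sC N (a - a') = sC N a - sC N a' by rewrite /sC mpolyCB rmorphB.
have -> : sX k q = sC N (a - a')^-1 *
  ((sX k p - sC N a' * sX k q) - (sX k p - sC N a * sX k q)).
  by rewrite -{1}[sX k q]mul1r -e eB; ring.
by apply: idealMl => //; apply: idealB.
Qed.

(** Write [p - q] as a combination of the [m l - n l] and separate positive from negative
    coefficients. One and the same monomial is then congruent to multiples of [u^(p + T)] and
    [u^(q + T)], with products of the [lambda l] as constants; [u^T] cancels because the ideal is
    prime and contains no monomial. *)
Lemma brel_ex p q : wt w p = wt w q -> exists2 a, a != 0 & brel p q a.
Proof.
move=> pq; have [lam0 _ _ _] := bin_prime.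
have [|c cE] := (w_ker (zvec p - zvec q)).1; first by rewrite raddfB; apply/eqP; rewrite subr_eq0; apply/eqP.
pose a l := absz (Num.max (c l) 0)%R; pose b l := absz (Num.max (- c l) 0)%R.
have abE l : c l = (a l)%:Z - (b l)%:Z by rewrite /a /b; case: (ltP (c l) 0); lia.
have mE : (p + (\sum_l m l *+ b l) + (\sum_l n l *+ a l) =
           q + (\sum_l m l *+ a l) + (\sum_l n l *+ b l))%MM.
  apply: zvec_inj; rewrite !zvecD !zvec_sum.
  apply/eqP; rewrite -subr_eq0; apply/eqP.
  set A := \sum_l zvec (m l *+ b l)%MM; set B := \sum_l zvec (n l *+ a l)%MM.
  set C := \sum_l zvec (m l *+ a l)%MM; set E := \sum_l zvec (n l *+ b l)%MM.
  have -> : zvec p + A + B - (zvec q + C + E) = (zvec p - zvec q) - (C - A - B + E).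
    by apply/rowP => i; rewrite !mxE; ring.
  rewrite cE /A /B /C /E -!sumrB -big_split -sumrB big1 // => l _ /=.
  by rewrite !zvecMn abE; apply/rowP => i; rewrite -!rowZ_int -!scaler_nat !mxE; ring.
have prod_neq0 e : \prod_l lambda l ^+ e l != 0.
  by apply/prodf_neq0 => l _; rewrite expf_neq0 //; apply/eqP.
pose T := (\sum_l n l *+ a l + \sum_l n l *+ b l)%MM.
have h1 : brel (p + (\sum_l m l *+ b l) + (\sum_l n l *+ a l))%MM (p + T)%MM (\prod_l lambda l ^+ b l).
  have -> : (p + T = p + (\sum_l n l *+ b l) + (\sum_l n l *+ a l))%MM.
    by rewrite /T -addmA; congr (_ + _)%MM; rewrite addmC.
  rewrite -[X in brel _ _ X]mulr1; apply: brelM (brel_refl _).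
  by rewrite -[X in brel _ _ X]mul1r; apply: brelM (brel_sum _); apply: brel_refl.
have h2 : brel (p + (\sum_l m l *+ b l) + (\sum_l n l *+ a l))%MM (q + T)%MM (\prod_l lambda l ^+ a l).
  rewrite mE /T addmA.
  rewrite -[X in brel _ _ X]mulr1; apply: brelM (brel_refl _).
  by rewrite -[X in brel _ _ X]mul1r; apply: brelM (brel_sum _); apply: brel_refl.
exists ((\prod_l lambda l ^+ a l) / (\prod_l lambda l ^+ b l)).
  by rewrite mulf_neq0 // invr_eq0.
by apply: (@brel_cancel _ _ T); apply: brel_trans h1 h2.
Qed.

(** The character of the lattice [ker w] that defines the binomial variety in the torus; meaningful
    only when [w z = 0]. *)
Definition chi z : k := xget 1 [set a | a != 0 /\
  exists p q, zvec p - zvec q = z /\ brel p q a].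

Lemma chiP z : w z = 0 -> chi z != 0 /\ forall p q, zvec p - zvec q = z -> brel p q (chi z).
Proof.
move=> wz; have [p0 [q0 z0]] := zvec_posneg z.
have [|a0 a00 h0] := @brel_ex p0 q0.
  by apply/eqP; rewrite -subr_eq0 /wt -raddfB z0 wz.
have ex : [set a | a != 0 /\ exists p q, zvec p - zvec q = z /\ brel p q a] a0.
  by split=> //; exists p0, q0.
rewrite /chi; case: xgetP => [a ->|/(_ a0)//] [an0 [p [q [pqz hpq]]]].
split=> // p' q' pqz'; apply: (@brel_cancel _ _ q).
have e : (p' + q = p + q')%MM.
  apply: zvec_inj; rewrite !zvecD; apply/eqP; rewrite -(subr_eq0 (_ + _)).
  rewrite -[X in _ == X](subrr z) -{1}pqz' -pqz; apply/eqP/rowP => i; rewrite !mxE; ring.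
rewrite e [(q' + q)%MM]addmC -[X in brel _ _ X]mulr1; apply: brelM hpq _; exact: brel_refl.
Qed.

Lemma chiE p q a : wt w p = wt w q -> brel p q a -> chi (zvec p - zvec q) = a.
Proof.
move=> pq h; have [|_ h'] := @chiP (zvec p - zvec q).
  by rewrite raddfB; apply/eqP; rewrite subr_eq0; apply/eqP.
exact: brel_uniq (h' p q erefl) h.
Qed.

Lemma chiD z z' : w z = 0 -> w z' = 0 -> chi (z + z') = chi z * chi z'.
Proof.
move=> wz wz'; have [p [q e]] := zvec_posneg z; have [p' [q' e']] := zvec_posneg z'.
have -> : z + z' = zvec (p + p')%MM - zvec (q + q')%MM.
  by rewrite !zvecD -e -e' opprD addrACA.
apply: chiE; last by apply: brelM; [apply: (chiP wz).2 | apply: (chiP wz').2].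
apply/eqP; rewrite -subr_eq0 /wt -raddfB !zvecD opprD addrACA e e' raddfD wz wz' addr0.
exact: eqxx.
Qed.

(** The section of [w] makes [nrm] a projection of [Z^N] onto [ker w], so [chi \o nrm] is a
    character of [Z^N] extending [chi]. Its values on the basis vectors are the coordinates of a
    point of the torus, rational over [k]. *)
Theorem torus_point : exists c : 'I_N -> k, (forall i, c i != 0) /\
  forall p q, wt w p = wt w q -> brel p q (mono c p / mono c q).
Proof.
have [D DE] := weight_section w_gen.
pose nrm z := z - w z *m D.
have nrm0 z : w (nrm z) = 0 by rewrite raddfB DE subrr.
have nrmD z z' : nrm (z + z') = nrm z + nrm z'.
  by rewrite /nrm raddfD mulmxDl opprD addrACA.
have nrmP z : w z = 0 -> nrm z = z by move=> h; rewrite /nrm h mul0mx subr0.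
pose c i := chi (nrm (zvec U_(i)%MM)).
have c0 i : c i != 0 by apply: (chiP (nrm0 _)).1.
have chi0 : chi 0 = 1.
  by rewrite -(subrr (zvec 0%MM)); apply: chiE => //; apply: brel_refl.
have monoP p : mono c p = chi (nrm (zvec p)).
  pose ext z := chi (nrm z).
  have extD z z' : ext (z + z') = ext z * ext z' by rewrite /ext nrmD chiD.
  have ext0 : ext 0 = 1 by rewrite /ext nrmP ?raddf0.
  have extMn z e : ext (z *+ e) = ext z ^+ e.
    by elim: e => [|e IH]; rewrite ?mulr0n ?expr0 // mulrS extD IH exprS.
  rewrite -/(ext _) zvecE (big_morph ext extD ext0) /mono.
  by apply: eq_bigr => i _; rewrite extMn.
exists c; split=> // p q pq.
have wpq : w (zvec p - zvec q) = 0 by rewrite raddfB; apply/eqP; rewrite subr_eq0; apply/eqP.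
have -> : mono c p / mono c q = chi (zvec p - zvec q); last exact: (chiP wpq).2.
rewrite !monoP; apply: (canLR (mulfK (chiP (nrm0 _)).1)).
by rewrite -{1}(subrK (zvec q) (zvec p)) nrmD chiD // nrmP.
Qed.

(** A relation with power series coefficients becomes one with polynomial coefficients by taking its
    part of weight [wt w p], since only finitely many monomials have a given weight. *)
Lemma brel_poly p q a : wt w p = wt w q -> brel p q a ->
  ideal_span J ('X_[p] - a *: 'X_[q]).
Proof.
move=> pq [e [c [g [gJ gE]]]].
have hJ := span_ideal J.
pose phi := wt w p.
have hom x y : wt w x = wt w y -> forall b, forall u, ('X_[x] - b *: 'X_[y] : {mpoly k[N]})@_u <> 0 -> wt w u = wt w y.
  move=> xy b u; rewrite mcoeffB mcoeffZ !mcoeffX.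
  have [<- //|_] := eqVneq x u; have [<- //|_] := eqVneq y u.
  by rewrite mulr0 subr0.
have -> : 'X_[p] - a *: 'X_[q] = hpart w phi ('X_[p] - a *: 'X_[q]).
  by rewrite (hpart_homog _ (hom p q pq a)) /phi pq eqxx.
have gL i : exists l, g i = series_of_poly (lbinomial (m l) (n l) (lambda l)).
  by case: (gJ i) => _ [l _ <-] <-; exists l.
have {gL} [L LE] := choice gL.
rewrite /hpart rmorphB /= series_of_polyZ gE.
have -> : weight_part w phi (\sum_i c i * g i) =
    \sum_i weight_part w (phi - wt w (n (L i))) (c i) * lbinomial (m (L i)) (n (L i)) (lambda (L i)).
  rewrite (big_morph (weight_part w phi) (fun x y => weight_partD (w_fin phi x) (w_fin phi y))
    (weight_part0 _ _ phi)).
  apply: eq_bigr => i _.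
  rewrite LE -{1}(subrK (wt w (n (L i))) phi) weight_partM //.
    congr (_ * _); rewrite -/(hpart w _ _) /lbinomial.
    by rewrite (hpart_homog _ (hom _ _ (wt_binomial (L i)) _)) eqxx.
  move=> x y _ /= /(hom _ _ (wt_binomial (L i))) ->.
  by move/addIr => ->.
apply: ideal_sum => // i _; apply: idealMl => //; apply: subset_span.
by exists (L i).
Qed.

Corollary binomial_torus_point : exists c : 'I_N -> k, [/\ forall i, c i != 0,
    forall p q, wt w p = wt w q -> ideal_span J ('X_[p] - (mono c p / mono c q) *: 'X_[q])
  & forall l, mono c (m l) = lambda l * mono c (n l)].
Proof.
have [c [c0 cP]] := torus_point; exists c; split=> // [p q pq|l].
  by apply: brel_poly => //; apply: cP.
rewrite (brel_uniq (brel_bin l) (cP _ _ (wt_binomial l))) divfK //.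
exact: mono_neq0.
Qed.

End BinomialIdeal.

(** * Normal forms and the valuation *)

Lemma span_range (A : comPzRingType) s (G : 'I_s -> A) x :
  ideal_span (range G) x <-> exists h : 'I_s -> A, x = \sum_l h l * G l.
Proof.
split; last first.
  by move=> [h ->]; exists s, h, G; split=> // i; exists i.
pose Q := [set x | exists h : 'I_s -> A, x = \sum_l h l * G l].
suff hQ : is_ideal Q.
  apply: (span_min hQ) => _ [l _ <-]; exists (fun i => (i == l)%:R).
  rewrite (bigD1 l) //= eqxx mul1r big1 ?addr0 // => i /negbTE -> ; exact: mul0r.
split=> [|_ _ [c ->] [d ->]|a _ [c ->]].
- by exists (fun=> 0); rewrite big1 // => i _; exact: mul0r.
- by exists (fun i => c i + d i); rewrite -big_split; apply: eq_bigr => i _; rewrite mulrDl.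
- by exists (fun i => a * c i); rewrite mulr_sumr; apply: eq_bigr => i _; rewrite mulrA.
Qed.

Section NormalForm.
Variables (N s : nat) (k : fieldType) (Phi : zmodType) (w : {additive 'rV[int]_N -> Phi}).
Variables (m n : 'I_s -> 'X_{1..N}) (lambda : 'I_s -> k) (F : 'I_s -> mseries N k).
(** [ex p j] stands for the exponent of [y_j] in [u^p] on a chart and [T] for the set of coordinates
    of positive value; the hypotheses below are all that is used of a chart. *)
Variables (ex : 'X_{1..N} -> 'I_N -> nat) (T : pred 'I_N) (c : 'I_N -> k).
Local Notation S := (mseries N k).
Local Notation X := 'X_{1..N}.
Local Notation J := (binomials m n lambda).
Local Notation IF := (ideal_span (range F)).
Local Notation bin l := (lbinomial (m l) (n l) (lambda l)).
Implicit Types (p q u : X) (f g : S).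

Hypothesis exD : forall p q j, ex (p + q)%MM j = (ex p j + ex q j)%N.
Hypothesis ex_wt : forall p q, wt w p = wt w q <-> forall j, T j -> ex p j = ex q j.
Hypothesis ex_pos : forall i, exists2 j, T j & (0 < ex U_(i)%MM j)%N.
Hypothesis F_over : forall l p, coef (F l - series_of_poly (bin l)) p <> 0 ->
  (forall j, T j -> (ex (m l) j <= ex p j)%N) /\ exists2 j, T j & (ex (m l) j < ex p j)%N.
Hypothesis c_neq0 : forall i, c i != 0.
Hypothesis J_mono : forall p q, wt w p = wt w q ->
  ideal_span J ('X_[p] - (mono c p / mono c q) *: 'X_[q]).
Hypothesis wt_bin : forall l, wt w (m l) = wt w (n l).

(** Unlike [w], the integral weight [lw] bounds the degree, so that the
    successive approximations below converge. *)
Definition lw p := (\sum_(j | T j) ex p j)%N.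

Lemma lwD p q : lw (p + q)%MM = (lw p + lw q)%N.
Proof. by rewrite /lw -big_split; apply: eq_bigr => j _; rewrite exD. Qed.

Lemma lw_ge p : (mdeg p <= lw p)%N.
Proof.
have lw0 : lw 0%MM = 0%N by have := lwD 0 0; rewrite addm0; lia.
rewrite {2}[p]multinomUE_id (big_morph lw lwD lw0) mdegE; apply: leq_sum => i _.
elim: (p i) => [|e IH] //; have [j Tj ij] := ex_pos i; rewrite mulmS lwD.
have lt : (0 < lw U_(i)%MM)%N by rewrite /lw (bigD1 j) //=; apply: ltn_addr.
by rewrite -add1n leq_add.
Qed.

Lemma lw_wt p q : wt w p = wt w q -> lw p = lw q.
Proof. by move/ex_wt => h; apply: eq_bigr => j /h. Qed.

(** Monomials of the same weight have the same [lw], hence bounded degree. *)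
Lemma fin_part_all phi f : fin_part w phi f.
Proof.
have [[q <-]|h] := pselect (exists q, wt w q = phi).
  apply: (@fin_part_bounded _ _ _ _ (lw q).+1) => p /lw_wt <- _.
  exact: lw_ge.
by apply: (@fin_part_bounded _ _ _ _ 0) => p pphi; case: h; exists p.
Qed.

Definition up_closed (Z : set X) :=
  forall p q, Z p -> (forall j, T j -> (ex p j <= ex q j)%N) -> Z q.

(** The set always contains [p], so the default value is never taken. *)
Definition rep p := xget 0%MM [set q | wt w q = wt w p].

Lemma wt_rep p : wt w (rep p) = wt w p.
Proof. rewrite /rep; by case: xgetP => [q -> //|/(_ p) []]. Qed.

Lemma rep_wt p q : wt w p = wt w q -> rep p = rep q.
Proof. by rewrite /rep => ->. Qed.

(** The relation between [u^p] and its representative is a combination of the binomials with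
    coefficients homogeneous for the weight. Replacing the binomials by the [F l] leaves products of
    these coefficients with overweight terms, which exceed [p] along [T]. *)
Lemma mono_step p : exists H : 'I_s -> S,
  (forall l u, coef (H l) u <> 0 -> wt w (u + m l)%MM = wt w p) /\
  forall u, coef (sX k p - sC N (mono c p / mono c (rep p)) * sX k (rep p)
                   - \sum_l H l * F l) u <> 0 ->
    (forall j, T j -> (ex p j <= ex u j)%N) /\ (lw p < lw u)%N.
Proof.
have /span_range [h hE] : ideal_span (range (fun l => bin l))
    ('X_[p] - (mono c p / mono c (rep p)) *: 'X_[rep p]).
  by apply: J_mono; rewrite wt_rep.
pose h' l := hpart w (wt w p - wt w (m l)) (h l).
have bin_hom l u : (bin l)@_u <> 0 -> wt w u = wt w (m l).
  rewrite mcoeffB mcoeffZ !mcoeffX.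
  have [<- //|_] := eqVneq (m l) u; have [<- //|_] := eqVneq (n l) u.
  by rewrite mulr0 subr0.
have h'E : 'X_[p] - (mono c p / mono c (rep p)) *: 'X_[rep p] = \sum_l h' l * bin l.
  have -> : 'X_[p] - (mono c p / mono c (rep p)) *: 'X_[rep p] =
      hpart w (wt w p) ('X_[p] - (mono c p / mono c (rep p)) *: 'X_[rep p]).
    rewrite (@hpart_homog _ _ _ _ (wt w p) (wt w p)) ?eqxx // => u.
    rewrite mcoeffB mcoeffZ !mcoeffX.
    have [<- //|_] := eqVneq p u; have [<- _|_] := eqVneq (rep p) u; first exact: wt_rep.
    by rewrite mulr0 subr0.
  rewrite hE hpart_sum; apply: eq_bigr => l _.
  rewrite /hpart rmorphM -{1}(subrK (wt w (m l)) (wt w p)) weight_partM //.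
  - congr (_ * _); rewrite -/(hpart w _ _) (@hpart_homog _ _ _ _ _ (wt w (m l))) ?eqxx //.
    exact: bin_hom.
  - exact: fin_part_poly.
  - exact: fin_part_poly.
  - by move=> u v _ /= /bin_hom -> /addIr ->.
have h'w l u : coef (series_of_poly (h' l)) u <> 0 -> wt w (u + m l)%MM = wt w p.
  by rewrite /= hpartE; case: eqP => // uE _; rewrite wtD uE subrK.
exists (fun l => series_of_poly (h' l)); split=> // u.
have -> : sX k p - sC N (mono c p / mono c (rep p)) * sX k (rep p) -
    \sum_l series_of_poly (h' l) * F l =
    - \sum_l series_of_poly (h' l) * (F l - series_of_poly (bin l)).
  rewrite -series_of_polyZ -rmorphB h'E rmorph_sum -sumrB -sumrN.
  by apply: eq_bigr => l _; rewrite rmorphM; ring.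
rewrite coefN coef_sum => nz.
have [l nzl] : exists l, coef (series_of_poly (h' l) * (F l - series_of_poly (bin l))) u <> 0.
  apply: contrapT => hz; apply: nz; rewrite big1 ?oppr0 // => l _.
  by apply: contrapT => nz; apply: hz; exists l.
have [x [y [-> /h'w xw /F_over [yle [j Tj jlt]]]]] := coefM_supp nzl.
have exE j' : T j' -> ex p j' = (ex x j' + ex (m l) j')%N.
  by move=> Tj'; rewrite -exD; apply/esym; apply: (iffLR (ex_wt _ _) xw).
split=> [j' Tj'|]; first by rewrite exE // exD leq_add2l yle.
rewrite -(lw_wt xw) !lwD ltn_add2l /lw (bigD1 j) //= [X in (_ < X)%N](bigD1 j) //=.
by rewrite -addSn leq_add // leq_sum // => j' /andP [/yle].
Qed.

Definition nf_supp g := forall u, coef g u <> 0 -> u = rep u.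

(** Modulo [(F)], each monomial is a multiple of the chosen monomial of the same
    weight, up to terms of larger [lw] lying above it for every [ex _ j]. *)
Lemma normal_form (Z : set X) f : up_closed Z -> (forall u, coef f u <> 0 -> Z u) ->
  exists2 g, nf_supp g /\ (forall u, coef g u <> 0 -> Z u) & IF (f - g).
Proof.
move=> Zup fZ; have [H HP] := choice mono_step.
(* The multiplier of [F l] used for a monomial of order [d] has order [d - lw (m l)]; this is the
   loss allowed. *)
pose C := (\max_l lw (m l))%N.
have hC (l : 'I_s) : (lw (m l) <= C)%N by exact: (leq_bigmax (F := fun l => lw (m l)) l).
have suppD (Y : set X) (x y : S) : (forall u, coef x u <> 0 -> Y u) ->
    (forall u, coef y u <> 0 -> Y u) -> forall u, coef (x + y) u <> 0 -> Y u.
  move=> hx hy u; rewrite coefD; have [->|/eqP /hx //] := eqVneq (coef x u) 0.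
  by rewrite add0r => /hy.
have [||h [g [gM ->]]] := @series_approx N k lw lwD s F C
   [set u | u = rep u /\ Z u] [set f | forall u, coef f u <> 0 -> Z u] _ f.
- move=> d x xZ xd.
  (* The exponents of order exactly [d]: finite in number because [lw] bounds the degree. *)
  pose idx := [seq bmnm v | v <- [seq v <- enum {: 'X_{1..N < d.+1}} | lw (bmnm v) == d]].
  have idxP p : (p \in idx) = (lw p == d).
    apply/mapP/eqP => [[q] |pd]; first by rewrite mem_filter => /andP [/eqP qd _] ->.
    have lt : (mdeg p < d.+1)%N by rewrite ltnS -pd lw_ge.
    by exists (BMultinom lt); rewrite // mem_filter /= pd eqxx mem_enum.
  have idxU : uniq idx.
    rewrite map_inj_uniq => [|v v' e]; first by rewrite filter_uniq // enum_uniq.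
    exact: (@val_inj _ _ 'X_{1..N < d.+1}).
  pose h l := \sum_(p <- idx) sC N (coef x p) * H p l.
  pose a p := mono c p / mono c (rep p).
  pose g := \sum_(p <- idx) sC N (coef x p) * (sC N (a p) * sX k (rep p)).
  pose top := \sum_(p <- idx) sC N (coef x p) * sX k p.
  pose E p := sX k p - sC N (a p) * sX k (rep p) - \sum_l H p l * F l.
  have xE : x - g - \sum_l h l * F l = (x - top) + \sum_(p <- idx) sC N (coef x p) * E p.
    have -> : \sum_l h l * F l = \sum_(p <- idx) sC N (coef x p) * \sum_l H p l * F l.
      under eq_bigr do rewrite mulr_suml.
      rewrite exchange_big; apply: eq_bigr => p _; rewrite mulr_sumr.
      by apply: eq_bigr => l _; rewrite mulrA.
    have -> : \sum_(p <- idx) sC N (coef x p) * E p = top - g -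
        \sum_(p <- idx) sC N (coef x p) * \sum_l H p l * F l.
      by rewrite /top /g -!sumrB; apply: eq_bigr => p _; rewrite /E; ring.
    ring.
  have suppS (G : X -> S) u : coef (\sum_(p <- idx) sC N (coef x p) * G p) u <> 0 ->
      exists p, [/\ lw p = d, coef x p <> 0 & coef (G p) u <> 0].
    rewrite coef_sum => nz; apply: contrapT => hz; apply: nz.
    rewrite big1_seq // => p /andP [_]; rewrite idxP coef_sCM => /eqP pd.
    have [->|/eqP xp] := eqVneq (coef x p) 0; first by rewrite mul0r.
    have [->|/eqP Gp] := eqVneq (coef (G p) u) 0; first by rewrite mulr0.
    by case: hz; exists p.
  have topE u : coef (x - top) u = if lw u == d then 0 else coef x u.
    rewrite coefB coef_sum; case: eqP => [/eqP ud|/eqP ud].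
      rewrite (bigD1_seq u) ?idxP // coef_sCM coef_sX eqxx mulr1 
          big1 => [|p /negbTE pu]; first by apply/eqP; rewrite subr_eq0 eq_sym; apply/eqP/addr0.
      by rewrite coef_sCM coef_sX pu mulr0.
    rewrite big1_seq ?subr0 // => p /andP [_]; rewrite idxP => pd.
    rewrite coef_sCM coef_sX; have [pu|_] := eqVneq p u; last by rewrite mulr0.
    by rewrite -pu pd in ud.
  have ZE u : coef (x - g - \sum_l h l * F l) u <> 0 -> Z u /\ (d < lw u)%N.
    rewrite xE; move: u; apply: (suppD [set u | Z u /\ (d < lw u)%N]) => u.
      rewrite topE; case: eqP => // /eqP ud nz; split; first exact: xZ.
      by rewrite ltn_neqAle eq_sym ud xd.
    move=> /suppS [p [pd xp /(HP p).2 [ple plt]]]; split; last by rewrite -pd.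
    exact: Zup (xZ p xp) ple.
  exists h, g; split.
  + move=> l u /suppS [p [pd xp /(HP p).1 /lw_wt]]; rewrite lwD pd => uE.
    by have := hC l; lia.
  + move=> u /suppS [p [pd xp]]; rewrite coef_sCM coef_sX.
    have [<- _|_] := eqVneq (rep p) u; last by rewrite mulr0.
    by rewrite (lw_wt (wt_rep p)) pd.
  + move=> u /suppS [p [pd xp]]; rewrite coef_sCM coef_sX.
    have [<- _|_] := eqVneq (rep p) u; last by rewrite mulr0.
    split; first by apply: rep_wt; rewrite wt_rep.
    apply: Zup (xZ p xp) _ => j Tj.
    by rewrite (iffLR (ex_wt _ _) (wt_rep p)).
  + by move=> u /ZE [].
  + by move=> u /ZE [].
- exact: fZ.
exists g; first by split=> u /gM [].
by rewrite addrC addrA addNr add0r; apply/span_range; exists h.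
Qed.

Section Order.
Variable O : group_order Phi.
Hypothesis O_ex : forall p q, (forall j, T j -> (ex p j <= ex q j)%N) -> O (wt w p) (wt w q).
Hypothesis nf_uniq : forall g, IF g -> nf_supp g -> g = 0.
Implicit Types phi psi : Phi.
Local Notation has_weight := (has_weight O w).

Lemma wt_lem p q : (p <= q)%MM -> O (wt w p) (wt w q).
Proof. by move=> pq; apply: O_ex => j _; rewrite -(submK pq) exD leq_addl. Qed.

(** The order on the weights need not be a well-order; the minimum exists because it is reached at
    one of the finitely many minimal exponents of the support. *)
Lemma min_weight f : f <> 0 -> exists phi, has_weight f phi.
Proof.
move=> f0; have [es [esE Ees]] := dickson [set p | coef f p <> 0].
have minE (r : seq X) : r != [::] -> exists2 e, e \in r & forall e', e' \in r -> O (wt w e) (wt w e').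
  elim: r => [|e r IH] // _; have [->|r0] := eqVneq r [::].
    by exists e; [exact: mem_head | move=> e'; rewrite inE => /eqP ->; apply: gle_refl].
  have [e1 e1r h1] := IH r0; have /orP[le|le] := gle_total O (wt w e) (wt w e1).
    exists e; first exact: mem_head.
    by move=> e'; rewrite inE => /predU1P[->|/h1]; [exact: gle_refl | exact: gle_trans].
  exists e1; first by rewrite inE e1r orbT.
  by move=> e'; rewrite inE => /predU1P[->|/h1].
have es0 : es != [::].
  apply/eqP => es0; apply: f0; apply: mseriesP => p.
  by apply: contrapT => /Ees [e]; rewrite es0.
have [e ees emin] := minE es es0; exists (wt w e); split; last by exists e; split=> //; apply: esE.
by move=> p /Ees [e' /emin le /wt_lem]; apply: gle_trans.
Qed.

(** Vanishes exactly when the initial form belongs to the binomial ideal. *)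
Definition ini_val phi f := (weight_part w phi f).@[c].

Lemma weight_gt_ini phi f : weight_gt O w phi f -> ini_val phi f = 0.
Proof.
move=> hf; rewrite /ini_val; have -> : weight_part w phi f = 0; last exact: meval0.
apply: weight_part_eq => p; rewrite mcoeff0; case: eqP => // pphi.
apply/esym; apply: contrapT => /hf [_]; by rewrite pphi.
Qed.

Lemma ini_valB phi f g : ini_val phi (f - g) = ini_val phi f - ini_val phi g.
Proof. by rewrite /ini_val weight_partB ?mevalB //; apply: fin_part_all. Qed.

(** A normal form has a single monomial of weight [phi], and a monomial does not vanish at a point
    of the torus. *)
Lemma ini_val_nf f phi : nf_supp f -> has_weight f phi -> ini_val phi f <> 0.
Proof.
move=> nff [fge [p [pf pphi]]].
have -> : ini_val phi f = coef f p * mono c p; last first.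
  by apply/eqP; rewrite mulf_neq0 ?mono_neq0 //; apply/eqP.
rewrite /ini_val (@weight_part_eq _ _ _ _ phi f (coef f p *: 'X_[p])).
  by rewrite mevalZ monoE.
move=> q; rewrite mcoeffZ mcoeffX; have [<-|pq] := eqVneq p q.
  by rewrite pphi eqxx mulr1.
rewrite mulr0; case: eqP => // qphi; apply/esym; apply: contrapT => /nff qE.
by case/eqP: pq; rewrite (nff p pf) qE; apply: rep_wt; rewrite qphi.
Qed.

(** Evaluation at [c] is multiplicative, so initial forms outside the binomial ideal have their
    product outside it; this makes values additive. *)
Lemma ini_valM phi psi f g : weight_ge O w phi f -> weight_ge O w psi g ->
  ini_val (phi + psi) (f * g) = ini_val phi f * ini_val psi g.
Proof.
move=> hf hg; rewrite /ini_val weight_partM ?mevalM //; try exact: fin_part_all.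
move=> p q /hf pf /hg qg e.
have pE : wt w p = phi.
  apply: (gle_eq (O := O)) => //; apply/gle_sub0.
  have -> : phi - wt w p = wt w q - psi by apply/eqP; rewrite subr_eq addrAC eq_sym subr_eq [wt w q + _]addrC e.
  exact: (iffLR (gle_sub0 O _ _) qg).
by split=> //; move: e; rewrite pE => /addrI.
Qed.

Lemma nf_exists f : ~ IF f -> exists g phi, [/\ IF (f - g), has_weight g phi,
  ini_val phi g <> 0 & forall psi, weight_ge O w psi f -> O psi phi].
Proof.
move=> IFf; pose Z := [set p | forall psi, weight_ge O w psi f -> O psi (wt w p)].
have [|p fp|g [nfg gZ] hg] := @normal_form Z f.
- by move=> p q pZ le psi /pZ h; apply: gle_trans h (O_ex le).
- by move=> psi; apply.
have g0 : g <> 0 by move=> g0; apply: IFf; rewrite g0 subr0 in hg.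
have [phi hphi] := min_weight g0; exists g, phi; split=> //.
  exact: ini_val_nf.
by case: hphi => _ [p [/gZ pZ <-]] psi; apply: pZ.
Qed.

(** Modulo [(F)], the series [f] is [a u^q'] plus terms of weight greater than [phi], where [a] is
    its initial value at [c] divided by [c^q']. Reducing these terms keeps their weight above [phi],
    so [f] has a normal form with coefficient [a] at [q']. If [f] were in [(F)], this normal form
    would be zero by uniqueness. *)
Lemma ini_val_notin f phi : weight_ge O w phi f -> ini_val phi f <> 0 -> ~ IF f.
Proof.
move=> fphi nz IFf; have hIF := span_ideal (range F).
set h := weight_part w phi f in nz.
have hE p : h@_p = if wt w p == phi then coef f p else 0 by apply: weight_partE; apply: fin_part_all.
have [q qh] : exists q, q \in msupp h.
  case E: (msupp h) => [|q r]; last by exists q; rewrite mem_head.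
  by case: nz; rewrite /ini_val -/h [h](msuppnil0 E) meval0.
have hw p : p \in msupp h -> wt w p = phi.
  by rewrite mcoeff_msupp hE; case: (wt w p =P phi) => // _; rewrite eqxx.
have [H HP] := choice mono_step.
pose q' := rep q; have q'w : wt w q' = phi by rewrite wt_rep hw.
have repE p : p \in msupp h -> rep p = q' by move=> ph; apply: rep_wt; rewrite !hw.
pose E p := sX k p - sC N (mono c p / mono c (rep p)) * sX k (rep p) - \sum_l H p l * F l.
pose a := ini_val phi f / mono c q'.
have a0 : a != 0 by rewrite mulf_neq0 ?invr_eq0 ?mono_neq0 //; apply/eqP.
have shE : series_of_poly h = \sum_(p <- msupp h) sC N h@_p * sX k p.
  rewrite {1}[h]mpolyE rmorph_sum; apply: eq_bigr => p _.
  exact: series_of_polyZ.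
pose res := (f - series_of_poly h) + \sum_(p <- msupp h) sC N h@_p * E p.
have fE : f = sC N a * sX k q' + res + \sum_(p <- msupp h) sC N h@_p * \sum_l H p l * F l.
  have -> : sC N a * sX k q' = \sum_(p <- msupp h) sC N h@_p * (sC N (mono c p / mono c q') * sX k q').
    rewrite /a /ini_val -/h mevalE mulr_suml.
    have -> (r : seq X) (G : X -> k) : sC N (\sum_(p <- r) G p) = \sum_(p <- r) sC N (G p).
      by rewrite /sC raddf_sum rmorph_sum.
    rewrite mulr_suml; apply: eq_bigr => p _.
    by rewrite mulrA -sCM mulrA.
  rewrite /res shE.
  have -> : \sum_(p <- msupp h) sC N h@_p * E p = \sum_(p <- msupp h) sC N h@_p * sX k p
     - \sum_(p <- msupp h) sC N h@_p * (sC N (mono c p / mono c q') * sX k q')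
     - \sum_(p <- msupp h) sC N h@_p * \sum_l H p l * F l.
    rewrite -!sumrB !big_seq; apply: eq_bigr => p ph; rewrite /E (repE p ph); ring.
  ring.
have resgt p : coef res p <> 0 -> glt O phi (wt w p).
  rewrite /res coefD => nzr.
  have [z|/eqP nz1] := eqVneq (coef (f - series_of_poly h) p) 0; last first.
    move: nz1; rewrite coefB /= hE; case: eqP => [_|ne]; first by rewrite subrr.
    by rewrite subr0 => /fphi le; split=> // e; apply: ne.
  move: nzr; rewrite z add0r coef_sum => nz2.
  have [u [uh nzu]] : exists u, u \in msupp h /\ coef (E u) p <> 0.
    apply: contrapT => hz; apply: nz2; rewrite big1_seq // => u /andP [_ uh].
    rewrite coef_sCM; have [->|/eqP nzu] := eqVneq (coef (E u) p) 0; first exact: mulr0.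
    by case: hz; exists u.
  have [le lt] := (HP u).2 p nzu; rewrite -(hw u uh); split; first exact: O_ex.
  by move=> /lw_wt e; rewrite e ltnn in lt.
have [|p /resgt //|g [nfg ggt] hg] := @normal_form [set p | glt O phi (wt w p)] res.
  by move=> p u hp le; apply: glt_le_trans hp (O_ex le).
have IFg : IF (sC N a * sX k q' + g).
  have -> : sC N a * sX k q' + g = f - (res - g)
     - \sum_(p <- msupp h) sC N h@_p * \sum_l H p l * F l by rewrite {1}fE; ring.
  apply: idealB => //; first exact: idealB.
  apply: ideal_sum => // p _; apply: idealMl => //; apply: ideal_sum => // l _.
  by apply: idealMl => //; apply: subset_span; exists l.
have coefq' : coef (sC N a * sX k q' + g) q' = a.
  rewrite coefD coef_sCM coef_sX eqxx mulr1; have -> : coef g q' = 0; last exact: addr0.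
  by apply: contrapT => /ggt [_]; rewrite q'w.
have z : sC N a * sX k q' + g = 0.
  apply: nf_uniq => // p; rewrite coefD coef_sCM coef_sX => nzp.
  have [e|ne] := eqVneq q' p; first by rewrite -e; apply: rep_wt; rewrite wt_rep.
  by apply: nfg => gz; apply: nzp; rewrite (negbTE ne) gz mulr0 addr0.
by move: a0; rewrite -coefq' z coef0 eqxx.
Qed.

Local Notation R := (quotient (range F)).
Local Notation qF := (quo (range F)).

Definition val_rel (x : R) phi := exists f, [/\ qF f = x, has_weight f phi & ini_val phi f <> 0].

Lemma quo_IF f g : qF f = qF g <-> IF (f - g). Proof. exact: quoP. Qed.
Lemma quo_eq0 f : qF f = 0 <-> IF f.
Proof. by rewrite -(rmorph0 qF) quo_IF subr0. Qed.

(** A lift of larger weight would differ from the given one by an element of [(F)] with the same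
    nonzero initial value at [c]. *)
Lemma val_rel_max x phi psi f : val_rel x phi -> qF f = x -> weight_ge O w psi f -> O psi phi.
Proof.
move=> [g [gx [gphi _] nz]] fx fpsi; apply: contrapT => lt; have {lt} lt := gltNge lt.
have fgt : weight_gt O w phi f by move=> p /fpsi; apply: glt_le_trans.
apply: (@ini_val_notin (g - f) phi).
- move=> p; rewrite coefB; have [z|/eqP /gphi //] := eqVneq (coef g p) 0.
  by rewrite z sub0r => nzp; apply: glt_gle; apply: fgt => z'; apply: nzp; rewrite z' oppr0.
- by rewrite ini_valB (weight_gt_ini fgt) subr0.
- by apply/quo_IF; rewrite gx fx.
Qed.

Lemma val_rel_uniq x phi psi : val_rel x phi -> val_rel x psi -> phi = psi.
Proof.
move=> hphi hpsi; apply: (gle_eq (O := O)).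
  by case: hphi => f [fx [fphi _] _]; apply: val_rel_max hpsi fx fphi.
by case: hpsi => f [fx [fpsi _] _]; apply: val_rel_max hphi fx fpsi.
Qed.

Lemma val_rel_ex x : x <> 0 -> exists phi, val_rel x phi.
Proof.
have [f <-] := quo_surj x => f0.
have [|g [phi [fg gphi nz _]]] := @nf_exists f; first by move/quo_eq0.
by exists phi, g; split=> //; apply/esym/quo_IF.
Qed.

Lemma val_rel_neq0 x phi : val_rel x phi -> x <> 0.
Proof. by move=> [f [<- [fphi _] nz]] /quo_eq0; apply: ini_val_notin fphi nz. Qed.

Lemma has_weight_ini f phi : weight_ge O w phi f -> ini_val phi f <> 0 -> has_weight f phi.
Proof.
move=> fphi nz; split=> //; apply: contrapT => hz; apply: nz; apply: weight_gt_ini => p nzp.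
by split; [exact: fphi | move=> e; apply: hz; exists p].
Qed.

Lemma weight_geM phi psi f g : weight_ge O w phi f -> weight_ge O w psi g ->
  weight_ge O w (phi + psi) (f * g).
Proof.
by move=> hf hg p /coefM_supp [u [v [-> /hf hu /hg hv]]]; rewrite wtD; apply: gleD.
Qed.

Lemma val_relM x y phi psi : val_rel x phi -> val_rel y psi -> val_rel (x * y) (phi + psi).
Proof.
move=> [f [<- [fphi _] nzf]] [g [<- [gpsi _] nzg]].
have nz : ini_val (phi + psi) (f * g) <> 0.
  by rewrite ini_valM //; apply/eqP; rewrite mulf_neq0 //; apply/eqP.
exists (f * g); split=> //; first by rewrite rmorphM.
by apply: has_weight_ini => //; apply: weight_geM.
Qed.

Lemma val_relD x y phi psi theta delta : val_rel x phi -> val_rel y psi ->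
  val_rel (x + y) theta -> O delta phi -> O delta psi -> O delta theta.
Proof.
move=> [f [fx [fphi _] _]] [g [gy [gpsi _] _]] htheta le le'.
apply: (val_rel_max htheta (f := f + g)); first by rewrite -fx -gy rmorphD.
move=> p; rewrite coefD; have [z|/eqP nz _] := eqVneq (coef f p) 0.
  by rewrite z add0r => /gpsi; apply: gle_trans.
exact: gle_trans le (fphi p nz).
Qed.

Lemma val_rel_mono p : val_rel (qF (sX k p)) (wt w p).
Proof.
have ge : weight_ge O w (wt w p) (sX k p).
  by move=> q; rewrite coef_sX; have [<- _|//] := eqVneq p q; apply: gle_refl.
have nz : ini_val (wt w p) (sX k p) <> 0.
  rewrite /ini_val (@weight_part_eq _ _ _ _ _ _ 'X_[p]); first by rewrite monoE; apply/eqP; apply: mono_neq0.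
  by move=> q; rewrite coef_sX mcoeffX; have [->|_] := eqVneq p q; rewrite ?eqxx ?if_same.
by exists (sX k p); split=> //; apply: has_weight_ini.
Qed.

(** The order [O] need not be the one of the overweight deformation: besides
    [nu], this provides valuations for auxiliary lexicographic orders. *)
Record val_theory : Prop := ValTheory {
  vt_fin : forall phi (f : S), fin_part w phi f;
  vt_ini : forall f phi, weight_ge O w phi f -> ini_val phi f <> 0 -> ~ IF f;
  vt_max : forall x phi psi f, val_rel x phi -> qF f = x -> weight_ge O w psi f -> O psi phi;
  vt_uniq : forall x phi psi, val_rel x phi -> val_rel x psi -> phi = psi;
  vt_ex : forall x, x <> 0 -> exists phi, val_rel x phi;
  vt_neq0 : forall x phi, val_rel x phi -> x <> 0;
  vt_mul : forall x y phi psi, val_rel x phi -> val_rel y psi -> val_rel (x * y) (phi + psi);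
  vt_add : forall x y phi psi theta delta, val_rel x phi -> val_rel y psi ->
    val_rel (x + y) theta -> O delta phi -> O delta psi -> O delta theta }.

Lemma val_theoryP : val_theory.
Proof.
split; [exact: fin_part_all | exact: ini_val_notin | exact: val_rel_max | exact: val_rel_uniq
  | exact: val_rel_ex | exact: val_rel_neq0 | exact: val_relM | exact: val_relD].
Qed.

End Order.
End NormalForm.

(** * Fraction fields and extension of valuations *)

Section DomainAlias.
Local Open Scope quotient_scope.
Variable A : comPzRingType.
Hypothesis A1 : 1 != 0 :> A.
Hypothesis AM : forall x y : A, x * y = 0 -> (x == 0) || (y == 0).

(** A copy of [A] which carries, under the hypotheses of the section, the structure of integral
    domain required to form fractions. *)
Definition domain_alias : Type := A.
Local Notation D := domain_alias.
HB.instance Definition _ := GRing.ComPzRing.on D.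
HB.instance Definition _ := GRing.PzSemiRing_isNonZero.Build D A1.

Definition dom_unit : pred D := fun x => `[< exists y : D, y * x = 1 >].
Definition dom_inv (x : D) : D := if dom_unit x then xget 0 [set y | y * x = 1] else x.
Lemma dom_mulVx : {in dom_unit, left_inverse 1 dom_inv *%R}.
Proof.
move=> x xu; rewrite /dom_inv ifT //; case/asboolP: xu => y yx.
by case: xgetP => [z _ //|/(_ y)].
Qed.
Lemma dom_unitPl : forall x y : D, y * x = 1 -> dom_unit x.
Proof. by move=> x y yx; apply/asboolP; exists y. Qed.
Lemma dom_inv_out : {in [predC dom_unit], dom_inv =1 id}.
Proof. by move=> x /negbTE xu; rewrite /dom_inv -[dom_unit x]/(x \in dom_unit) xu. Qed.
HB.instance Definition _ :=
  GRing.ComNzRing_hasMulInverse.Build D dom_mulVx dom_unitPl dom_inv_out.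
HB.instance Definition _ := GRing.ComUnitRing_isIntegral.Build D AM.

Lemma fraction_field : exists (K : fieldType) (iota : {rmorphism A -> K}),
  is_fraction_field iota.
Proof.
exists {fraction D}, (@tofrac D : {rmorphism D -> {fraction D}}); split.
  by move=> x y /eqP; rewrite tofrac_eq => /eqP.
move=> z; exists (\n_(repr z)), (\d_(repr z)); split.
  by apply/eqP; rewrite tofrac_eq0 denom_ratioP.
apply: (canRL (mulfK _)); first by rewrite tofrac_eq0 denom_ratioP.
have key (n d : D) (f : {ratio D}) : \n_f = n -> \d_f = d ->
    (\pi_{fraction D} f : {fraction D}) * tofrac d = tofrac n.
  move=> fn fd; unlock tofrac; rewrite -[LHS]FracField.pi_mul.
  apply/eqmodP; rewrite /= FracField.equivfE.
  by rewrite !numden_Ratio ?mulr1 ?oner_neq0 -?fd ?denom_ratioP // -fn mulrC.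
by rewrite -{1}[z]reprK; apply: key.
Qed.

End DomainAlias.

Section ExtendValuation.
Variables (Phi : zmodType) (O : group_order Phi) (A : comPzRingType) (K : fieldType).
Variables (iota : {rmorphism A -> K}) (V : A -> Phi -> Prop).
Hypothesis fracK : is_fraction_field iota.
Hypothesis V_ex : forall x, x <> 0 -> exists phi, V x phi.
Hypothesis V_uniq : forall x phi psi, V x phi -> V x psi -> phi = psi.
Hypothesis V_neq0 : forall x phi, V x phi -> x <> 0.
Hypothesis VM : forall x y phi psi, V x phi -> V y psi -> V (x * y) (phi + psi).
Hypothesis VD : forall x y phi psi theta delta, V x phi -> V y psi ->
  V (x + y) theta -> O delta phi -> O delta psi -> O delta theta.

Lemma iota_eq0 x : iota x = 0 -> x = 0.
Proof. by case: fracK => inj _ e; apply: inj; rewrite e rmorph0. Qed.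

(** [V] is a relation because [0] has no value. The value [a - b] of a fraction does not depend on
    its numerator and denominator, by comparing cross products. *)
Lemma valuation_extends : exists v : K -> Phi,
  is_valuation O v /\ forall x phi, V x phi -> v (iota x) = phi.
Proof.
have [inj frac] := fracK.
have nz x : x <> 0 -> iota x != 0 by move=> x0; apply/eqP => /iota_eq0.
have ex z : exists phi, z <> 0 -> exists x y a b,
    [/\ V x a, V y b, z = iota x / iota y & phi = a - b].
  have [->|/eqP z0] := eqVneq z 0; first by exists 0.
  have [x [y [y0 zE]]] := frac z.
  have [|b yb] := @V_ex y; first by move=> y0'; apply: y0; rewrite y0' rmorph0.
  have [|a xa] := @V_ex x; first by move=> x0; apply: z0; rewrite zE x0 rmorph0 mul0r.
  by exists (a - b) => _; exists x, y, a, b.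
have [v vP] := choice ex.
have vE z x y a b : V x a -> V y b -> z = iota x / iota y -> v z = a - b.
  move=> xa yb zE; have x0 := nz _ (V_neq0 xa); have y0 := nz _ (V_neq0 yb).
  have z0 : z <> 0 by apply/eqP; rewrite zE mulf_neq0 ?invr_eq0.
  have [x' [y' [a' [b' [xa' yb' zE' ->]]]]] := vP z z0.
  have y0' := nz _ (V_neq0 yb').
  have e : x * y' = x' * y.
    apply: inj; rewrite !rmorphM; apply/eqP.
    by rewrite -eqr_div // -zE zE'.
  have := VM xa yb'; rewrite e => /V_uniq /(_ (VM xa' yb)) eab.
  by apply/eqP; rewrite subr_eq addrAC eq_sym subr_eq eab.
exists v; split; last first.
  move=> x phi xphi; have x0 := V_neq0 xphi.
  have n10 : (1 : A) <> 0 by move=> e; apply: x0; rewrite -[x]mul1r e mul0r.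
  have [b yb] := V_ex n10.
  have b0 : b = 0.
    have := VM yb yb; rewrite mul1r => /V_uniq /(_ yb) /eqP.
    by rewrite -subr_eq0 addrK => /eqP.
  by rewrite (vE _ _ _ _ _ xphi yb) ?b0 ?subr0 // rmorph1 divr1.
split=> [z z' /eqP z0 /eqP z0'|z z' phi /eqP z0 /eqP z0' /eqP zz0].
  have [x [y [a [b [xa yb zE ->]]]]] := vP z z0.
  have [x' [y' [a' [b' [xa' yb' zE' ->]]]]] := vP z' z0'.
  rewrite (vE _ _ _ _ _ (VM xa xa') (VM yb yb')).
    by rewrite opprD addrACA.
  by rewrite zE zE' !rmorphM mulf_div.
have [x [y [a [b [xa yb zE vz]]]]] := vP z z0.
have [x' [y' [a' [b' [xa' yb' zE' vz']]]]] := vP z' z0'.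
have y0 := nz _ (V_neq0 yb); have y0' := nz _ (V_neq0 yb').
have zzE : z + z' = iota (x * y' + x' * y) / iota (y * y').
  by rewrite zE zE' addf_div // rmorphD !rmorphM.
have [|theta tP] := @V_ex (x * y' + x' * y).
  by move=> e; apply: zz0; rewrite zzE e rmorph0 mul0r.
rewrite (vE _ _ _ _ _ tP (VM yb yb') zzE) vz vz' => h h'.
have le1 : O ((b + b') + phi) (a + b').
  by have := gle_add (b + b') h; rewrite [_ + (a - b)]addrC addrA subrK.
have le2 : O ((b + b') + phi) (a' + b).
  by have := gle_add (b + b') h'; rewrite [_ + (a' - b')]addrC [b + b']addrC addrA subrK [b' + b]addrC.
have := VD (VM xa yb') (VM xa' yb) tP le1 le2.
by move/(gle_add (- (b + b'))); rewrite addKr [_ + theta]addrC.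
Qed.

End ExtendValuation.

(** * Toric charts *)

Section QuotientLift.
Variables (A B : comPzRingType) (E : set A) (g : {rmorphism A -> B}).
Hypothesis gE : forall x, E x -> g x = 0.

Definition quo_lift (x : quotient E) : B := g (repr x).

Lemma quo_liftE x : quo_lift (quo E x) = g x.
Proof.
rewrite /quo_lift; apply/eqP; rewrite -subr_eq0 -rmorphB; apply/eqP.
have hK : is_ideal [set y | g y = 0].
  split=> [|y z /= gy gz|b y /= gy]; first exact: rmorph0.
    by rewrite rmorphD gy gz addr0.
  by rewrite rmorphM gy mulr0.
have /quoP : quo E (repr (quo E x)) = quo E x by apply: quo_repr.
exact: (span_min hK).
Qed.

Lemma quo_lift_zmod : zmod_morphism quo_lift.
Proof.
move=> x y; have [[x' <-] [y' <-]] := (quo_surj x, quo_surj y).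
by rewrite -rmorphB !quo_liftE rmorphB.
Qed.
HB.instance Definition _ := GRing.isZmodMorphism.Build _ _ quo_lift quo_lift_zmod.
Lemma quo_lift_monoid : monoid_morphism quo_lift.
Proof.
split=> [|x y]; first by rewrite -(rmorph1 (quo E)) quo_liftE rmorph1.
have [[x' <-] [y' <-]] := (quo_surj x, quo_surj y).
by rewrite -rmorphM !quo_liftE rmorphM.
Qed.
HB.instance Definition _ := GRing.isMonoidMorphism.Build _ _ quo_lift quo_lift_monoid.

Lemma quotient_lift : exists f : {rmorphism quotient E -> B}, forall x, f (quo E x) = g x.
Proof. by exists quo_lift; exact: quo_liftE. Qed.

End QuotientLift.

Section ChartBasics.
Variables (N : nat) (a : 'I_N -> 'X_{1..N}).
Local Notation X := 'X_{1..N}.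
Implicit Types p q : X.

Definition chart_mx : 'M[int]_N := \matrix_(j, i) (a j i)%:Z.

(** The exponent in the [y_j] of the monomial [u^p]. *)
Definition cmn p : X := [multinom (\sum_i p i * a j i)%N | j < N].

Lemma zvec_cmn p : zvec (cmn p) = zvec p *m chart_mx^T.
Proof.
apply/rowP => j; rewrite !mxE mnmE (big_morph Posz PoszD (erefl 0%:Z)).
by apply: eq_bigr => i _; rewrite !mxE PoszM.
Qed.

Lemma cmnE p j : cmn p j = (\sum_i p i * a j i)%N.
Proof. exact: mnmE. Qed.

Lemma cmnD p q : cmn (p + q)%MM = (cmn p + cmn q)%MM.
Proof. by apply: zvec_inj; rewrite zvecD !zvec_cmn zvecD mulmxDl. Qed.

Lemma cmn0 : cmn 0%MM = 0%MM.
Proof. by apply: zvec_inj; rewrite zvec_cmn zvec0 mul0mx. Qed.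

Lemma cmn1 i : cmn U_(i)%MM = chart_mon a i.
Proof.
apply/mnmP => j; rewrite !mnmE (bigD1 i) //= mnm1E eqxx mul1n big1 ?addn0 // => t ne.
by rewrite mnm1E eq_sym (negbTE ne).
Qed.

Lemma cmn_sum (T : Type) (r : seq T) (F : T -> X) :
  cmn (\sum_(i <- r) F i)%MM = (\sum_(i <- r) cmn (F i))%MM.
Proof. exact: (big_morph cmn cmnD cmn0). Qed.

Lemma cmnMn p n : cmn (p *+ n)%MM = (cmn p *+ n)%MM.
Proof. by elim: n => [|n IH]; rewrite ?mulm0n ?cmn0 // !mulmS cmnD IH. Qed.

Lemma cmn_mono p : cmn p = (\sum_i chart_mon a i *+ p i)%MM.
Proof.
by rewrite {1}[p]multinomUE_id cmn_sum; apply: eq_bigr => i _; rewrite cmnMn cmn1.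
Qed.

(** Compatibility of the fan with the form [p - q] thus means that on every chart one of [u^p],
    [u^q] divides the other. *)
Lemma form_val_chart (p q : X) j :
  form_val (zvec p - zvec q) (a j) = (cmn p j)%:Z - (cmn q j)%:Z.
Proof.
rewrite !cmnE !(big_morph Posz PoszD (erefl 0%:Z)) -sumrB; apply: eq_bigr => i _.
by rewrite !mxE !PoszM mulrBl.
Qed.

Hypothesis a_unit : chart_mx \in unitmx.

(** The exponents in the [u_i] of the Laurent monomials [y_j]. *)
Definition chart_inv : 'M[int]_N := (invmx chart_mx)^T.

Lemma chart_mxK : chart_mx^T *m chart_inv = 1%:M.
Proof. by rewrite -trmx_mul mulVmx // trmx1. Qed.
Lemma chart_invK : chart_inv *m chart_mx^T = 1%:M.
Proof. by rewrite -trmx_mul mulmxV // trmx1. Qed.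

Lemma cmn_inj : injective cmn.
Proof.
move=> p q e; apply: zvec_inj.
by rewrite -[zvec p]mulmx1 -[zvec q]mulmx1 -chart_mxK !mulmxA -!zvec_cmn e.
Qed.

Section ChartWeight.
Variables (Phi : zmodType) (w : {additive 'rV[int]_N -> Phi}).

(** The weight transported to Laurent monomials in the [y_j]. *)
Definition wy (z : 'rV[int]_N) : Phi := w (z *m chart_inv).
Lemma wy_zmod : zmod_morphism wy.
Proof. by move=> z z'; rewrite /wy mulmxBl raddfB. Qed.
HB.instance Definition _ := GRing.isZmodMorphism.Build _ _ wy wy_zmod.

Lemma wy_cmn p : wt wy (cmn p) = wt w p.
Proof. by rewrite /wt /= /wy zvec_cmn -mulmxA chart_mxK mulmx1. Qed.

Lemma wt_chart p : wt w p = \sum_j wt wy U_(j)%MM *+ cmn p j.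
Proof. by rewrite -wy_cmn {1}wtE. Qed.

End ChartWeight.

(** [y_j = u^p / u^q] *)
Lemma chart_coord j : exists p q, cmn p = (U_(j) + cmn q)%MM.
Proof.
have [p [q pq]] := zvec_posneg (zvec U_(j)%MM *m chart_inv).
exists p, q; apply: zvec_inj; rewrite zvecD !zvec_cmn.
apply/eqP; rewrite -subr_eq -mulmxBl pq -mulmxA chart_invK mulmx1.
exact: eqxx.
Qed.

(** Every monomial in the [y_j] becomes a monomial in the [u_i] after
    multiplication by a monomial in the [u_i]. *)
Lemma chart_clear (b : X) : exists p q, cmn p = (b + cmn q)%MM.
Proof.
have [P PP] := choice chart_coord; have [Q QP] := choice PP.
exists (\sum_j P j *+ b j)%MM, (\sum_j Q j *+ b j)%MM.
rewrite !cmn_sum {2}[b]multinomUE_id -big_split; apply: eq_bigr => j _ /=.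
rewrite !cmnMn QP; apply/mnmP => i; rewrite mnmDE !mulmnE mnmDE; lia.
Qed.

End ChartBasics.

Lemma is_chart_unit (RR : realType) N (Sigma : {fset {fset 'X_{1..N}}}) a :
  good_fan RR Sigma -> is_chart Sigma a -> chart_mx a \in unitmx.
Proof.
move=> gS [ainj [sigma sS sP]]; have [M Mu Mr] := gf_reg gS sS.
have ex j : exists i, row i M = zvec (a j) by apply: Mr; apply/sP; exists j.
have [f fP] := choice ex.
have finj : injective f.
  by move=> j j' e; apply: ainj; apply: zvec_inj; rewrite -!fP e.
have -> : chart_mx a = perm_mx (perm finj) *m M.
  rewrite -row_permE; apply/matrixP => j i; rewrite !mxE permE.
  by have /rowP /(_ i) := fP j; rewrite !mxE.
by rewrite unitmx_mul unitmx_perm.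
Qed.

Lemma is_chart_compat (RR : realType) N (Sigma : {fset {fset 'X_{1..N}}}) a p q :
  good_fan RR Sigma -> is_chart Sigma a -> compatible (zvec p - zvec q) Sigma ->
  (forall j, (cmn a q j <= cmn a p j)%N) \/ (forall j, (cmn a p j <= cmn a q j)%N).
Proof.
move=> gS [_ [sigma sS sP]] cS; have [h|h] := cS sigma sS; [left|right] => j.
  have := h (a j); rewrite form_val_chart => h'.
  by have := h' (iffRL (sP _) (ex_intro _ j erefl)); lia.
have := h (a j); rewrite form_val_chart => h'.
by have := h' (iffRL (sP _) (ex_intro _ j erefl)); lia.
Qed.

(** The covering property is applied to the vector of the [w(u_i)] itself, with values in [Phi]; its
    coordinates on the cone found are the values of the [y_j]. *)
Lemma exists_chart (RR : realType) N (Sigma : {fset {fset 'X_{1..N}}})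
    (Phi : zmodType) (O : group_order Phi) (w : {additive 'rV[int]_N -> Phi}) :
  good_fan RR Sigma -> (forall i, O 0 (wt w U_(i)%MM)) ->
  exists2 a, is_chart Sigma a & forall j, O 0 (wt (wy a w) U_(j)%MM).
Proof.
move=> gS w0; have [sigma [c [sS sN c0 cs wE]]] := gf_exh gS w0.
have sz : size (enum_fset sigma) = N by [].
pose a (j : 'I_N) := nth 0%MM (enum_fset sigma) j.
have ain j : a j \in sigma by apply: mem_nth; rewrite sz.
have ac : is_chart Sigma a.
  split.
    move=> i j /eqP; rewrite nth_uniq ?sz ?fset_uniq //.
    by move=> /eqP e; apply: val_inj.
  exists sigma => // b; split=> [bs|[j ->]]; last exact: ain.
  have lt : (index b (enum_fset sigma) < N)%N.
    have lt : (index b (enum_fset sigma) < size (enum_fset sigma))%N by rewrite index_mem.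
    by apply: (leq_trans lt); rewrite sz.
  by exists (Ordinal lt); rewrite /a nth_index.
exists a => // j; suff -> : wt (wy a w) U_(j)%MM = c (a j) by [].
have au := is_chart_unit gS ac.
have wi i : wt w U_(i)%MM = \sum_j c (a j) *+ cmn a U_(i)%MM j.
  rewrite wE (big_nth 0%MM) sz big_mkord; apply: eq_bigr => t _.
  by rewrite cmn1 mnmE.
have wp p : wt w p = \sum_j c (a j) *+ cmn a p j.
  rewrite wtE; under eq_bigr do rewrite wi.
  transitivity (\sum_i \sum_t c (a t) *+ (cmn a U_(i)%MM t * p i)).
    apply: eq_bigr => i _; rewrite -sumrMnl; apply: eq_bigr => t _.
    by rewrite mulrnA.
  rewrite exchange_big; apply: eq_bigr => t _; rewrite sumrMnr; congr (_ *+ _).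
  by rewrite cmnE; apply: eq_bigr => i _; rewrite cmn1 mnmE mulnC.
have [p [q pq]] := chart_coord au j.
have := wy_cmn au w p; rewrite pq wtD wy_cmn // !wp => /eqP.
rewrite -subr_eq0 pq => /eqP.
under [X in _ - X]eq_bigr do rewrite mnmDE mulrnDr.
rewrite big_split /= opprD addrACA subrr addr0 => /eqP; rewrite subr_eq0 => /eqP ->.
rewrite (bigD1 j) //= mnm1E eqxx big1 ?addr0 // => t ne.
by rewrite mnm1E eq_sym (negbTE ne).
Qed.

(** * Orders on the value group *)

Section OrderBuild.
Variables (Phi : zmodType) (pos : pred Phi).
Hypothesis pos0 : pos 0.
Hypothesis posD : forall x y, pos x -> pos y -> pos (x + y).
Hypothesis pos_anti : forall x, pos x -> pos (- x) -> x = 0.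
Hypothesis pos_total : forall x, pos x || pos (- x).

Lemma order_of_cone : exists O : group_order Phi, forall x y, O x y = pos (y - x).
Proof.
unshelve eexists (@GroupOrder Phi (fun x y => pos (y - x)) _ _ _ _ _) => //.
- by move=> x; rewrite subrr.
- move=> x y /andP [h1 h2]; apply/eqP; rewrite eq_sym -subr_eq0; apply/eqP.
  by apply: pos_anti; rewrite // opprB.
- by move=> y x z h1 h2; rewrite -(subrK y z) -addrA; apply: posD.
- by move=> x y; rewrite -[x - y]opprB.
- by move=> z x y h /=; rewrite opprD addrACA subrr add0r.
Qed.
End OrderBuild.

Section Lex.
Variable I : eqType.
Implicit Types (L : seq I) (f g : I -> int).

Fixpoint lexpos f L : bool :=
  if L is j :: L' then (0 < f j) || (f j == 0) && lexpos f L' else true.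

Lemma lexposD f g L : lexpos f L -> lexpos g L -> lexpos (fun j => f j + g j) L.
Proof.
elim: L => //= j L IH /orP[f0|/andP [/eqP f0 fL]] /orP[g0|/andP [/eqP g0 gL]].
- by rewrite addr_gt0.
- by rewrite g0 addr0 f0.
- by rewrite f0 add0r g0.
- by rewrite f0 g0 addr0 eqxx IH ?orbT.
Qed.
Lemma lexpos_anti f L : lexpos f L -> lexpos (fun j => - f j) L -> forall j, j \in L -> f j = 0.
Proof.
elim: L => //= i L IH /orP[f0|/andP [/eqP f0 fL]].
  by rewrite oppr_gt0 oppr_eq0 ltNge ltW //= gt_eqF.
rewrite f0 oppr0 ltxx eqxx /= => gL j; rewrite inE => /predU1P[->//|]; exact: IH.
Qed.
Lemma lexpos_total f L : lexpos f L || lexpos (fun j => - f j) L.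
Proof.
elim: L => //= i L IH; rewrite oppr_gt0 oppr_eq0.
by case: (ltgtP (f i) 0) => //= _; rewrite ?orbT.
Qed.
Lemma lexpos_ge0 f L : (forall j, j \in L -> 0 <= f j) -> lexpos f L.
Proof.
elim: L => //= i L IH h; have := h i (mem_head _ _); rewrite le0r orbC => /orP[->//|/eqP ->].
by rewrite eqxx IH ?orbT // => j jL; apply: h; rewrite inE jL orbT.
Qed.
Lemma lexpos_take f L i : lexpos f L -> lexpos f (take i L).
Proof.
elim: L i => [|j L IH] [|i] //= /orP[->//|/andP [-> /IH ->]]; exact: orbT.
Qed.
Lemma lexpos_eq_in f g L : {in L, f =1 g} -> lexpos f L = lexpos g L.
Proof.
elim: L => //= j L IH fg; rewrite fg ?mem_head // IH // => i iL.
by apply: fg; rewrite inE iL orbT.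
Qed.
Lemma lexpos_ext f g L : f =1 g -> lexpos f L = lexpos g L.
Proof. by move=> fg; apply: lexpos_eq_in => j _; apply: fg. Qed.
End Lex.

Section OrderedMore.
Variables (Phi : zmodType) (O : group_order Phi).
Implicit Types x y : Phi.
Lemma pos_mulrn_eq0 x e : O 0 x -> x != 0 -> x *+ e = 0 -> e = 0%N.
Proof.
case: e => // e x0 /eqP nz h; case: nz; apply: (gle_eq (O := O)) => //.
have := gle_mulrn e x0; have -> : x *+ e = - x.
  by apply/eqP; rewrite -subr_eq0 opprK addrC -mulrS h.
by move/(gle_add x); rewrite addr0 subrr.
Qed.
Lemma sum_ge0_eq0 (I : finType) (f : I -> Phi) : (forall i, O 0 (f i)) ->
  \sum_i f i = 0 -> forall i, f i = 0.
Proof.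
move=> f0 h i; apply: (gle_eq (O := O)) => //.
move: h; rewrite (bigD1 i) //= => /eqP; rewrite addr_eq0 => /eqP ->.
have B0 : O 0 (\sum_(j | j != i) f j).
  rewrite big_mkcond; apply: gle_sum => j; case: ifP => // _; exact: gle_refl.
by have := gle_add (- \sum_(j | j != i) f j) B0; rewrite addr0 addNr.
Qed.
End OrderedMore.

(** * Weights on a chart where the valuation has a center *)

Section MainChart.
Variables (N r s : nat) (k : fieldType) (O : group_order 'rV[int]_r).
Variables (w : {additive 'rV[int]_N -> 'rV[int]_r}).
Variables (m n : 'I_s -> 'X_{1..N}) (lambda : 'I_s -> k) (F : 'I_s -> mseries N k).
Hypothesis w_gen : forall phi, exists c : 'I_N -> int, phi = \sum_i wt w U_(i)%MM *~ c i.
Hypothesis w_pos : forall i : 'I_N, glt O 0 (wt w U_(i)%MM).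
Hypothesis hF : overweight_deformation O w m n lambda F.
Variables (gens : 'I_s -> seq 'X_{1..N}).
Local Notation S := (mseries N k).
Local Notation X := 'X_{1..N}.
Local Notation bin l := (lbinomial (m l) (n l) (lambda l)).
Local Notation Phi := 'rV[int]_r.
Hypothesis gens_supp : forall l g, g \in gens l -> coef (F l - series_of_poly (bin l)) g <> 0.
Hypothesis gens_le : forall l p, coef (F l - series_of_poly (bin l)) p <> 0 ->
  exists2 g, g \in gens l & (g <= p)%MM.
Variable a : 'I_N -> X.
Hypothesis a_unit : chart_mx a \in unitmx.
Hypothesis a_bin : forall l, (forall j, (cmn a (n l) j <= cmn a (m l) j)%N) \/
  (forall j, (cmn a (m l) j <= cmn a (n l) j)%N).
Hypothesis a_gens : forall l g, g \in gens l ->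
  (forall j, (cmn a (m l) j <= cmn a g j)%N) \/ (forall j, (cmn a g j <= cmn a (m l) j)%N).
Local Notation om j := (wt (wy a w) U_(j)%MM).
Implicit Types (p q : X) (z : 'rV[int]_N) (phi psi : Phi) (j : 'I_N).

Let w_ker z : w z = 0 <-> exists c : 'I_s -> int, z = \sum_l (zvec (m l) - zvec (n l)) *~ c l.
Proof. by case: hF => _ h _ _; apply: h. Qed.

Lemma ker_coord z j : w z = 0 -> (forall l, cmn a (m l) j = cmn a (n l) j) ->
  (z *m (chart_mx a)^T) 0 j = 0.
Proof.
move=> /w_ker [c ->] h; rewrite mulmx_suml summxE big1 // => l _.
rewrite -rowZ_int -scalemxAl mulmxBl -!zvec_cmn !mxE h subrr mulr0 //.
Qed.

Lemma weight_coords_chart z : w z = \sum_j om j *~ (z *m (chart_mx a)^T) 0 j.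
Proof.
have -> : w z = wy a w (z *m (chart_mx a)^T).
  by rewrite /wy -mulmxA chart_mxK // mulmx1.
rewrite {1}[z *m _]zvec_basis raddf_sum; apply: eq_bigr => j _; exact: raddfMz.
Qed.

(** The coordinate [alpha phi j] of a weight [phi] along [om j]. *)
Lemma weight_dual : exists alpha : Phi -> 'rV[int]_N,
  [/\ forall phi psi, alpha (phi - psi) = alpha phi - alpha psi,
      forall phi, phi = \sum_j om j *~ alpha phi 0 j
    & forall z j, (forall l, cmn a (m l) j = cmn a (n l) j) ->
        alpha (w z) 0 j = (z *m (chart_mx a)^T) 0 j].
Proof.
have [D DE] := weight_section w_gen.
exists (fun phi => phi *m D *m (chart_mx a)^T); split.
- by move=> phi psi; rewrite !mulmxBl.
- by move=> phi; rewrite -{1}[phi]DE weight_coords_chart.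
move=> z j h; have : (w z *m D *m (chart_mx a)^T - z *m (chart_mx a)^T) 0 j = 0.
  by rewrite -mulmxBl ker_coord // raddfB DE subrr.
by rewrite [LHS]mxE [X in _ + X]mxE => /eqP; rewrite subr_eq0 => /eqP.
Qed.

Hypothesis om_ge0 : forall j, O 0 (om j).
Definition ptau j := om j != 0.

(** On the chart one monomial of the binomial divides the other. The quotient has weight 0, a sum of
    nonnegative terms, so it involves no [y_j] of positive value. *)
Lemma bin_tau l j : ptau j -> cmn a (m l) j = cmn a (n l) j.
Proof.
have wb : wt w (m l) = wt w (n l).
  apply/eqP; rewrite -subr_eq0 /wt -raddfB; apply/eqP/w_ker.
  exists (fun l' => (l' == l)%:Z); rewrite (bigD1 l) //= eqxx big1 ?addr0 // => l' /negbTE -> .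
  by rewrite mulr0z.
have key p q : wt w p = wt w q -> (forall j, (cmn a q j <= cmn a p j)%N) -> ptau j -> cmn a p j = cmn a q j.
  move=> pq le tj; apply/eqP; rewrite eqn_leq le andbT -subn_eq0; apply/eqP.
  apply: (pos_mulrn_eq0 (om_ge0 j) tj).
  apply: (@sum_ge0_eq0 _ O _ (fun j => om j *+ (cmn a p j - cmn a q j))).
    by move=> i; apply: gle_mulrn.
  under eq_bigr do rewrite mulrnBr //.
  by rewrite sumrB -!wt_chart // pq subrr.
by move=> tj; case: (a_bin l) => h; [apply: key | apply/esym; apply: key].
Qed.

(** Exponents of equal weight differ by a combination of the [m l - n l], which have no component
    along [tau]. Conversely the [y_j] outside [tau] do not contribute to the weight. *)
Lemma tau_wt p q : wt w p = wt w q <-> forall j, ptau j -> cmn a p j = cmn a q j.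
Proof.
split=> [pq j tj|h].
  have := @ker_coord (zvec p - zvec q) j; rewrite mulmxBl -!zvec_cmn !mxE => e.
  apply/eqP; rewrite -eqz_nat -subr_eq0; apply/eqP; apply: e => [|l]; last exact: bin_tau.
  by rewrite raddfB; apply/eqP; rewrite subr_eq0; apply/eqP.
rewrite !(wt_chart a_unit); apply: eq_bigr => j _.
have [->|tj] := eqVneq (om j) 0; first by rewrite !mul0rn.
by rewrite h.
Qed.

Lemma tau_pos i : exists2 j, ptau j & (0 < cmn a U_(i)%MM j)%N.
Proof.
apply: contrapT => h; have [_ ne] := w_pos i; apply: ne; apply/esym.
rewrite (wt_chart a_unit) big1 // => j _.
have [->|tj] := eqVneq (om j) 0; first by rewrite mul0rn.
have [->//|pj] := posnP (cmn a U_(i)%MM j); by case: h; exists j.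
Qed.

Lemma tau_order p q : (forall j, ptau j -> (cmn a p j <= cmn a q j)%N) -> O (wt w p) (wt w q).
Proof.
move=> h; rewrite !(wt_chart a_unit); apply/gle_sub0.
rewrite -sumrB; apply: gle_sum => j.
have [->|tj] := eqVneq (om j) 0; first by rewrite !mul0rn subrr; apply: gle_refl.
by rewrite -mulrnBr ?h //; apply: gle_mulrn.
Qed.

(** The chart makes [u^(m l)] and [u^g] comparable, the overweight condition decides in which sense,
    and [tau_wt] turns the inequality of weights into a strict inequality along [tau]. *)
Lemma gens_over l g : g \in gens l -> (forall j, (cmn a (m l) j <= cmn a g j)%N) /\
  exists2 j, ptau j & (cmn a (m l) j < cmn a g j)%N.
Proof.
move=> gl; have [_ _ ow _] := hF; have lt := ow l g (gens_supp gl).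
have le : forall j, (cmn a (m l) j <= cmn a g j)%N.
  case: (a_gens gl) => // h; exfalso; apply: (gltN lt).
  by apply: tau_order => j _.
split=> //; apply: contrapT => h; case: lt => _; apply.
apply/tau_wt => j tj; apply/eqP; rewrite eqn_leq le /= leqNgt.
by apply/negP => lt; apply: h; exists j.
Qed.

Lemma cmn_le p q j : (p <= q)%MM -> (cmn a p j <= cmn a q j)%N.
Proof. by move=> pq; rewrite -(submK pq) cmnD mnmDE leq_addl. Qed.

Lemma F_over l p : coef (F l - series_of_poly (bin l)) p <> 0 ->
  (forall j, ptau j -> (cmn a (m l) j <= cmn a p j)%N) /\
  exists2 j, ptau j & (cmn a (m l) j < cmn a p j)%N.
Proof.
move=> /gens_le [g /gens_over [le [j tj lt]] gp]; split=> [i _|].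
  exact: leq_trans (le i) (cmn_le _ gp).
by exists j => //; apply: leq_trans lt (cmn_le _ gp).
Qed.

Lemma wt_bin_eq l : wt w (m l) = wt w (n l).
Proof.
apply/eqP; rewrite -subr_eq0 /wt -raddfB; apply/eqP/w_ker.
exists (fun l' => (l' == l)%:Z); rewrite (bigD1 l) //= eqxx big1 ?addr0 // => l' /negbTE -> .
by rewrite mulr0z.
Qed.

Lemma cmnDE p q j : cmn a (p + q)%MM j = (cmn a p j + cmn a q j)%N.
Proof. by rewrite cmnD mnmDE. Qed.

Lemma w_fin phi (f : S) : fin_part w phi f.
Proof. exact: (fin_part_all cmnDE tau_wt tau_pos). Qed.

Lemma exists_torus_point : exists c : 'I_N -> k, [/\ forall i, c i != 0,
    forall p q, wt w p = wt w q ->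
      ideal_span (binomials m n lambda) ('X_[p] - (mono c p / mono c q) *: 'X_[q])
  & forall l, mono c (m l) = lambda l * mono c (n l)].
Proof. by case: hF => bp _ _ _; exact: (binomial_torus_point w_gen w_ker w_fin bp). Qed.

Variable c : 'I_N -> k.
Hypothesis c_neq0 : forall i, c i != 0.
Hypothesis J_mono : forall p q, wt w p = wt w q ->
  ideal_span (binomials m n lambda) ('X_[p] - (mono c p / mono c q) *: 'X_[q]).
Hypothesis c_bin : forall l, mono c (m l) = lambda l * mono c (n l).

Lemma binomials_vanish : ideal_span (binomials m n lambda) `<=` vanish w c.
Proof.
apply: span_min; first exact: vanish_ideal.
by move=> _ [l _ <-]; apply: vanish_binomial => //; exact: wt_bin_eq.
Qed.

Lemma F_weight l : weight_part w (wt w (m l)) (F l) = bin l.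
Proof.
apply: weight_part_eq => p; have [_ _ ow _] := hF.
have bw : (bin l)@_p <> 0 -> wt w p = wt w (m l).
  rewrite mcoeffB mcoeffZ !mcoeffX.
  have [<- //|_] := eqVneq (m l) p; have [<- _|_] := eqVneq (n l) p; first by rewrite wt_bin_eq.
  by rewrite mulr0 subr0.
case: eqP => [pm|ne].
  apply/esym/eqP; rewrite -subr_eq0; apply/eqP; apply: contrapT => /(ow l p) [_].
  by rewrite pm.
by apply: contrapT => /bw.
Qed.

(** The initial forms of the [F l] are the binomials, which vanish at [c]; by definition of an
    overweight deformation they generate all initial forms of [(F)]. *)
Lemma initial_forms_vanish f phi : ideal_span (range F) f -> has_weight O w f phi ->
  ini_val w c phi f = 0.
Proof.
move=> IFf hf; have [bp _ ow ini] := hF; have [_ mn _ _] := bp.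
have inJ : initial_forms O w (range F) `<=` binomials m n lambda.
  move=> g [_ [psi [[l _ <-] [Fge [p [Fp pw]]] ->]]].
  suff -> : psi = wt w (m l) by exists l => //; rewrite F_weight.
  have m1 : coef (F l) (m l) <> 0.
    have e : (weight_part w (wt w (m l)) (F l))@_(m l) = coef (F l) (m l).
      by rewrite weight_partE ?eqxx //; apply: w_fin.
    rewrite -e F_weight mcoeffB mcoeffZ !mcoeffX eqxx.
    have [/esym /mn //|_] := eqVneq (n l) (m l).
    by rewrite mulr0 subr0; apply/eqP/oner_neq0.
  apply: (gle_eq (O := O)); first exact: Fge.
  rewrite -pw; have [z|/eqP nz] := eqVneq (coef (F l - series_of_poly (bin l)) p) 0.
    have : coef (series_of_poly (bin l)) p <> 0.
      by move=> z'; apply: Fp; move: z; rewrite coefB z' subr0.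
    rewrite /= mcoeffB mcoeffZ !mcoeffX.
    have [<- _|_] := eqVneq (m l) p; first exact: gle_refl.
    have [<- _|_] := eqVneq (n l) p; first by rewrite wt_bin_eq; apply: gle_refl.
    by rewrite mulr0 subr0.
  by apply: glt_gle; apply: (ow l).
have : vanish w c (weight_part w phi f).
  apply: binomials_vanish; apply: (span_sub inJ); rewrite ini; apply: subset_span.
  by exists f, phi.
move/(_ phi); rewrite (@hpart_homog _ _ _ _ phi phi) ?eqxx // => p.
by rewrite weight_partE; [case: eqP | apply: w_fin].
Qed.

(** Proved with the order [O] of the deformation, but free of any order in its statement;
    [chart_val_theory] can therefore use it for another order [O']. *)
Lemma nf_uniq g : ideal_span (range F) g -> nf_supp w g -> g = 0.
Proof.
move=> IFg nfg; apply: contrapT => g0.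
have [phi hphi] := min_weight cmnDE tau_order g0.
exact: (ini_val_nf c_neq0 nfg hphi) (initial_forms_vanish IFg hphi).
Qed.

Lemma chart_val_theory (O' : group_order Phi) :
  (forall p q, (forall j, ptau j -> (cmn a p j <= cmn a q j)%N) -> O' (wt w p) (wt w q)) ->
  val_theory w F c O'.
Proof.
move=> h.
exact: (val_theoryP cmnDE tau_wt tau_pos F_over c_neq0 J_mono wt_bin_eq h nf_uniq).
Qed.

(** The lexicographic order for the coordinates along the [om j]. *)
Lemma lex_order (alpha : Phi -> 'rV[int]_N) (L : seq 'I_N) :
  (forall phi psi, alpha (phi - psi) = alpha phi - alpha psi) ->
  (forall phi, phi = \sum_j om j *~ alpha phi 0 j) ->
  (forall j, ptau j -> j \in L) ->
  exists O' : group_order Phi, forall phi psi, O' phi psi = lexpos (alpha (psi - phi) 0) L.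
Proof.
move=> alphaB alphaP LP.
have alpha0 : alpha 0 = 0 by rewrite -(subrr 0) alphaB subrr.
have alphaN phi : alpha (- phi) = - alpha phi by rewrite -sub0r alphaB alpha0 sub0r.
apply: (@order_of_cone _ (fun phi => lexpos (alpha phi 0) L)).
- by apply: lexpos_ge0 => j _; rewrite alpha0 mxE.
- move=> x y hx hy; rewrite -[y]opprK alphaB alphaN opprK.
  by rewrite (@lexpos_ext _ _ (fun j => alpha x 0 j + alpha y 0 j)) ?lexposD // => j; rewrite mxE.
- move=> x hx; rewrite alphaN => hx'; rewrite [x]alphaP big1 // => j _.
  have [->|tj] := eqVneq (om j) 0; first exact: mul0rz.
  rewrite (lexpos_anti hx) ?LP //.
  by rewrite -(@lexpos_ext _ ((- alpha x) 0)) // => i; rewrite mxE.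
- move=> x; rewrite alphaN (@lexpos_ext _ ((- alpha x) 0) (fun j => - alpha x 0 j)).
    exact: lexpos_total.
  by move=> j; rewrite mxE.
Qed.

End MainChart.

(** * The graded ring *)

Section PartA.
Variables (N r s : nat) (k : fieldType) (O : group_order 'rV[int]_r).
Variables (w : {additive 'rV[int]_N -> 'rV[int]_r}).
Variables (F : 'I_s -> mseries N k) (J : set {mpoly k[N]}) (c : 'I_N -> k).
Local Notation S := (mseries N k).
Local Notation X := 'X_{1..N}.
Local Notation Phi := 'rV[int]_r.
Local Notation R := (quotient (range F)).
Local Notation pi := (quo (range F)).
Local Notation IF := (ideal_span (range F)).
Local Notation V := (val_rel w c O).
Local Notation wge := (weight_ge O w).
Local Notation wgt := (weight_gt O w).
Local Notation wp := (weight_part w).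
Implicit Types (f g h : S) (phi psi theta : Phi) (x y : R) (p q : X).

Hypothesis w_gen : forall phi, exists c : 'I_N -> int, phi = \sum_i wt w U_(i)%MM *~ c i.
Hypothesis w_pos : forall i : 'I_N, glt O 0 (wt w U_(i)%MM).
Hypothesis c_neq0 : forall i, c i != 0.
Hypothesis vt : val_theory w F c O.
Hypothesis JP : forall g : {mpoly k[N]}, ideal_span J g <-> vanish w c g.

Lemma wt_ge0 p : O 0 (wt w p).
Proof. by rewrite wtE; apply: gle_sum => i; apply: gle_mulrn; case: (w_pos i). Qed.

Lemma wt_eq0 p : wt w p = 0 -> p = 0%MM.
Proof.
move=> p0; apply/mnmP => i; rewrite mnm0E; apply/eqP/negPn/negP => pi0.
have ip : (U_(i) <= p)%MM by rewrite lep1mP.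
apply: (gltN (w_pos i)); rewrite -p0 -(submK ip) wtD.
by apply/gle_sub0; rewrite addrK; apply: wt_ge0.
Qed.

Lemma weight_ge0 f : wge 0 f.
Proof. by move=> p _; apply: wt_ge0. Qed.

Let fin := vt_fin vt.

Lemma ini_B phi f g : ini_val w c phi (f - g) = ini_val w c phi f - ini_val w c phi g.
Proof. by rewrite /ini_val weight_partB ?mevalB //; apply: fin. Qed.

Lemma weight_partM_ge phi psi f g : wge phi f -> wge psi g ->
  wp (phi + psi) (f * g) = wp phi f * wp psi g.
Proof.
move=> hf hg; rewrite weight_partM //; try exact: fin.
move=> p q /hf pf /hg qg e.
have pE : wt w p = phi.
  apply: (gle_eq (O := O)) => //; apply/gle_sub0.
  have -> : phi - wt w p = wt w q - psi.
    by apply/eqP; rewrite subr_eq addrAC eq_sym subr_eq [wt w q + _]addrC e.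
  exact: (iffLR (gle_sub0 O _ _) qg).
by split=> //; move: e; rewrite pE => /addrI.
Qed.

Lemma weight_geB phi f g : wge phi f -> wge phi g -> wge phi (f - g).
Proof.
move=> hf hg p; rewrite coefB; have [->|/eqP /hf //] := eqVneq (coef f p) 0.
by rewrite sub0r => nz; apply: hg => z; apply: nz; rewrite z oppr0.
Qed.

Lemma weight_part_gt phi f : wge phi f -> (wp phi f = 0 <-> wgt phi f).
Proof.
move=> hf; split=> [z p nz|hgt].
  split; first exact: hf.
  move=> e; apply: nz; have := weight_partE p (fin phi f).
  by rewrite z mcoeff0 -e eqxx => /esym.
apply: weight_part_eq => p; rewrite mcoeff0; case: eqP => // pphi.
by apply/esym; apply: contrapT => /hgt [_]; rewrite pphi.
Qed.

Lemma wp_homog phi f p : (wp phi f)@_p <> 0 -> wt w p = phi.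
Proof. by rewrite (weight_partE _ (fin phi f)); case: eqP. Qed.

Lemma hpart_wp phi psi f : hpart w phi (wp psi f) = if psi == phi then wp psi f else 0.
Proof. by apply: hpart_homog => p; apply: wp_homog. Qed.

Lemma wp_J phi f : ideal_span J (wp phi f) <-> ini_val w c phi f = 0.
Proof.
split=> [/JP /(_ phi)|e]; first by rewrite hpart_wp eqxx.
by apply/JP => psi; rewrite hpart_wp; case: eqP => _ //; exact: meval0.
Qed.

Lemma lift_ini x phi f : V x phi -> pi f = x -> wge phi f -> ini_val w c phi f <> 0.
Proof.
move=> [g [gx [gphi _] nz]] fx fphi z; apply: (vt_ini vt (f := g - f) (phi := phi)).
- exact: weight_geB.
- by rewrite ini_B z subr0.
- by apply/quoP; rewrite gx.
Qed.

Lemma V1 : V (1 : R) 0.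
Proof.
have e : sX k 0%MM = 1 :> S by exact: sX0.
by have := val_rel_mono w F c_neq0 O 0%MM; rewrite e rmorph1 wt0.
Qed.

Lemma V_fraction_field : exists (K : fieldType) (iota : {rmorphism R -> K}),
  is_fraction_field iota.
Proof.
have h1 : 1 != 0 :> R by apply/eqP; exact: (vt_neq0 vt V1).
apply: (fraction_field h1) => x y xy.
apply: contrapT => /negP; rewrite negb_or => /andP [/eqP x0 /eqP y0].
have [[phi xphi] [psi ypsi]] := (vt_ex vt x0, vt_ex vt y0).
exact: (vt_neq0 vt (vt_mul vt xphi ypsi)).
Qed.

Variables (K : fieldType) (iota : {rmorphism R -> K}) (v : K -> Phi).
Hypothesis fracK : is_fraction_field iota.
Hypothesis v_val : is_valuation O v.
Hypothesis vE : forall x phi, V x phi -> v (iota x) = phi.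

Let iota0 x : iota x = 0 -> x = 0. Proof. exact: iota_eq0. Qed.
Let iota_neq0 x : x <> 0 -> iota x != 0. Proof. by move=> x0; apply/eqP => /iota0. Qed.

Lemma valuation_max_weight x : x <> 0 -> is_max_weight O w pi x (v (iota x)).
Proof.
move=> x0; have [phi xphi] := vt_ex vt x0; rewrite (vE xphi); split.
  by case: xphi => f [fx fphi _]; exists f.
by move=> f psi fx [fpsi _]; apply: (vt_max vt) xphi fx fpsi.
Qed.

Lemma v_div z z' : z != 0 -> z' != 0 -> v (z / z') = v z - v z'.
Proof.
move=> z0 z'0; case: v_val => vM _.
have := vM (z / z') z'; rewrite mulf_neq0 ?invr_eq0 // divfK // => ->//.
by rewrite addrK.
Qed.

Lemma valuation_full : value_group_full v.
Proof.
move=> phi; have [d dE] := w_gen phi.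
have [p [q pq]] := zvec_posneg (\sum_i zvec (U_(i)%MM : X) *~ d i).
have Vp t := val_rel_mono w F c_neq0 O t.
have nz t : iota (pi (sX k t)) != 0 by apply: iota_neq0; exact: (vt_neq0 vt (Vp t)).
exists (iota (pi (sX k p)) / iota (pi (sX k q))); first by rewrite mulf_neq0 ?invr_eq0.
rewrite v_div // !(vE (Vp _)) /wt -raddfB pq dE raddf_sum.
by apply: eq_bigr => i _; rewrite raddfMz.
Qed.

Lemma iota_valuation_ring x : valuation_ring O v (iota x).
Proof.
have [->|/eqP x0] := eqVneq x 0; first by left; rewrite rmorph0.
have [phi xphi] := vt_ex vt x0; right; rewrite (vE xphi).
by have [f fx] := quo_surj x; exact: (vt_max vt xphi fx (weight_ge0 (f := f))).
Qed.

Lemma v1 : v 1 = 0.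
Proof. by rewrite -(rmorph1 iota) (vE V1). Qed.

(** An element of [R] of value 0 lifts to a series with nonzero constant term, hence is a unit. For
    a fraction [x / y] of value 0, the quotient [al] of the initial values at [c] of lifts of [x]
    and [y] is its residue: [x - al y] has a value greater than the common value of [x] and [y]. *)
Lemma valuation_rational : rational_valuation O v iota.
Proof.
have [vM vD] := v_val.
split=> [x|z].
  split; first exact: iota_valuation_ring.
  split=> [xmax [y xy]|nu].
    have x0 : x <> 0.
      by move=> x0; apply: (vt_neq0 vt V1); rewrite -xy x0 mul0r.
    have y0 : y <> 0.
      by move=> y0; apply: (vt_neq0 vt V1); rewrite -xy y0 mulr0.
    case: xmax => [/iota0 //|vx].
    have := vM _ _ (iota_neq0 x0) (iota_neq0 y0); rewrite -rmorphM xy rmorph1 v1 => e.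
    have [/iota0 //|vy] := iota_valuation_ring y.
    by have := gltD vx vy; rewrite addr0 -e => -[].
  have [->|/eqP x0] := eqVneq x 0; first by left; rewrite rmorph0.
  have [phi xphi] := vt_ex vt x0; right; rewrite (vE xphi).
  split; first by case: (iota_valuation_ring x) => [/iota0 //|]; rewrite (vE xphi).
  move=> phi0; case: xphi => f [fx [_ [p [fp pphi]]] _]; apply: nu.
  have p0 : p = 0%MM by apply: wt_eq0; rewrite pphi phi0.
  have [|g fg] := @series_unit _ _ f; first by rewrite -p0.
  by exists (pi g); rewrite -fx -rmorphM fg rmorph1.
case=> [->|z0]; first by exists 0; left; rewrite rmorph0 subr0.
have [->|nz] := eqVneq z 0; first by exists 0; left; rewrite rmorph0 subr0.
have [vz|/eqP vz] := eqVneq (v z) 0; last first.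
  by exists 0; right; rewrite rmorph0 subr0; split=> // e; apply: vz.
have [_ frac] := fracK; have [x [y [iy zE]]] := frac z.
have y0 : y <> 0 by move=> y0; apply: iy; rewrite y0 rmorph0.
have x0 : x <> 0 by move=> x0; move: nz; rewrite zE x0 rmorph0 mul0r eqxx.
have [[phi xphi] [psi ypsi]] := (vt_ex vt x0, vt_ex vt y0).
have e : psi = phi.
  move: vz; rewrite zE v_div ?iota_neq0 // (vE xphi) (vE ypsi) => /eqP.
  by rewrite subr_eq0 => /eqP.
rewrite {}e in ypsi.
have [f [fx [fphi _] nf]] := xphi; have [g [gy [gphi _] ng]] := ypsi.
pose al := ini_val w c phi f / ini_val w c phi g.
exists (pi (sC N al)); set x' := x - pi (sC N al) * y.
have zE' : z - iota (pi (sC N al)) = iota x' / iota y.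
  by rewrite rmorphB rmorphM mulrBl mulfK ?iota_neq0 // zE.
have [x'0|/eqP x'0] := eqVneq x' 0; first by left; rewrite zE' x'0 rmorph0 mul0r.
have [theta x'theta] := vt_ex vt x'0; right; rewrite zE' v_div ?iota_neq0 //.
rewrite (vE x'theta) (vE ypsi).
have alg p : coef (sC N al * g) p <> 0 -> coef g p <> 0.
  by rewrite coef_sCM => nzg z1; apply: nzg; rewrite z1 mulr0.
pose h := f - sC N al * g.
have hphi : wge phi h by apply: weight_geB => // p /alg /gphi.
have hx' : pi h = x' by rewrite /x' -fx -gy /h rmorphB rmorphM.
have le := vt_max vt x'theta hx' hphi.
split; first exact: (iffLR (gle_sub0 O _ _) le).
move=> /esym /eqP; rewrite subr_eq0 => /eqP e; rewrite e in x'theta.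
apply: (lift_ini x'theta hx' hphi); rewrite ini_B.
have -> : ini_val w c phi (sC N al * g) = al * ini_val w c phi g.
  rewrite /ini_val (@weight_part_eq _ _ _ _ phi _ (al *: wp phi g)) ?mevalZ // => p.
  by rewrite mcoeffZ (weight_partE _ (fin phi g)) coef_sCM; case: eqP => _ //; rewrite mulr0.
by rewrite /al divfK ?subrr //; apply/eqP.
Qed.

Lemma val_geP phi x : val_ge O v iota phi x <-> exists2 f, pi f = x & wge phi f.
Proof.
split=> [|[f fx fphi]].
  have [->|/eqP x0 [//|le]] := eqVneq x 0.
    by move=> _; exists 0; rewrite ?rmorph0 // => p.
  have [theta xt] := vt_ex vt x0; have [f [fx [ft _] _]] := xt.
  exists f => // p /ft; apply: gle_trans; by rewrite -(vE xt).
have [->|/eqP x0] := eqVneq x 0; first by left.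
have [theta xt] := vt_ex vt x0; right; rewrite (vE xt).
exact: (vt_max vt) xt fx fphi.
Qed.

Definition graded_ini phi x : quotient J :=
  quo J (wp phi (xget 0 [set f | pi f = x /\ wge phi f])).

(** Two lifts of weight at least [phi] differ by an element of [(F)], whose part of weight [phi]
    lies in the ideal of [J]; so the choice made in [graded_ini] is harmless. *)
Lemma graded_iniE phi f : wge phi f -> graded_ini phi (pi f) = quo J (wp phi f).
Proof.
move=> fphi; rewrite /graded_ini; case: xgetP => [g _ [gf gphi]|/(_ f) []//].
apply/quoP; rewrite -weight_partB; [|exact: fin|exact: fin].
apply/wp_J; apply: contrapT => nz; apply: (vt_ini vt (f := g - f) (phi := phi)) => //.
  exact: weight_geB.
by apply/quoP.
Qed.

Lemma graded_ini_eq0 phi x : val_ge O v iota phi x ->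
  (graded_ini phi x = 0 <-> val_gt O v iota phi x).
Proof.
move=> /val_geP [f fx fphi]; rewrite -{1}fx graded_iniE //.
have q0 (g : {mpoly k[N]}) : quo J g = 0 <-> ideal_span J g by rewrite -(rmorph0 (quo J)) quoP subr0.
rewrite q0 wp_J; have [x0|/eqP x0] := eqVneq x 0.
  split=> _; first by left.
  apply: contrapT => nz; apply: (vt_ini vt fphi nz).
  by have := quoP (range F) f 0; rewrite subr0 rmorph0 fx x0 => -[h _]; apply: h.
have [theta xt] := vt_ex vt x0; have le := vt_max vt xt fx fphi.
split=> [z|[//|]].
  by right; rewrite (vE xt); split=> // e; rewrite -e in xt; apply: (lift_ini xt fx fphi).
rewrite (vE xt) => lt; have [g [gx [gt _] _]] := xt.
have gphi : wgt phi g by move=> p /gt; apply: glt_le_trans.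
have ggphi : wge phi g by move=> p /gphi [].
have e := graded_iniE fphi; have := graded_iniE ggphi; rewrite gx -fx e.
rewrite (iffRL (weight_part_gt ggphi) gphi) rmorph0 => h.
by apply/wp_J; apply/q0.
Qed.

Lemma wp_series phi (g : {mpoly k[N]}) : wp phi (series_of_poly g) = hpart w phi g.
Proof. by []. Qed.

Lemma hpart_ge phi (g : {mpoly k[N]}) : wge phi (series_of_poly (hpart w phi g)).
Proof. by move=> p /=; rewrite hpartE; case: eqP => // -> _; apply: gle_refl. Qed.

Lemma wp_hpart phi (g : {mpoly k[N]}) : wp phi (series_of_poly (hpart w phi g)) = hpart w phi g.
Proof.
rewrite wp_series (@hpart_homog _ _ _ _ phi phi) ?eqxx // => p.
by rewrite hpartE; case: eqP.
Qed.

Lemma graded_series : is_associated_graded O (@weight_ge N _ O w k)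
  (@weight_gt N _ O w k) (@weight_part N _ w k).
Proof.
split.
- move=> phi f g _ hf hg; split; first exact: weight_geB.
  by rewrite weight_partB //; apply: fin.
- by move=> phi f _; exact: weight_part_gt.
- split; first exact: weight_ge0.
  apply: weight_part_eq => p; rewrite mcoeff1 coef1.
  by have [->|_] := eqVneq p 0%MM; rewrite ?wt0 ?eqxx ?if_same.
- move=> phi psi f g _ _ hf hg; split; last exact: weight_partM_ge.
  exact: weight_geM.
split=> [g|D f Du hf e phi phiD].
  exists (undup [seq wt w p | p <- msupp g]), (fun phi => series_of_poly (hpart w phi g)).
  split; first exact: undup_uniq.
    move=> phi; rewrite mem_undup => /mapP [p _ ->]; split; first exact: wt_ge0.
    exact: hpart_ge.
  by rewrite {1}[g](hpart_decomp w); apply: eq_bigr => phi _; rewrite wp_hpart.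
have := congr1 (hpart w phi) e; rewrite hpart0 hpart_sum (bigD1_seq phi) //=.
rewrite hpart_wp eqxx big1 ?addr0 // => psi ne.
by rewrite hpart_wp (negbTE ne).
Qed.

Lemma graded_ring : is_associated_graded O (val_ge O v iota) (val_gt O v iota) graded_ini.
Proof.
split.
- move=> phi x y _ /val_geP [f fx fphi] /val_geP [g gy gphi].
  have hB := weight_geB fphi gphi.
  split; first by apply/val_geP; exists (f - g); rewrite -?fx -?gy // rmorphB.
  rewrite -fx -gy -rmorphB !graded_iniE // weight_partB ?rmorphB //; exact: fin.
- by move=> phi x _; exact: graded_ini_eq0.
- split; first by apply/val_geP; exists 1; [rewrite rmorph1 | exact: weight_ge0].
  rewrite -(rmorph1 pi) graded_iniE; last exact: weight_ge0.
  by have [_ _ [_ ->] _ _] := graded_series; rewrite rmorph1.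
- move=> phi psi x y _ _ /val_geP [f fx fphi] /val_geP [g gy gpsi].
  have hM := weight_geM fphi gpsi.
  split; first by apply/val_geP; exists (f * g); rewrite -?fx -?gy // rmorphM.
  by rewrite -fx -gy -rmorphM !graded_iniE // weight_partM_ge // rmorphM.
split=> [g|D x Du hx e phi phiD].
  have [G <-] := quo_surj g.
  have [_ _ _ _ [gen _]] := graded_series; have [D [f [Du hf GE]]] := gen G.
  exists D, (fun phi => pi (f phi)); split=> //.
    move=> phi phiD; have [h0 hge] := hf phi phiD; split=> //.
    by apply/val_geP; exists (f phi).
  rewrite GE rmorph_sum; apply: eq_big_seq => phi phiD.
  by rewrite graded_iniE //; case: (hf phi phiD).
have ex psi : exists f, psi \in D -> pi f = x psi /\ wge psi f.
  have [psiD|_] := boolP (psi \in D); last by exists 0.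
  by have [_ /val_geP [f fx fpsi]] := hx psi psiD; exists f.
have [f fP] := choice ex.
have iE psi : psi \in D -> graded_ini psi (x psi) = quo J (wp psi (f psi)).
  by move=> /fP [<- h]; apply: graded_iniE.
have : quo J (\sum_(psi <- D) wp psi (f psi)) = 0.
  by rewrite rmorph_sum; apply: etrans e; apply: eq_big_seq => psi /iE ->.
have q0 (g : {mpoly k[N]}) : quo J g = 0 <-> ideal_span J g by rewrite -(rmorph0 (quo J)) quoP subr0.
move=> /q0 /JP /(_ phi); rewrite hpart_sum (bigD1_seq phi) //= hpart_wp eqxx big1.
  by rewrite addr0 => z; rewrite iE //; apply/q0/wp_J.
by move=> psi ne; rewrite hpart_wp (negbTE ne).
Qed.

Lemma graded_map : is_graded_map O
  (@weight_ge N _ O w k) (@weight_gt N _ O w k) (@weight_part N _ w k)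
  (val_ge O v iota) (val_gt O v iota) graded_ini pi (quo J).
Proof.
move=> phi f _ fphi.
have ge : val_ge O v iota phi (pi f) by apply/val_geP; exists f.
split=> [//|fgt|]; last by rewrite graded_iniE.
by apply/graded_ini_eq0 => //; rewrite graded_iniE // (iffRL (weight_part_gt fphi) fgt) rmorph0.
Qed.

End PartA.

(** * Formal charts *)

Lemma mnm_gen N (P : 'X_{1..N} -> Prop) : P 0%MM -> (forall i, P U_(i)%MM) ->
  (forall p q, P p -> P q -> P (p + q)%MM) -> forall p, P p.
Proof.
move=> P0 P1 PD p; rewrite [p]multinomUE_id; apply: (big_ind P) => // i _.
by elim: (p i) => [|e IH]; rewrite ?mulm0n // mulmS; apply: PD.
Qed.

Lemma closure_idealP (A : comPzRingType) (E : set A) t : is_ideal (closure_ideal E t).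
Proof.
have hE := span_ideal E.
split=> [|x y [n xn] [n' yn]|b x [n xn]].
- by exists 0%N; rewrite mulr0; apply: ideal0.
- exists (n + n')%N.
  have -> : t ^+ (n + n') * (x + y) = t ^+ n' * (t ^+ n * x) + t ^+ n * (t ^+ n' * y).
    by rewrite exprD; ring.
  by apply: idealD => //; apply: idealMl.
- by exists n; rewrite mulrCA; apply: idealMl.
Qed.

Lemma closure_quo (A : comPzRingType) (E : set A) t x :
  quo (closure_ideal E t) x = 0 <-> closure_ideal E t x.
Proof.
rewrite -(rmorph0 (quo _)) quoP subr0; split; last exact: subset_span.
by apply: span_min => //; apply: closure_idealP.
Qed.

Lemma sub_closure (A : comPzRingType) (E : set A) t : ideal_span E `<=` closure_ideal E t.
Proof. by move=> x Ex; exists 0%N; rewrite expr0 mul1r. Qed.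

Section ValuationRing.
Variables (Phi : zmodType) (O : group_order Phi) (K : fieldType) (v : K -> Phi).
Hypothesis v_val : is_valuation O v.
Local Notation VR := (valuation_ring O v).

Lemma vringD x y : VR x -> VR y -> VR (x + y).
Proof.
have [x0|nx] := eqVneq x 0; first by rewrite x0 add0r.
have [y0|ny] := eqVneq y 0; first by rewrite y0 addr0.
have [xy0|nxy] := eqVneq (x + y) 0; first by left.
case=> [/eqP|vx]; first by rewrite (negbTE nx).
case=> [/eqP|vy]; first by rewrite (negbTE ny).
by right; case: v_val => _; apply.
Qed.

Lemma vringM x y : VR x -> VR y -> VR (x * y).
Proof.
case=> [->|vx]; first by left; rewrite mul0r.
case=> [->|vy]; first by left; rewrite mulr0.
have [->|nx] := eqVneq x 0; first by left; rewrite mul0r.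
have [->|ny] := eqVneq y 0; first by left; rewrite mulr0.
by right; case: v_val => -> // _; apply: gleD0.
Qed.

Lemma val1 : v 1 = 0.
Proof.
case: v_val => vM _; have := vM 1 1 (oner_neq0 _) (oner_neq0 _).
by rewrite mulr1 => /eqP; rewrite -subr_eq0 opprD addNKr oppr_eq0 => /eqP.
Qed.

(** Convex subgroups [H] of the value group give primes of a ring mapping to
    the valuation ring. *)
Lemma convex_prime (A : comPzRingType) (f : {rmorphism A -> K}) (H : set Phi) :
  (forall g, VR (f g)) -> H 0 -> (forall x y, H x -> H y -> H (x + y)) ->
  (forall x y, O 0 x -> O x y -> H y -> H x) ->
  prime_ideal [set g | f g = 0 \/ ~ H (v (f g))].
Proof.
move=> fV H0 HD Hc; have [vM vA] := v_val.
have fV' g : f g <> 0 -> O 0 (v (f g)) by case: (fV g).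
split.
- apply/is_idealP; split=> [|g h hg hh|b g hg] /=.
  + by left; rewrite rmorph0.
  + rewrite rmorphD; have [g0|/eqP ng] := eqVneq (f g) 0; first by rewrite g0 add0r.
    have [h0|/eqP nh] := eqVneq (f h) 0; first by rewrite h0 addr0.
    have [z|/eqP nz] := eqVneq (f g + f h) 0; [by left | right=> Hgh].
    have vA' phi : O phi (v (f g)) -> O phi (v (f h)) -> O phi (v (f g + f h)).
      by apply: vA; apply/eqP.
    case: hg => [//|]; case: hh => [//|] nHh nHg.
    have /orP[le|le] := gle_total O (v (f g)) (v (f h)).
      by apply: nHg; apply: Hc Hgh; [apply: fV' | apply: vA' => //; apply: gle_refl].
    by apply: nHh; apply: Hc Hgh; [apply: fV' | apply: vA' => //; apply: gle_refl].
  + rewrite rmorphM; have [b0|/eqP nb] := eqVneq (f b) 0; first by left; rewrite b0 mul0r.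
    case: hg => [->|nHg]; first by left; rewrite mulr0.
    have [g0|/eqP ng] := eqVneq (f g) 0; first by left; rewrite g0 mulr0.
    right=> Hbg; apply: nHg; apply: Hc Hbg; first exact: fV'.
    rewrite vM; [|exact/eqP|exact/eqP]; apply/gle_sub0; rewrite addrK; exact: fV'.
- by rewrite /= rmorph1 val1 => -[/eqP|//]; rewrite oner_eq0.
- move=> g h /=; rewrite rmorphM => -[/eqP|nH].
    by rewrite mulf_eq0 => /orP[/eqP|/eqP]; [left; left|right; left].
  have [g0|ng] := eqVneq (f g) 0; first by left; left.
  have [h0|nh] := eqVneq (f h) 0; first by right; left.
  rewrite vM // in nH; apply: contrapT => /not_orP [h1 h2]; apply: nH; apply: HD.
    by apply: contrapT => nH; apply: h1; right.
  by apply: contrapT => nH; apply: h2; right.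
Qed.

Lemma vmax_prime (A : comPzRingType) (f : {rmorphism A -> K}) :
  (forall g, VR (f g)) -> prime_ideal [set g | valuation_max O v (f g)].
Proof.
move=> fV; have := @convex_prime A f [set 0] fV.
have -> : [set g | f g = 0 \/ ~ [set 0] (v (f g))] = [set g | valuation_max O v (f g)].
  rewrite eqEsubset; split=> g /= [->|h]; try by left.
    by case: (fV g) => [|vg]; [left | right; split=> // e; apply: h; rewrite /= -e].
  by right; case: h => _ h /=; move=> e; apply: h.
apply=> //=.
- by move=> x y -> ->; rewrite addr0.
- by move=> x y h0 hxy y0; rewrite y0 in hxy; apply: (gle_eq (O := O)).
Qed.

End ValuationRing.

Section FormalChart.
Variables (N s : nat) (k : fieldType) (F : 'I_s -> mseries N k) (a : 'I_N -> 'X_{1..N}).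
Hypothesis a_unit : chart_mx a \in unitmx.
Local Notation S := (mseries N k).
Local Notation X := 'X_{1..N}.
Local Notation R := (quotient (range F)).
Local Notation pi := (quo (range F)).
Local Notation IF := (ideal_span (range F)).
Variables (K : fieldType) (iota : {rmorphism R -> K}).
Hypothesis iota_inj : injective iota.
Hypothesis sX_neq0 : forall p, iota (pi (sX k p)) != 0.
Local Notation E0 := (total_equations a (range F)).
Local Notation TE := (ideal_span E0).
Local Notation tt := (\prod_i (series_of_poly 'X_i)%:MP : {mpoly S[N]}).
Local Notation A := (formal_strict a (range F)).
Local Notation qA := (quo (closure_ideal E0 tt)).
Implicit Types (p q b : X).

Let hTE : is_ideal TE. Proof. exact: span_ideal. Qed.

Definition sXm p : {mpoly S[N]} := (sX k p)%:MP.

Lemma sXmD p q : sXm (p + q)%MM = sXm p * sXm q.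
Proof. by rewrite /sXm sXD mpolyCM. Qed.
Lemma sXm0 : sXm 0%MM = 1.
Proof. by rewrite /sXm sX0 mpolyC1. Qed.

Lemma TE_sX p : TE (sXm p - 'X_[cmn a p]).
Proof.
elim/mnm_gen: p => [|i|p q hp hq].
- by rewrite sXm0 cmn0 mpolyX0 subrr; apply: ideal0.
- by apply: subset_span; left; exists i => //; rewrite cmn1.
- rewrite sXmD cmnD mpolyXD.
  have -> : sXm p * sXm q - 'X_[cmn a p] * 'X_[cmn a q] =
    sXm p * (sXm q - 'X_[cmn a q]) + 'X_[cmn a q] * (sXm p - 'X_[cmn a p]) by ring.
  by apply: idealD => //; apply: idealMl.
Qed.

Lemma TE_clear (G : {mpoly S[N]}) : exists q (C : S), TE (sXm q * G - C%:MP).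
Proof.
rewrite [G]mpolyE; elim: (msupp G) => [|b r [q [C IH]]].
  by exists 0%MM, 0; rewrite big_nil mulr0 mpolyC0 subr0; apply: ideal0.
have [p [q' pq]] := chart_clear a_unit b.
exists (q' + q)%MM, (sX k q * sX k p * G@_b + sX k q' * C); rewrite big_cons.
set T := \sum_(i <- r) _ in IH *.
have -> : sXm (q' + q) * (G@_b *: 'X_[b] + T) - (sX k q * sX k p * G@_b + sX k q' * C)%:MP =
   (G@_b)%:MP * sXm q * (sXm q' * 'X_[b] - sXm p) + sXm q' * (sXm q * T - C%:MP).
  by rewrite sXmD mpolyCD !mpolyCM -/(sXm _) -/(sXm _) -/(sXm _) -mul_mpolyC; ring.
apply: idealD => //; apply: idealMl => //.
have -> : sXm q' * 'X_[b] - sXm p = 'X_[b] * (sXm q' - 'X_[cmn a q']) - (sXm p - 'X_[cmn a p]).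
  by rewrite pq mpolyXD; ring.
by apply: idealB => //; [apply: idealMl => //|]; apply: TE_sX.
Qed.

Lemma tt_pow q : exists n t', tt ^+ n = t' * sXm q.
Proof.
pose one : X := [multinom 1%N | i < N].
have ttE : tt = sXm one.
  have -> : one = (\sum_i U_(i))%MM.
    apply/mnmP => i; rewrite mnm_sumE mnmE (bigD1 i) //= mnm1E eqxx big1 // => j ne.
    by rewrite mnm1E (negbTE ne).
  by rewrite (big_morph sXm sXmD sXm0).
have powE n : tt ^+ n = sXm (one *+ n)%MM.
  elim: n => [|n IH]; first by rewrite expr0 mulm0n sXm0.
  by rewrite exprS IH mulmS sXmD ttE.
exists (mdeg q), (sXm (one *+ mdeg q - q)%MM); rewrite powE -sXmD submK //.
apply/mnm_lepP => i; rewrite mulmnE mnmE mul1n mdegE (bigD1 i) //=.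
exact: leq_addr.
Qed.

Lemma TE_const C : IF C -> TE C%:MP.
Proof.
move=> /span_range [h ->]; rewrite raddf_sum; apply: ideal_sum => // l _ /=.
rewrite mpolyCM; apply: idealMl => //; apply: subset_span; right.
by exists (F l) => //; exists l.
Qed.

Lemma formal_monomial p : qA (sXm p) = qA 'X_[cmn a p].
Proof. by apply/quoP; apply: subset_span; apply: sub_closure; apply: TE_sX. Qed.

Section Map.
Variable f : {rmorphism A -> K}.
Hypothesis fE : forall x : S, f (formal_const a (range F) x) = iota (pi x).

Lemma formal_map_cmn p : f (qA 'X_[cmn a p]) = iota (pi (sX k p)).
Proof. by rewrite -formal_monomial -fE. Qed.

Lemma formal_map_mono b p q : cmn a p = (b + cmn a q)%MM ->
  f (qA 'X_[b]) = iota (pi (sX k p)) / iota (pi (sX k q)).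
Proof.
move=> e; apply: (canRL (mulfK (sX_neq0 q))).
by rewrite -!formal_map_cmn e mpolyXD !rmorphM.
Qed.

Lemma formal_map_mono_neq0 b : f (qA 'X_[b]) != 0.
Proof.
by have [p [q /formal_map_mono ->]] := chart_clear a_unit b; rewrite mulf_neq0 ?invr_eq0.
Qed.

(** Multiplication by a monomial in the [u_i] turns an element of the chart into the class of a
    series [C]. If its image is zero then [C] is in [(F)], and the monomial is absorbed by the
    closure ideal, since it divides a power of [u_1 .. u_N]. *)
Lemma formal_map_inj g : f g = 0 -> g = 0.
Proof.
have [G <-] := quo_surj g => fG.
have [q [C h]] := TE_clear G.
have IC : IF C.
  have e : qA (sXm q * G) = qA C%:MP.
    by apply/quoP; apply: subset_span; apply: sub_closure.
  have := congr1 f e; rewrite rmorphM rmorphM fG mulr0 => /esym.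
  rewrite -/(formal_const a (range F) C) fE -(rmorph0 iota) => /iota_inj.
  by rewrite -(rmorph0 pi) quoP subr0.
have qG : TE (sXm q * G).
  by rewrite -(subrK C%:MP (sXm q * G)); apply: idealD => //; apply: TE_const.
have [n [t' tn]] := tt_pow q.
by apply/closure_quo; exists n; rewrite tn -mulrA; apply: idealMl.
Qed.

Lemma formal_map_weight (Phi : zmodType) (O : group_order Phi) (v : K -> Phi)
    (w : {additive 'rV[int]_N -> Phi}) b : is_valuation O v ->
  (forall p, v (iota (pi (sX k p))) = wt w p) -> v (f (qA 'X_[b])) = wt (wy a w) b.
Proof.
move=> [vM _] vX; have [p [q e]] := chart_clear a_unit b.
have := vM _ _ (formal_map_mono_neq0 b) (sX_neq0 q).
rewrite {1}(formal_map_mono e) divfK // !vX => h.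
by apply: (@addIr _ (wt w q)); rewrite -h -(wy_cmn a_unit w p) -(wy_cmn a_unit w q) e wtD.
Qed.

End Map.

(** The generic point: [y_j] is sent to the quotient of monomials in the [u_i] that it represents.
    The equations of the chart hold because the image of a monomial does not depend on the quotient
    chosen, [cmn] being injective. *)
Lemma formal_map_exists : exists f : {rmorphism A -> K},
  forall x : S, f (formal_const a (range F) x) = iota (pi x).
Proof.
have [P PP] := choice (chart_coord a_unit); have [Q QP] := choice PP.
pose eta j := iota (pi (sX k (P j))) / iota (pi (sX k (Q j))).
have eta0 j : eta j != 0 by rewrite mulf_neq0 ?invr_eq0.
pose io p := iota (pi (sX k p)).
have ioD p q : io (p + q)%MM = io p * io q by rewrite /io sXD !rmorphM.
have io0 : io 0%MM = 1 by rewrite /io sX0 !rmorph1.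
have ioMn p e : io (p *+ e)%MM = io p ^+ e.
  by elim: e => [|e IH]; rewrite ?mulm0n ?io0 ?expr0 // mulmS ioD IH exprS.
have monoP b p q : cmn a p = (b + cmn a q)%MM -> mono eta b * io q = io p.
  move=> e; pose P' := (\sum_j P j *+ b j)%MM; pose Q' := (\sum_j Q j *+ b j)%MM.
  have PQ : mono eta b * io Q' = io P'.
    rewrite /mono /P' /Q' !(big_morph io ioD io0) -big_split; apply: eq_bigr => j _.
    by rewrite /= !ioMn -exprMn /eta divfK //; apply: sX_neq0.
  have e' : cmn a P' = (b + cmn a Q')%MM.
    rewrite /P' /Q' !cmn_sum {2}[b]multinomUE_id -big_split; apply: eq_bigr => j _ /=.
    by rewrite !cmnMn QP; apply/mnmP => i; rewrite mnmDE !mulmnE mnmDE; lia.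
  have : (p + Q' = P' + q)%MM.
    by apply: (cmn_inj a_unit); rewrite !cmnD e e'; apply/mnmP => i; rewrite !mnmDE; lia.
  move/(congr1 io); rewrite !ioD -PQ => h.
  by apply: (mulIf (sX_neq0 Q')); rewrite -/(io Q') h; ring.
pose ev : {rmorphism {mpoly S[N]} -> K} := mmap (iota \o pi) eta.
have evC x : ev x%:MP = iota (pi x) by rewrite /ev /= mmapC.
have evX b : ev 'X_[b] = mono eta b by rewrite /ev /= mmapX.
have evE0 x : E0 x -> ev x = 0.
  case=> [[i _ <-]|[y [l _ <-] <-]].
    rewrite rmorphB evC evX -/(io _) -cmn1.
    by rewrite -(monoP (cmn a U_(i)%MM) U_(i)%MM 0%MM) ?cmn0 ?addm0 // io0 mulr1 subrr.
  rewrite evC; have -> : pi (F l) = 0; last exact: rmorph0.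
  by rewrite -(rmorph0 pi); apply/quoP; rewrite subr0; apply: subset_span; exists l.
have evTE x : TE x -> ev x = 0.
  apply: (@span_min _ _ [set x | ev x = 0]) => //; split=> [|y z hy hz|b y hy].
  - exact: rmorph0.
  - by apply: (etrans (rmorphD ev y z)); rewrite (hy : ev y = 0) (hz : ev z = 0) addr0.
  - by apply: (etrans (rmorphM ev b y)); rewrite (hy : ev y = 0) mulr0.
have evcl x : closure_ideal E0 tt x -> ev x = 0.
  case=> n /evTE /eqP; rewrite rmorphM rmorphXn mulf_eq0 => /orP[|/eqP //].
  rewrite expf_eq0 => /andP [_]; rewrite rmorph_prod => /eqP z; exfalso.
  move/eqP: z; apply/negP; apply/prodf_neq0 => i _.
  by rewrite evC; apply: sX_neq0.
have [f fE] := quotient_lift evcl; exists f => x.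
by rewrite /formal_const fE evC.
Qed.

End FormalChart.

(** Cancellation of the units [z], [p], [q], isolated from the large expressions of
    [res_mono_coord]. *)
Lemma unit_cancel (Q : comPzRingType) (x y z t u u' p q : Q) :
  x * (z * p) * q = y * q * p -> z * t = 1 -> u * q = 1 -> u' * p = 1 -> x = y * t.
Proof.
move=> h zt uq up.
have -> : x = (u * q) * (u' * p) * (z * t) * x by rewrite uq up zt !mul1r.
have -> : (u * q) * (u' * p) * (z * t) * x = u * u' * t * (x * (z * p) * q) by ring.
rewrite h; have -> : u * u' * t * (y * q * p) = (u * q) * (u' * p) * (y * t) by ring.
by rewrite uq up !mul1r.
Qed.

(** * Regularity of the formal strict transform at the center *)

Section FormalRegular.
Variables (N r s : nat) (k : fieldType) (O : group_order 'rV[int]_r).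
Variables (w : {additive 'rV[int]_N -> 'rV[int]_r}).
Variables (m n : 'I_s -> 'X_{1..N}) (lambda : 'I_s -> k) (F : 'I_s -> mseries N k).
Hypothesis w_gen : forall phi, exists c : 'I_N -> int, phi = \sum_i wt w U_(i)%MM *~ c i.
Hypothesis w_pos : forall i : 'I_N, glt O 0 (wt w U_(i)%MM).
Hypothesis hF : overweight_deformation O w m n lambda F.
Variables (gens : 'I_s -> seq 'X_{1..N}).
Local Notation S := (mseries N k).
Local Notation X := 'X_{1..N}.
Local Notation bin l := (lbinomial (m l) (n l) (lambda l)).
Local Notation Phi := 'rV[int]_r.
Hypothesis gens_supp : forall l g, g \in gens l -> coef (F l - series_of_poly (bin l)) g <> 0.
Hypothesis gens_le : forall l p, coef (F l - series_of_poly (bin l)) p <> 0 ->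
  exists2 g, g \in gens l & (g <= p)%MM.
Variable a : 'I_N -> X.
Hypothesis a_unit : chart_mx a \in unitmx.
Hypothesis a_bin : forall l, (forall j, (cmn a (n l) j <= cmn a (m l) j)%N) \/
  (forall j, (cmn a (m l) j <= cmn a (n l) j)%N).
Hypothesis a_gens : forall l g, g \in gens l ->
  (forall j, (cmn a (m l) j <= cmn a g j)%N) \/ (forall j, (cmn a g j <= cmn a (m l) j)%N).
Local Notation om j := (wt (wy a w) U_(j)%MM).
Local Notation R := (quotient (range F)).
Local Notation pi := (quo (range F)).
Variables (K : fieldType) (iota : {rmorphism R -> K}).
Hypothesis fracK : is_fraction_field iota.
Hypothesis sX_neq0 : forall p, iota (pi (sX k p)) != 0.
Local Notation E0 := (total_equations a (range F)).
Local Notation tt := (\prod_i (series_of_poly 'X_i)%:MP : {mpoly S[N]}).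
Local Notation A := (formal_strict a (range F)).
Local Notation qA := (quo (closure_ideal E0 tt)).
Local Notation yc j := (@formal_coord N a k (range F) j).
Variable f : {rmorphism A -> K}.
Hypothesis fE : forall x : S, f (formal_const a (range F) x) = iota (pi x).
Implicit Types (p q b : X) (j : 'I_N).

Let iota_inj : injective iota. Proof. by case: fracK. Qed.

Lemma formal_map_generated (Q : set K) :
  (forall x, Q (iota x)) -> (forall j, Q (f (yc j))) ->
  (forall x y, Q x -> Q y -> Q (x + y)) -> (forall x y, Q x -> Q y -> Q (x * y)) ->
  forall g, Q (f g).
Proof.
move=> Qi Qy QD QM g; have [G <-] := quo_surj g.
have Q1 : Q 1 by rewrite -(rmorph1 iota).
have Q0 : Q 0 by rewrite -(rmorph0 iota).
have QX b : Q (f (qA 'X_[b])).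
  elim/mnm_gen: b => [|j|p q hp hq]; [by rewrite mpolyX0 !rmorph1 | exact: Qy |].
  by rewrite mpolyXD !rmorphM; apply: QM.
rewrite [G]mpolyE !rmorph_sum; apply: (big_ind Q) => [||b _]; [exact: Q0 | exact: QD |].
rewrite -mul_mpolyC !rmorphM; apply: QM; last exact: QX.
by rewrite -/(formal_const a (range F) _) fE.
Qed.

Hypothesis om_ge0 : forall j, O 0 (om j).
Local Notation tau := (ptau w a).
Local Notation Yset := [set yc j | j in [set j | tau j]].
Local Notation Y := (ideal_span Yset).
Local Notation Q := (quotient Yset).
Local Notation pY := (quo Yset).

Let hY : is_ideal Y. Proof. exact: span_ideal. Qed.

Lemma pY0 g : pY g = 0 <-> Y g.
Proof. by rewrite -(rmorph0 pY) quoP subr0. Qed.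

(** The images of the monomials and of the constants in [A / (y_j, j in tau)]. *)
Definition res_mono b : Q := pY (qA 'X_[b]).
Definition cst (e : k) : A := qA (sC N e)%:MP.

Lemma res_monoD b b' : res_mono (b + b')%MM = res_mono b * res_mono b'.
Proof. by rewrite /res_mono mpolyXD !rmorphM. Qed.
Lemma res_mono0 : res_mono 0%MM = 1.
Proof. by rewrite /res_mono mpolyX0 !rmorph1. Qed.
Lemma res_monoMn b e : res_mono (b *+ e)%MM = res_mono b ^+ e.
Proof. by elim: e => [|e IH]; rewrite ?mulm0n ?res_mono0 ?expr0 // mulmS res_monoD IH exprS. Qed.
Lemma cstM e e' : cst (e * e') = cst e * cst e'.
Proof. by rewrite /cst sCM mpolyCM rmorphM. Qed.
Lemma cst1 : cst 1 = 1.
Proof.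
have e : sC N (1 : k) = 1 by rewrite /sC mpolyC1 rmorph1.
by rewrite /cst e mpolyC1 rmorph1.
Qed.
Lemma cst0 : cst 0 = 0.
Proof.
have e : sC N (0 : k) = 0 by rewrite /sC mpolyC0 rmorph0.
by rewrite /cst e mpolyC0 rmorph0.
Qed.
Lemma cstD e e' : cst (e + e') = cst e + cst e'.
Proof.
have h : sC N (e + e') = sC N e + sC N e' by rewrite /sC mpolyCD rmorphD.
by rewrite /cst h mpolyCD rmorphD.
Qed.

Lemma res_mono_tau b j : tau j -> (0 < b j)%N -> res_mono b = 0.
Proof.
move=> tj bj; have le : (U_(j) <= b)%MM by rewrite lep1mP -lt0n.
rewrite -(submK le) res_monoD; have -> : res_mono U_(j)%MM = 0; last exact: mulr0.
by apply/pY0; apply: subset_span; exists j.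
Qed.

(** [Epos] and [Eneg] are what remains on the chart of the two monomials of a binomial after
    division by their greatest common divisor; one of them is 0 by [a_bin]. *)
Definition Epos l : X := (cmn a (m l) - cmn a (n l))%MM.
Definition Eneg l : X := (cmn a (n l) - cmn a (m l))%MM.

(** On the chart [F l] is the product of the common monomial [y^mn] and of a factor that must
    vanish, since [f] is injective and sends monomials to nonzero elements. Modulo the [y_j] in
    [tau] only the binomial part of this factor survives. *)
Lemma res_mono_bin l : res_mono (Epos l) = pY (cst (lambda l)) * res_mono (Eneg l).
Proof.
pose mn : X := [multinom minn (cmn a (m l) j) (cmn a (n l) j) | j < N].
have mnE j : mn j = minn (cmn a (m l) j) (cmn a (n l) j) by apply: mnmE.
have mE : cmn a (m l) = (Epos l + mn)%MM.
  by apply/mnmP => j; rewrite mnmDE mnE /Epos mnmBE; lia.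
have nE : cmn a (n l) = (Eneg l + mn)%MM.
  by apply/mnmP => j; rewrite mnmDE mnE /Eneg mnmBE; lia.
have over := gens_over hF gens_supp a_unit a_bin a_gens om_ge0.
have [G GE] := split_generators (gens_le (l := l)).
pose g i := nth 0%MM (gens l) i.
have gE (i : 'I_(size (gens l))) : cmn a (g i) = ((cmn a (g i) - mn) + mn)%MM.
  rewrite submK //; apply/mnm_lepP => j; rewrite mnE.
  have [le _] := over l (g i) (mem_nth _ (ltn_ord i)).
  by apply: leq_trans (le j); apply: geq_minl.
pose rest := \sum_(i < size (gens l)) qA 'X_[cmn a (g i) - mn] * qA (G i)%:MP.
have e0 : qA 'X_[mn] * (qA 'X_[Epos l] - cst (lambda l) * qA 'X_[Eneg l] + rest) = 0.
  have -> : qA 'X_[mn] * (qA 'X_[Epos l] - cst (lambda l) * qA 'X_[Eneg l] + rest) = qA (F l)%:MP.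
    rewrite -[F l](subrK (series_of_poly (bin l))) GE mpolyCD rmorphD addrC mulrDr.
    congr (_ + _).
      rewrite /rest mulr_sumr raddf_sum rmorph_sum; apply: eq_bigr => i _ /=.
      rewrite mpolyCM rmorphM /= -/(sXm _ _) formal_monomial [in RHS]gE mpolyXD rmorphM /=; ring.
    have -> : series_of_poly (bin l) = sX k (m l) - sC N (lambda l) * sX k (n l).
      by rewrite /lbinomial rmorphB /= series_of_polyZ.
    have mQ : qA (sX k (m l))%:MP = qA 'X_[Epos l] * qA 'X_[mn].
      by rewrite -rmorphM -mpolyXD -mE; apply: formal_monomial.
    have nQ : qA (sX k (n l))%:MP = qA 'X_[Eneg l] * qA 'X_[mn].
      by rewrite -rmorphM -mpolyXD -nE; apply: formal_monomial.
    by rewrite mpolyCB mpolyCM rmorphB rmorphM /= mQ nQ -/(cst _); ring.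
  apply: (formal_map_inj a_unit iota_inj fE).
  rewrite -/(formal_const a (range F) (F l)) fE; have -> : pi (F l) = 0; last exact: rmorph0.
  by rewrite -(rmorph0 pi); apply/quoP; rewrite subr0; apply: subset_span; exists l.
have e1 : qA 'X_[Epos l] - cst (lambda l) * qA 'X_[Eneg l] + rest = 0.
  apply: (formal_map_inj a_unit iota_inj fE).
  have := congr1 f e0; rewrite rmorphM rmorph0 => /eqP; rewrite mulf_eq0.
  by rewrite (negbTE (formal_map_mono_neq0 a_unit sX_neq0 fE mn)) => /eqP.
have rest0 : pY rest = 0.
  rewrite rmorph_sum big1 // => i _; rewrite rmorphM /= -/(res_mono _).
  have [_ [j tj lt]] := over l (g i) (mem_nth _ (ltn_ord i)).
  rewrite (@res_mono_tau _ j) ?mul0r // mnmBE mnE subn_gt0.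
  by apply: leq_ltn_trans lt; apply: geq_minl.
have := congr1 pY e1; rewrite rmorphD /= rest0 addr0 rmorphB rmorphM rmorph0 /= => /eqP.
by rewrite subr_eq0 => /eqP.
Qed.

Lemma res_Eneg_unit l : exists u, u * res_mono (Eneg l) = 1.
Proof.
case: (a_bin l) => h.
  exists 1; have -> : Eneg l = 0%MM by apply/mnmP => j; rewrite mnmBE mnm0E; apply/eqP; rewrite subn_eq0.
  by rewrite res_mono0 mul1r.
exists (pY (cst (lambda l))); rewrite -res_mono_bin.
have -> : Epos l = 0%MM by apply/mnmP => j; rewrite mnmBE mnm0E; apply/eqP; rewrite subn_eq0.
exact: res_mono0.
Qed.

Let w_ker z : w z = 0 <-> exists c : 'I_s -> int, z = \sum_l (zvec (m l) - zvec (n l)) *~ c l.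
Proof. by case: hF => _ h _ _; apply: h. Qed.

(** If [y_j] has value 0, its exponent is a combination of the [m l - n l]; so it is a product of
    powers of quotients of binomial monomials, each equal to the constant [lambda l] in the residue
    ring. *)
Lemma res_mono_coord j : exists e, res_mono U_(j)%MM = pY (cst e).
Proof.
have [tj|tj] := boolP (tau j).
  by exists 0; rewrite cst0 rmorph0 (@res_mono_tau _ j) // mnm1E eqxx.
have [[lam0 _ _ _] _ _ _] := hF.
have : w (zvec U_(j)%MM *m chart_inv a) = 0 by apply/eqP; move: tj; rewrite negbK.
move=> /w_ker [d dE].
pose al l := absz (Num.max (d l) 0)%R; pose be l := absz (Num.max (- d l) 0)%R.
have abE l : d l = (al l)%:Z - (be l)%:Z by rewrite /al /be; case: (ltP (d l) 0); lia.
have jE : zvec U_(j)%MM = \sum_l (zvec (Epos l) - zvec (Eneg l)) *~ d l.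
  rewrite -[zvec _]mulmx1 -(chart_invK a_unit) mulmxA dE mulmx_suml.
  apply: eq_bigr => l _; rewrite -rowZ_int -scalemxAl rowZ_int mulmxBl -!zvec_cmn.
  congr (_ *~ _); apply/rowP => i; rewrite !mxE !mnmBE; lia.
have mE : (U_(j) + (\sum_l Epos l *+ be l) + (\sum_l Eneg l *+ al l) =
           (\sum_l Epos l *+ al l) + (\sum_l Eneg l *+ be l))%MM.
  apply: zvec_inj; rewrite !zvecD !zvec_sum jE.
  apply/eqP; rewrite -subr_eq0; apply/eqP.
  rewrite -!big_split -sumrB big1 // => l _ /=.
  by rewrite !zvecMn abE; apply/rowP => i; rewrite -!rowZ_int -!scaler_nat !mxE; ring.
have [C [CE CM C1]] : exists C : k -> Q,
    [/\ forall e, pY (cst e) = C e, forall e e', C (e * e') = C e * C e' & C 1 = 1].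
  exists (fun e => pY (cst e)); split=> // [e e'|]; first by rewrite cstM rmorphM.
  by rewrite cst1 rmorph1.
have xsum (e : 'I_s -> nat) : res_mono (\sum_l Epos l *+ e l)%MM =
    C (\prod_l lambda l ^+ e l) * res_mono (\sum_l Eneg l *+ e l)%MM.
  rewrite !(big_morph res_mono res_monoD res_mono0) (big_morph C CM C1) -big_split.
  apply: eq_bigr => l _ /=; rewrite !res_monoMn res_mono_bin exprMn CE; congr (_ * _).
  by elim: (e l) => [|i IH]; rewrite ?expr0 ?C1 // !exprS IH CM.
have usum (e : 'I_s -> nat) : exists u, u * res_mono (\sum_l Eneg l *+ e l)%MM = 1.
  have [U UP] := choice res_Eneg_unit.
  exists (\prod_l U l ^+ e l); rewrite (big_morph res_mono res_monoD res_mono0) -big_split big1 // => l _ /=.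
  by rewrite res_monoMn -exprMn UP expr1n.
have [ua uaE] := usum al; have [ub ubE] := usum be.
set cA := \prod_l lambda l ^+ al l; set cB := \prod_l lambda l ^+ be l.
have cB0 : cB != 0 by apply/prodf_neq0 => l _; rewrite expf_neq0 //; apply/eqP.
exists (cA / cB).
have := congr1 res_mono mE; rewrite !res_monoD !xsum -/cA -/cB.
set xA := res_mono (\sum_l Eneg l *+ al l)%MM in uaE *; set xB := res_mono (\sum_l Eneg l *+ be l)%MM in ubE *.
move=> h.
have cBi : C cB * C cB^-1 = 1 by rewrite -CM divff.
rewrite CE CM; exact: unit_cancel h cBi uaE ubE.
Qed.

(** A series reduces to its constant term, because every [u_i] is divisible on the chart by some
    [y_j] with [j] in [tau]; the [y_j] outside [tau] reduce to constants too. *)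
Lemma residue g : exists e, Y (g - cst e).
Proof.
have cstE x y e e' : x = pY (cst e) -> y = pY (cst e') -> x * y = pY (cst (e * e')).
  by move=> -> ->; rewrite cstM rmorphM.
suff [e h] : exists e, pY g = pY (cst e) by exists e; apply/quoP.
have xmE b : exists e, res_mono b = pY (cst e).
  elim/mnm_gen: b => [|j|p q [e he] [e' he']]; first by exists 1; rewrite res_mono0 cst1 rmorph1.
    exact: res_mono_coord.
  by exists (e * e'); rewrite res_monoD; apply: cstE.
have SE (x : S) : exists e, pY (qA x%:MP) = pY (cst e).
  exists (coef x 0%MM).
  have [|G GE] := @split_generators _ _ [seq U_(i)%MM | i <- enum 'I_N] (x - sC N (coef x 0%MM)).
    move=> p; rewrite coefB coef_sC; have [->|p0 _] := eqVneq p 0%MM; first by rewrite mulr1 subrr.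
    have [i pi0] : exists i, p i != 0%N.
      apply: contrapT => h; case/eqP: p0; apply/mnmP => i; rewrite mnm0E.
      by apply/eqP/negPn/negP => pi0; apply: h; exists i.
    by exists U_(i)%MM; [apply: map_f; rewrite mem_enum | rewrite lep1mP].
  pose pq (x : S) := pY (qA x%:MP).
  have pqD x1 x2 : pq (x1 + x2) = pq x1 + pq x2 by rewrite /pq mpolyCD !rmorphD.
  have pqM x1 x2 : pq (x1 * x2) = pq x1 * pq x2 by rewrite /pq mpolyCM !rmorphM.
  have pq0 : pq 0 = 0 by rewrite /pq mpolyC0 !rmorph0.
  rewrite -/(pq x) -[x in LHS](subrK (sC N (coef x 0%MM))) GE pqD.
  rewrite (big_morph pq pqD pq0) big1 ?add0r // => t _.
  rewrite pqM {1}/pq -/(sXm _ _) formal_monomial -/(res_mono _).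
  have /mapP [i _ ->] : nth 0%MM [seq U_(i)%MM | i <- enum 'I_N] t \in [seq U_(i)%MM | i <- enum 'I_N].
    exact: mem_nth.
  by have [j tj lt] := tau_pos w_pos a_unit i; rewrite (res_mono_tau tj lt) mul0r.
have [G <-] := quo_surj g; rewrite [G]mpolyE !rmorph_sum.
apply: (big_ind (fun x => exists e, x = pY (cst e))).
- by exists 0; rewrite cst0 rmorph0.
- by move=> _ _ [e ->] [e' ->]; exists (e + e'); rewrite cstD rmorphD.
move=> b _; rewrite -mul_mpolyC !rmorphM; have [e he] := SE G@_b; have [e' he'] := xmE b.
by exists (e * e'); apply: cstE.
Qed.

(** Stated for an arbitrary order, since it also locates the center of the auxiliary lexicographic
    valuation. An element of the center is constant modulo [Y], and a nonzero constant is a unit. *)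
Lemma center_eq (O' : group_order Phi) (v' : K -> Phi) : is_valuation O' v' ->
  (forall p, v' (iota (pi (sX k p))) = wt w p) ->
  (forall g, valuation_ring O' v' (f g)) -> (forall j, tau j -> O' 0 (om j)) ->
  [set g | valuation_max O' v' (f g)] = Y.
Proof.
move=> v'_val v'X fV om'; have pp := vmax_prime v'_val fV.
have hp := prime_is_ideal pp; have [_ p1 _] := pp.
have YP : Y `<=` [set g | valuation_max O' v' (f g)].
  apply: span_min => // _ [j tj <-]; right.
  rewrite (formal_map_weight a_unit sX_neq0 fE U_(j)%MM v'_val v'X); split; first exact: om'.
  by move=> e; move: tj; rewrite /= /ptau -e eqxx.
rewrite eqEsubset; split=> // g pg; have [e Yg] := residue g.
have [e0|e0] := eqVneq e 0; first by rewrite e0 cst0 subr0 in Yg.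
case: p1; have -> : 1 = cst e^-1 * cst e by rewrite -cstM mulVf // cst1.
apply: idealMl => //; have -> : cst e = g - (g - cst e) by rewrite opprB addrC subrK.
by apply: idealB => //; apply: YP.
Qed.

Variables (c : 'I_N -> k).
Hypothesis c_neq0 : forall i, c i != 0.
Hypothesis J_mono : forall p q, wt w p = wt w q ->
  ideal_span (binomials m n lambda) ('X_[p] - (mono c p / mono c q) *: 'X_[q]).
Hypothesis c_bin : forall l, mono c (m l) = lambda l * mono c (n l).

Local Notation L := [seq j <- enum 'I_N | tau j].

Lemma mem_L j : (j \in L) = tau j.
Proof. by rewrite mem_filter mem_enum andbT. Qed.

(** The lexicographic order on the coordinates along [tau] gives another valuation
    of [K] with center [Y]; its convex subgroups yield the chain of primes. *)
Lemma center_chain : prime_ideal Y -> prime_chain Y (size L).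
Proof.
move=> Yprime.
have [alpha [alphaB alphaP alphaE]] := weight_dual w_gen hF a_unit.
have alpha_w z j : tau j -> alpha (w z) 0 j = (z *m (chart_mx a)^T) 0 j.
  by move=> tj; apply: alphaE => l; apply: (bin_tau hF a_unit a_bin om_ge0).
have alpha_om i j : tau j -> alpha (om i) 0 j = (i == j)%:R.
  move=> tj; rewrite [om i]/(w _) alpha_w // -mulmxA chart_invK // mulmx1.
  by rewrite !mxE mnm1E; case: eqP.
have [O' O'E] : exists O' : group_order Phi,
    forall phi psi, O' phi psi = lexpos (alpha (psi - phi) 0) L.
  by apply: lex_order => // j; rewrite mem_L.
have O'_wt p q : (forall j, tau j -> (cmn a p j <= cmn a q j)%N) -> O' (wt w p) (wt w q).
  move=> le; rewrite O'E; apply: lexpos_ge0 => j; rewrite mem_L => tj.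
  rewrite /wt -raddfB alpha_w // mulmxBl -!zvec_cmn !mxE subr_ge0.
  exact: le.
have vt := chart_val_theory w_pos hF gens_supp gens_le a_unit a_bin a_gens om_ge0
  c_neq0 J_mono c_bin O'_wt.
have w_pos' i : glt O' 0 (wt w U_(i)%MM).
  split; last by case: (w_pos i).
  by rewrite -(wt0 w); apply: O'_wt => j _; rewrite cmn0 mnm0E.
have [v' [v'_val v'E]] := valuation_extends fracK (vt_ex vt) (vt_uniq vt) (vt_neq0 vt)
  (vt_mul vt) (vt_add vt).
have v'X p : v' (iota (pi (sX k p))) = wt w p.
  by apply: v'E; apply: val_rel_mono.
have v'f b := formal_map_weight a_unit sX_neq0 fE b v'_val v'X.
have om' j : O' 0 (om j).
  rewrite O'E subr0; apply: lexpos_ge0 => i; rewrite mem_L => ti.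
  by rewrite alpha_om.
have fV g : valuation_ring O' v' (f g).
  apply: (@formal_map_generated (valuation_ring O' v')) => [x|j|x y|x y].
  - exact: (iota_valuation_ring w_pos' vt v'E).
  - by right; rewrite (v'f U_(j)%MM).
  - exact: vringD.
  - exact: vringM.
have centerE := center_eq v'_val v'X fV (fun j _ => om' j).
(* The values whose coordinates along the first [i] elements of [L] vanish: a convex subgroup for
   [O'], the whole group when [i = 0]. It shrinks as [i] grows, so the primes [q i] increase. *)
pose H i : set Phi := [set phi | forall j, j \in take i L -> alpha phi 0 j = 0].
have alpha0 : alpha 0 = 0 by rewrite -(subrr 0) alphaB subrr.
have alphaN phi : alpha (- phi) = - alpha phi by rewrite -sub0r alphaB alpha0 sub0r.
have alphaD x y : alpha (x + y) = alpha x + alpha y.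
  by rewrite -{1}[y]opprK alphaB alphaN opprK.
have H0 i : H i 0 by move=> j _; rewrite alpha0 mxE.
have HD i x y : H i x -> H i y -> H i (x + y).
  by move=> hx hy j jL; rewrite alphaD mxE hx // hy // addr0.
have Hc i x y : O' 0 x -> O' x y -> H i y -> H i x.
  rewrite !O'E subr0 alphaB => x0 xy Hy.
  apply: (lexpos_anti (lexpos_take i x0)).
  have := lexpos_take i xy; rewrite (@lexpos_eq_in _ _ (fun j => - alpha x 0 j)) // => j jL.
  by rewrite !mxE Hy // add0r.
pose q i : set A := [set g | f g = 0 \/ ~ H i (v' (f g))].
have qprime i : prime_ideal (q i) by exact: (convex_prime v'_val fV (H0 i) (@HD i) (@Hc i)).
exists q; split=> i iL.
  split; first exact: qprime.
  rewrite -centerE => g [g0|nH]; first by left.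
  by case: (fV g) => [g0|v0]; [left | right; split=> // e; apply: nH; rewrite -e].
have j0 : 'I_N by move: iL; case: (L) => [|j l] // _; exact: j.
pose j := nth j0 L i.
have tj : tau j by rewrite -mem_L; apply: mem_nth.
have vj : v' (f (yc j)) = om j by apply: (v'f U_(j)%MM).
split=> [g [g0|nH]|e]; [by left | right=> Hg; apply: nH => t tl; apply: Hg |].
  by rewrite (take_nth j0) // mem_rcons inE tl orbT.
(* [y_j], with [j] at position [i] in [L], separates the two primes: its value has coordinate 1
   along [j] and 0 along the preceding elements. *)
have : q i.+1 (yc j).
  right; rewrite vj => /(_ j); rewrite (take_nth j0) // mem_rcons mem_head => /(_ isT).
  by rewrite alpha_om // eqxx => /eqP; rewrite oner_eq0.
rewrite -e => -[/eqP|].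
  by rewrite (negbTE (formal_map_mono_neq0 a_unit sX_neq0 fE U_(j)%MM)).
apply; rewrite vj => t tl.
have tt' : tau t by rewrite -mem_L; apply: mem_take tl.
rewrite alpha_om //; case: eqP => // jt; exfalso.
have uL : uniq L by rewrite filter_uniq // enum_uniq.
have := uL; rewrite -{1}(cat_take_drop i L) cat_uniq => /and3P [_ /hasP h _]; apply: h.
by exists t => //; rewrite -jt /j (drop_nth j0) // mem_head.
Qed.

Theorem formal_regular (v : K -> Phi) (p : set A) : is_valuation O v ->
  (forall p, v (iota (pi (sX k p))) = wt w p) ->
  (forall g, valuation_ring O v (f g)) -> p = [set g | valuation_max O v (f g)] ->
  regular_at p /\ transversal_at (@formal_coord N a k (range F)) p.
Proof.
move=> v_val vX fV pE.
have Yprime : prime_ideal Y.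
  by rewrite -(center_eq v_val vX fV (fun j _ => om_ge0 j)); apply: vmax_prime.
have {pE} pE : p = Y by rewrite pE (center_eq v_val vX fV (fun j _ => om_ge0 j)).
have pyE j : `[< p (yc j) >] = tau j.
  apply/asboolP/idP => [|tj]; last by rewrite pE; apply: subset_span; exists j.
  rewrite pE -(center_eq v_val vX fV (fun j _ => om_ge0 j)) /=.
  rewrite /valuation_max /= (formal_map_weight a_unit sX_neq0 fE U_(j)%MM v_val vX) => -[/eqP|[_ ne]].
    by rewrite (negbTE (formal_map_mono_neq0 a_unit sX_neq0 fE U_(j)%MM)).
  by apply/eqP => e; apply: ne; rewrite e.
pose ys := [seq yc j | j <- enum 'I_N & `[< p (yc j) >]].
have ysE : ys = [seq yc j | j <- L].
  by rewrite /ys; congr map; apply: eq_filter => j; rewrite pyE.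
have spanE : ideal_span [set y | y \in ys] = Y.
  congr ideal_span; rewrite eqEsubset; split=> y.
    by rewrite /= ysE => /mapP [j]; rewrite mem_L => tj ->; exists j.
  by move=> [j tj <-]; rewrite /= ysE; apply: map_f; rewrite mem_L.
have reg : regular_parameters p ys.
  rewrite pE; split=> //.
  - split; first by rewrite ysE size_map; apply: center_chain.
    move=> e; apply: krull_height => //.
    + apply: noetherian_quotient; apply: noetherian_mpoly; exact: noetherian_series.
    + by move=> y ys_y; rewrite -spanE; apply: subset_span.
    + by rewrite spanE => z Yz; exists 1%N; rewrite expr1; apply: sub_satur.
  - by move=> y ys_y; rewrite -spanE; apply: subset_span.
  - move=> x Yx; exists 1; first by case: Yprime.
    by rewrite mul1r spanE.
split; first by exists ys.
(* The components of the boundary through the center already form a full system of parameters. *)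
by exists [::]; rewrite cats0.
Qed.

End FormalRegular.

(** * Regularity of polynomial rings *)

(** [xs] is a regular system of parameters at [q], up to the bound on the
    dimension, which in a noetherian ring follows from Krull's theorem. *)
Definition weak_parameters (B : comPzRingType) (q : set B) (xs : seq B) : Prop :=
  [/\ prime_chain q (size xs), forall x, x \in xs -> q x
    & forall x, q x -> exists2 t, ~ q t & ideal_span [set y | y \in xs] (t * x)].

(** Regularity of [B] and transversality to the divisors with equations [zs], at every prime, in a
    form that passes to polynomial rings. *)
Definition regular_along (B : comPzRingType) (zs : seq B) : Prop :=
  forall q : set B, prime_ideal q ->
  exists xs, weak_parameters q ([seq z <- zs | `[< q z >]] ++ xs).

Lemma regular_along_field (k : fieldType) : @regular_along k [::].
Proof.
move=> q pq; have [_ q1 _] := pq; exists [::]; split=> //=.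
  by exists (fun=> q); split=> i; [split | rewrite ltn0].
move=> x qx; exists 1 => //; have [->|x0] := eqVneq x 0.
  by rewrite mulr0; apply: ideal0; apply: span_ideal.
by case: q1; rewrite -(mulVf x0); apply: idealMl => //; apply: prime_is_ideal.
Qed.

Section PolyExtension.
Variable B : comNzRingType.
Implicit Types (q : set B) (p : set {poly B}) (f g : {poly B}).

Definition poly_ext q : set {poly B} := [set f | forall i, q f`_i].

Lemma poly_ext_ideal q : is_ideal q -> is_ideal (poly_ext q).
Proof.
move=> hq; split=> [i|f g hf hg i|f g hg i].
- by rewrite poly.coef0; apply: ideal0.
- by rewrite poly.coefD; apply: idealD.
- by rewrite poly.coefM; apply: ideal_sum => // j _; apply: idealMl.
Qed.

Lemma poly_extC q b : is_ideal q -> poly_ext q b%:P <-> q b.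
Proof.
move=> hq; split=> [/(_ 0%N)|qb i]; first by rewrite coefC.
by rewrite coefC; case: eqP => // _; apply: ideal0.
Qed.

Lemma poly_ext_least q f : ~ poly_ext q f -> exists2 i, ~ q f`_i & forall j, (j < i)%N -> q f`_j.
Proof.
move=> nf; have [i ni] : exists i, ~ q f`_i.
  by apply: contrapT => h; apply: nf => i; apply: contrapT => hi; apply: h; exists i.
have ex : exists i, ~~ `[< q f`_i >] by exists i; apply/asboolPn.
case: (ex_minnP ex) => t /asboolPn nt tmin; exists t => // j jt.
by apply: contrapT => /asboolPn /tmin; rewrite leqNgt jt.
Qed.

Lemma poly_ext_prime q : prime_ideal q -> prime_ideal (poly_ext q).
Proof.
move=> pq; have hq := prime_is_ideal pq; have [_ q1 qM] := pq.
split; first by apply/is_idealP; apply: poly_ext_ideal.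
  by move=> /(_ 0%N); rewrite poly.coef1.
move=> f g fg; apply: contrapT => /not_orP [/poly_ext_least [i ni li] /poly_ext_least [j nj lj]].
have := fg (i + j)%N; rewrite poly.coefM; have lt : (i < (i + j).+1)%N by rewrite ltnS leq_addr.
rewrite (bigD1 (Ordinal lt)) //= addKn => h.
have : q (f`_i * g`_j).
  apply: (ideal_addK hq _ h); apply: ideal_sum => // t ne.
  have [ti|it] := ltnP t i; first by apply: idealMr => //; apply: li.
  apply: idealMl => //; apply: lj; have : (t : nat) != i by apply: contraNneq ne => e; apply/eqP/val_inj.
  by have := ltn_ord t; lia.
by case/qM.
Qed.

Lemma contract_prime p : prime_ideal p -> prime_ideal [set b | p b%:P].
Proof.
move=> pp; have hp := prime_is_ideal pp; have [_ p1 pM] := pp.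
split=> [||x y /=]; [apply/is_idealP; split=> [|x y /= px py|b x /= px] | by [] |].
- by rewrite /= polyC0; apply: ideal0.
- by rewrite /= polyCD; apply: idealD.
- by rewrite /= polyCM; apply: idealMl.
- by rewrite polyCM; apply: pM.
Qed.

Lemma contract_ext p : prime_ideal p -> poly_ext [set b | p b%:P] `<=` p.
Proof.
move=> pp f hf; have hp := prime_is_ideal pp; rewrite -[f]coefK poly_def.
by apply: ideal_sum => // i _; rewrite -mul_polyC; apply: idealMr => //; apply: hf.
Qed.

Section Fiber.
Variables (p : set {poly B}) (xs : seq B).
Hypothesis pp : prime_ideal p.
Local Notation q := [set b | p b%:P].
Hypothesis wxs : weak_parameters q xs.

Let hp : is_ideal p. Proof. exact: prime_is_ideal. Qed.
Let pq : prime_ideal q. Proof. exact: contract_prime. Qed.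
Let hq : is_ideal q. Proof. exact: prime_is_ideal. Qed.

Lemma fiber_gen g : poly_ext q g ->
  exists2 t, ~ q t & ideal_span [set y | y \in map polyC xs] (t%:P * g).
Proof.
move=> hg; have [_ _ gen] := wxs; have hs := span_ideal [set y | y \in map polyC xs].
rewrite -[g]coefK; elim: (size g) => [|d [t qt IH]].
  exists 1; first by case: pq.
  by rewrite poly_def big_ord0 mulr0; apply: ideal0.
have [t' qt' [e [c [b [bx E]]]]] := gen _ (hg d).
exists (t * t'); first exact: primeM.
rewrite poly_def big_ord_recr /= -poly_def polyCM mulrDr; apply: idealD => //.
  by rewrite mulrAC; apply: idealMr.
rewrite -mul_polyC mulrA -(mulrA t%:P) -polyCM E rmorph_sum mulr_sumr mulr_suml.
apply: ideal_sum => // i _; apply: idealMr => //; apply: idealMl => //; rewrite rmorphM.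
by apply: idealMl => //; apply: subset_span; apply: map_f; apply: bx.
Qed.

Lemma fiber_chain : exists Q : nat -> set {poly B},
  (forall i, (i <= size xs)%N -> prime_ideal (Q i) /\ Q i `<=` poly_ext q) /\
  (forall i, (i < size xs)%N -> Q i `<=` Q i.+1 /\ Q i <> Q i.+1).
Proof.
have [[Q [Qp Qlt]] _ _] := wxs; exists (fun i => poly_ext (Q i)); split=> i iL.
  have [pQ Qq] := Qp i iL; split; first exact: poly_ext_prime.
  by move=> f hf j; apply: Qq.
have [le ne] := Qlt i iL; split; first by move=> f hf j; apply: le.
move=> e; apply: ne; have [h1 _] := Qp i (ltnW iL); have [h2 _] := Qp i.+1 iL.
apply/seteqP; split=> b; first exact: le.
by move=> hb; apply/(poly_extC _ (prime_is_ideal h1)); rewrite e; apply/(poly_extC _ (prime_is_ideal h2)).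
Qed.

Lemma fiber_generic : p `<=` poly_ext q -> weak_parameters p (map polyC xs).
Proof.
move=> pE; have [Q [Qp Qlt]] := fiber_chain; split.
- rewrite size_map; exists Q; split=> // i iL; have [pQ Qq] := Qp i iL; split=> //.
  by move=> f /Qq; apply: contract_ext.
- by have [_ xsq _] := wxs; move=> _ /mapP [x /xsq qx ->].
- by move=> g /pE /fiber_gen [t qt ht]; exists t%:P.
Qed.

(** A closed point of the fibre over [q]. Pseudo-division by [f] multiplies by a power of the
    leading coefficient, which is outside [q], and leaves a remainder with coefficients in [q]; so
    [f] completes the parameters of [q], and [p] prolongs the extended chain. The condition on [zs]
    is independent of the position of [f] in the list. *)
Lemma fiber_closed f zs : p f -> f != 0 -> ~ q (lead_coef f) ->
  (forall g, p g -> (size g < size f)%N -> poly_ext q g) ->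
  (forall y, (y \in zs) = (y == f) || (y \in map polyC xs)) -> size zs = (size xs).+1 ->
  weak_parameters p zs.
Proof.
move=> pf f0 qf fmin zsE zsz; have [Q [Qp Qlt]] := fiber_chain; split.
- have sub i : (i <= size xs)%N -> Q i `<=` p.
    by move=> iL g /((Qp i iL).2); apply: contract_ext.
  rewrite zsz; exists (fun i => if (i <= size xs)%N then Q i else p); split=> i iL.
    by case: ifP => iL'; [split; [apply: (Qp i iL').1 | apply: sub] | split].
  rewrite -ltnS iL; case: ifP => iL'; first exact: Qlt.
  split; first by apply: sub; rewrite -ltnS.
  by move=> e; have := (Qp i iL).2 f; rewrite e => /(_ pf) hf; apply: qf; apply: hf.
- move=> y; rewrite zsE => /predU1P [-> //|/mapP [x xxs ->]].
  by have [_ xsq _] := wxs; apply: xsq.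
- move=> g pg; have := Pdiv.ComRing.rdivp_eq f g.
  set a := lead_coef f ^+ _; set h := Pdiv.CommonRing.rdivp g f; set r := Pdiv.CommonRing.rmodp g f => E.
  have qa : ~ q a by move=> /(prime_exp pq).
  have hr : poly_ext q r.
    apply: fmin; last by rewrite Pdiv.Ring.ltn_rmodp.
    have -> : r = a%:P * g - h * f by rewrite mul_polyC E addrC addKr.
    by apply: idealB => //; apply: idealMl.
  have hs := span_ideal [set y | y \in zs].
  have [t qt ht] := fiber_gen hr; exists (t * a)%:P; first exact: (primeM pq).
  rewrite polyCM -mulrA (mul_polyC a) E mulrDr; apply: idealD => //.
    by rewrite mulrA; apply: idealMl => //; apply: subset_span; rewrite /= zsE eqxx.
  by apply: span_sub ht => y /= hy; rewrite zsE hy orbT.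
Qed.

End Fiber.

(** If ['X] is in [p], it is itself the additional parameter, as transversality requires. Otherwise
    [p] is either the extension of its contraction, with no additional parameter, or a closed point
    of the fibre, where a polynomial of least size outside that extension is added. *)
Lemma regular_along_poly (zs : seq B) : regular_along zs ->
  regular_along ('X :: map polyC zs).
Proof.
move=> rB p pp; have hp := prime_is_ideal pp; have [_ p1 _] := pp.
have pq := contract_prime pp; have [xs wxs] := rB _ pq.
set ys := _ ++ xs in wxs.
have ysE : [seq z <- map polyC zs | `[< p z >]] ++ map polyC xs = map polyC ys.
  by rewrite /ys map_cat filter_map.
have mem_rcons' (f : {poly B}) (L : seq {poly B}) y : (y \in rcons L f) = (y == f) || (y \in L).
  by rewrite mem_rcons inE.
rewrite /=; case: asboolP => pX.
  exists (map polyC xs); rewrite cat_cons ysE.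
  apply: (fiber_closed pp wxs pX); rewrite ?polyX_eq0 ?lead_coefX //= ?size_map //.
  rewrite size_polyX => g pg /size1_polyC gE; rewrite gE in pg *.
  by apply/(poly_extC _ (prime_is_ideal pq)).
have [pE|npE] := pselect (p `<=` poly_ext [set b | p b%:P]).
  by exists (map polyC xs); rewrite ysE; apply: fiber_generic.
have ex : exists d, `[< exists f, [/\ p f, ~ poly_ext [set b | p b%:P] f & size f = d] >].
  apply: contrapT => h; apply: npE => f pf; apply: contrapT => nf; apply: h.
  by exists (size f); apply/asboolP; exists f.
case: (ex_minnP ex) => d /asboolP [f [pf nf fd]] dmin.
have fmin g : p g -> (size g < size f)%N -> poly_ext [set b | p b%:P] g.
  move=> pg lt; apply: contrapT => ng; have : (d <= size g)%N.
    by apply: dmin; apply/asboolP; exists g.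
  by rewrite -fd leqNgt lt.
have f0 : f != 0.
  apply/eqP => e; apply: nf; rewrite e; apply: ideal0; apply: poly_ext_ideal; exact: prime_is_ideal.
(* Otherwise removing the leading term would leave a smaller polynomial of [p], with coefficients in
   the contraction by minimality. *)
have qf : ~ p (lead_coef f)%:P.
  move=> pl; apply: nf; have pl' : poly_ext [set b | p b%:P] ((lead_coef f)%:P * 'X^((size f).-1)).
    apply: (@idealMr _ (poly_ext [set b | p b%:P])); first exact: poly_ext_ideal (prime_is_ideal pq).
    by apply/(poly_extC _ (prime_is_ideal pq)).
  have he := poly_ext_ideal (prime_is_ideal pq).
  rewrite -[f](subrK ((lead_coef f)%:P * 'X^((size f).-1))).
  apply: (idealD he _ pl').
  apply: fmin; first by apply: idealB => //; apply: contract_ext pl'.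
  have sf : (0 < size f)%N by rewrite size_poly_gt0.
  rewrite -[X in (_ < X)%N](prednK sf) ltnS; apply/leq_sizeP => i.
  rewrite poly.coefB coefCM coefXn /lead_coef leq_eqVlt => /predU1P [<-|lt].
    by rewrite eqxx mulr1 subrr.
  by rewrite gtn_eqF // mulr0 subr0 nth_default // -(prednK sf).
exists (rcons (map polyC xs) f); rewrite -rcons_cat ysE.
apply: (fiber_closed pp wxs pf f0 qf fmin); first exact: mem_rcons'.
by rewrite size_rcons size_map.
Qed.

End PolyExtension.

Section Localization.
Variables (B A : comPzRingType) (psi : {rmorphism B -> A}) (zs : seq B).
Hypothesis psi_inj : forall b, psi b = 0 -> b = 0.
Hypothesis psi_frac : forall z, exists b0 b, (exists t, t * psi b0 = 1) /\ psi b0 * z = psi b.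
Hypothesis noeth : noetherian A.
Hypothesis rB : regular_along zs.

Let psi_inj2 b b' : psi b = psi b' -> b = b'.
Proof.
move=> e; apply/eqP; rewrite -subr_eq0; apply/eqP; apply: psi_inj.
by rewrite rmorphB e subrr.
Qed.

Lemma unit_notin (I : set A) x : prime_ideal I -> (exists t, t * x = 1) -> ~ I x.
Proof.
move=> pI [t tx] Ix; have [_ I1 _] := pI; apply: I1; rewrite -tx.
by apply: idealMl => //; apply: prime_is_ideal.
Qed.

Definition loc_ext (q : set B) : set A :=
  [set z | exists b0 b, [/\ exists t, t * psi b0 = 1, psi b0 * z = psi b & q b]].

Lemma loc_ext_prime (p : set A) (q : set B) : prime_ideal p -> prime_ideal q ->
  (forall b, q b -> p (psi b)) -> prime_ideal (loc_ext q) /\ loc_ext q `<=` p.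
Proof.
move=> pp pq qp; have hq := prime_is_ideal pq; have hp := prime_is_ideal pp.
have [_ q1 qM] := pq.
have unitM b b' : (exists t, t * psi b = 1) -> (exists t, t * psi b' = 1) ->
    exists t, t * psi (b * b') = 1.
  by move=> [t tb] [t' tb']; exists (t * t'); rewrite rmorphM mulrACA tb tb' mulr1.
have nq b : (exists t, t * psi b = 1) -> ~ q b.
  by move=> ub /qp; apply: unit_notin.
split.
  split.
  - apply/is_idealP; split=> [|z z' [b0 [b [u0 e qb]]] [b0' [b' [u0' e' qb']]]|y z [b0 [b [u0 e qb]]]].
    + exists 1, 0; rewrite !rmorph0 mulr0; split=> //; last exact: ideal0.
      by exists 1; rewrite rmorph1 mulr1.
    + exists (b0 * b0'), (b0' * b + b0 * b'); split; first exact: unitM.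
        by rewrite mulrDr !rmorphD !rmorphM /= -e -e'; ring.
      by apply: idealD => //; apply: idealMl.
    + have [c0 [c [u1 e1]]] := psi_frac y.
      exists (c0 * b0), (c * b); split; first exact: unitM.
        by rewrite !rmorphM /= -e -e1; ring.
      exact: idealMl.
  - by move=> [b0 [b [u0]]]; rewrite mulr1 => /psi_inj2 <-; apply: nq.
  move=> z z' [b0 [b [u0 e qb]]].
  have [c0 [c [u1 e1]]] := psi_frac z; have [d0 [d [u2 e2]]] := psi_frac z'.
  have E : b0 * (c * d) = c0 * d0 * b.
    by apply: psi_inj2; rewrite !rmorphM /= -e -e1 -e2; ring.
  have : q (b0 * (c * d)) by rewrite E; apply: idealMl.
  case/qM => [/(nq _ u0) //|/qM [qc|qd]]; [left|right].
    by exists c0, c.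
  by exists d0, d.
move=> z [b0 [b [u0 e qb]]]; have [_ _ pM] := pp.
have : p (psi b0 * z) by rewrite e; apply: qp.
by case/pM => // /(unit_notin pp u0).
Qed.

(** [A] is the localization of [B] at the elements that [psi] makes invertible. Chains below the
    contraction of [p] extend strictly through [loc_ext], and Krull's theorem in [A] gives the bound
    on the dimension. *)
Lemma regular_localization (p : set A) : prime_ideal p ->
  exists xs, regular_parameters p ([seq z <- map psi zs | `[< p z >]] ++ xs).
Proof.
move=> pp; have hp := prime_is_ideal pp; have [_ p1 pM] := pp.
have pq : prime_ideal [set b | p (psi b)].
  split=> [||x y /=]; [apply/is_idealP; split=> [|x y /= px py|b x /= px] | by rewrite /= rmorph1 |].
  - by rewrite /= rmorph0; apply: ideal0.
  - by rewrite /= rmorphD; apply: idealD.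
  - by rewrite /= rmorphM; apply: idealMl.
  - by rewrite rmorphM; apply: pM.
have [xs wxs] := rB pq; exists (map psi xs).
set ys := _ ++ xs in wxs; set Y := _ ++ _.
have YE : Y = map psi ys by rewrite /Y /ys map_cat filter_map.
have Yp y : y \in Y -> p y.
  by rewrite YE => /mapP [x xys ->]; have [_ h _] := wxs; apply: h.
have gen x : p x -> exists2 t, ~ p t & ideal_span [set y | y \in Y] (t * x).
  move=> px; have [b0 [b [u0 e]]] := psi_frac x.
  have [_ _ gen] := wxs; have [|t qt [d [c [g [gy E]]]]] := gen b.
    by rewrite /= -e; apply: idealMl.
  exists (psi (t * b0)).
    rewrite rmorphM; apply: primeM => //; exact: unit_notin.
  rewrite rmorphM -mulrA e -rmorphM E rmorph_sum; have hs := span_ideal [set y | y \in Y].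
  apply: ideal_sum => // i _; rewrite rmorphM; apply: idealMl => //; apply: subset_span.
  by rewrite /= YE; apply: map_f; apply: gy.
split=> //; split.
  rewrite YE size_map; have [[Q [Qp Qlt]] _ _] := wxs.
  exists (fun i => loc_ext (Q i)); split=> i iL.
    by have [pQ Qq] := Qp i iL; apply: loc_ext_prime => // b /Qq.
  have [le ne] := Qlt i iL; split; first by move=> z [b0 [b [u0 e /le qb]]]; exists b0, b.
  move=> E; apply: ne; apply/seteqP; split=> // b qb.
  have : loc_ext (Q i.+1) (psi b).
    by exists 1, b; rewrite rmorph1 mul1r; split=> //; exists 1; rewrite mulr1.
  rewrite -E => -[b0 [b' [u0]]]; rewrite -rmorphM => /psi_inj2 <-.
  have [[_ _ QM] Qq] := Qp i (ltnW iL); case/QM => // /Qq /=.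
  by move/(unit_notin pp u0).
move=> e; apply: krull_height => // z pz; exists 1%N; rewrite expr1.
by have [t pt ht] := gen z pz; exists t.
Qed.

End Localization.

Section Tower.
Variables (N : nat) (Phi : zmodType) (w : {additive 'rV[int]_N -> Phi}) (k : fieldType).
Variable c : 'I_N -> k.
Hypothesis c_neq0 : forall i, c i != 0.
Local Notation X := 'X_{1..N}.
Local Notation E g phi := ((hpart w phi g).@[c]).
Implicit Types (P p q : X) (phi psi : Phi) (g h : {mpoly k[N]}) (Ps : seq X) (beta : {additive Phi -> int}).

(** Linear independence of the weights in a triangular form: a linear form that
    does not vanish on the first one vanishes on all the others. *)
Fixpoint has_duals Ps : Prop := if Ps is P :: Ps' then
    (exists2 beta : {additive Phi -> int}, beta (wt w P) != 0 &
       forall P', P' \in Ps' -> beta (wt w P') = 0) /\ has_duals Ps'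
  else True.

Lemma wtMn P i : wt w (P *+ i)%MM = wt w P *+ i.
Proof. by rewrite /wt zvecMn raddfMn. Qed.

Lemma dual_inj beta phi x (i j : nat) : beta phi = 0 -> beta x != 0 ->
  beta (phi + x *+ j - x *+ i) = 0 -> i = j.
Proof.
move=> bphi bx e; have : beta x *+ j = beta x *+ i.
  rewrite -!raddfMn -[x *+ j](subrK (x *+ i)) raddfD.
  have -> : x *+ j - x *+ i = phi + x *+ j - x *+ i - phi by rewrite addrAC [phi + _]addrC addrK.
  by rewrite raddfB e bphi subrr add0r.
by move/(mulrIn bx).
Qed.

Lemma ini_mulX p g phi : E ('X_[p] * g) phi = mono c p * E g (phi - wt w p).
Proof. by rewrite hpartMX mevalM monoE. Qed.

Lemma ini_const (e : k) phi : E e%:MP phi = if 0 == phi then e else 0.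
Proof.
have -> : e%:MP = e *: 'X_[0%MM] :> {mpoly k[N]} by rewrite mpolyX0 -mul_mpolyC mulr1.
rewrite hpartZ hpartX wt0 mevalZ; case: eqP => _; last by rewrite meval0 mulr0.
by rewrite monoE /mono big1 ?mulr1 // => i _; rewrite mnm0E expr0.
Qed.

(** The polynomial ring on the [X^P], [P] in [Ps], maps injectively to
    [gr_w / (g vanishing at c)], since the weights of its monomials are distinct. *)
Lemma poly_tower Ps : has_duals Ps ->
  exists (B : comNzRingType) (theta : {rmorphism B -> {mpoly k[N]}}) (zs : seq B),
  [/\ map theta zs = [seq 'X_[P] | P <- Ps], regular_along zs,
      forall e, exists b, theta b = e%:MP,
      forall b, b != 0 -> exists phi, E (theta b) phi != 0
    & forall b beta phi, (forall P, P \in Ps -> beta (wt w P) = 0) ->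
        E (theta b) phi != 0 -> beta phi = 0].
Proof.
elim: Ps => [|P Ps IH] /=.
  move=> _; exists k, (@mpolyC N k), [::]; split=> //; first exact: regular_along_field.
  - by move=> e; exists e.
  - by move=> b b0; exists 0; rewrite ini_const eqxx.
  move=> b beta phi _; rewrite ini_const; case: (0 =P phi) => [<- _|_]; last by rewrite eqxx.
  exact: raddf0.
move=> [[beta0 beta0P beta0Ps] /IH [B [theta [zs [zsE reg cst nz supp]]]]].
have cfu : commr_rmorph theta 'X_[P] by move=> b; apply: mulrC.
pose theta' : {rmorphism {poly B} -> {mpoly k[N]}} := horner_morph cfu.
have theta'C b : theta' b%:P = theta b by apply: horner_morphC.
have theta'X : theta' 'X = 'X_[P] by apply: horner_morphX.
have EE b phi : E (theta' b) phi =
    \sum_(i < size b) mono c (P *+ i)%MM * E (theta b`_i) (phi - wt w P *+ i).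
  rewrite -{1}[b]coefK poly_def rmorph_sum hpart_sum raddf_sum; apply: eq_bigr => i _ /=.
  rewrite -mul_polyC rmorphM theta'C rmorphXn theta'X mpolyXn mulrC ini_mulX.
  by rewrite wtMn.
exists {poly B}, theta', ('X :: map polyC zs); split.
- by rewrite /= theta'X -zsE -map_comp; congr cons; apply: eq_map => b; apply: theta'C.
- exact: regular_along_poly.
- by move=> e; have [b be] := cst e; exists b%:P; rewrite theta'C.
- move=> b b0; have sb : (0 < size b)%N by rewrite size_poly_gt0.
  have lt : ((size b).-1 < size b)%N by rewrite prednK.
  have [phi hphi] : exists phi, E (theta b`_(Ordinal lt)) phi != 0.
    by apply: nz; rewrite lead_coef_eq0.
  exists (phi + wt w P *+ (Ordinal lt : nat)); rewrite EE (bigD1 (Ordinal lt)) //= addrK.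
  (* Other powers of [X^P] do not reach this weight: [beta0] vanishes on the weights occurring in
     the coefficients, but not on that of [P], so it determines the power. *)
  rewrite big1 ?addr0; first by rewrite mulf_neq0 // mono_neq0.
  move=> i ne; apply/eqP; rewrite mulf_eq0 (negbTE (mono_neq0 c_neq0 _)) /=.
  apply: contraT => nzi; have := supp _ _ _ beta0Ps nzi.
  move/(dual_inj (supp _ _ _ beta0Ps hphi) beta0P) => e.
  by case/eqP: ne; apply: val_inj.
move=> b beta phi hbeta; rewrite EE => nzsum.
have [i nzi] : exists i : 'I_(size b), E (theta b`_i) (phi - wt w P *+ i) != 0.
  apply: contrapT => h; case/eqP: nzsum; apply: big1 => i _.
  by apply/eqP; rewrite mulf_eq0; apply/orP; right; apply/negPn/negP => nzi; apply: h; exists i.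
have hPs P' : P' \in Ps -> beta (wt w P') = 0 by move=> P'P; apply: hbeta; rewrite inE P'P orbT.
by rewrite -(subrK (wt w P *+ i) phi) raddfD (supp _ _ _ hPs nzi) add0r raddfMn hbeta ?mem_head // mul0rn.
Qed.
End Tower.

Lemma additive_of (V W : zmodType) (f : V -> W) : zmod_morphism f ->
  exists g : {additive V -> W}, g =1 f.
Proof.
move=> fB; pose mx := GRing.isZmodMorphism.Build V W f fB.
by exists (HB.pack_for {additive V -> W} f mx).
Qed.

(** In the Smith normal form [L D R] of [M], the rows of [R] multiplied by the nonzero elementary
    divisors form a basis of the lattice spanned by the rows of [M]. The coordinates with respect to
    the rows of [R] are dual to it up to these divisors, which is enough for independence. *)
Lemma lattice_basis N r (M : 'M[int]_(N, r)) :
  exists (b : 'I_r -> 'rV[int]_r) (beta : 'I_r -> {additive 'rV[int]_r -> int}) (Sel : pred 'I_r),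
  [/\ forall t, Sel t -> exists e, b t = e *m M,
      forall j, exists f : 'I_r -> int, row j M = \sum_(t | Sel t) b t *~ f t,
      forall t, Sel t -> beta t (b t) != 0 & forall t t', t' != t -> beta t (b t') = 0].
Proof.
have [L Lu [R Ru [d _ ME]]] := int_Smith_normal_form M.
set D := \matrix_(i, j) _ in ME.
have [beta betaE] := choice (fun t : 'I_r => @additive_of 'rV[int]_r int
  (fun phi => (phi *m invmx R) 0 t) ltac:(by move=> x y; rewrite mulmxBl !mxE)).
have bE (t t' : 'I_r) : beta t (d`_t' *: row t' R) = d`_t' *+ (t' == t).
  by rewrite betaE -scalemxAl -row_mul mulmxV // !mxE mulr_natr.
exists (fun t : 'I_r => d`_t *: row t R), beta, (fun t : 'I_r => (t < N)%N && (d`_t != 0)); split.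
- move=> t /andP [tN _]; exists (row (Ordinal tN) (invmx L)).
  rewrite -row_mul ME !mulmxA mulVmx // mul1mx row_mul; apply/rowP => i; rewrite !mxE (bigD1 t) //= !mxE eqxx.
  by rewrite big1 ?addr0 // => t' ne; rewrite !mxE /= eq_sym (negbTE (ne : (t' : nat) != t)) mul0r.
- move=> j; exists (fun t : 'I_r => if insub (t : nat) is Some i then L j i else 0).
  rewrite ME row_mul row_mul; apply/rowP => i; rewrite !mxE summxE [RHS]big_mkcond; apply: eq_bigr => t _.
  rewrite !mxE; case: ifP => [/andP [tN _]|].
    rewrite insubT (bigD1 (Ordinal tN)) //= !mxE eqxx big1 ?addr0.
      by rewrite -rowZ_int !mxE mulr1n mulrA.
    by move=> u ne; rewrite !mxE (negbTE (ne : (u : nat) != t)) mulr0.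
  move=> h; rewrite big1 ?mul0r // => u _; rewrite !mxE; case: eqP => [ut|]; last by rewrite mulr0.
  by move: h; rewrite -ut ltn_ord /= => /negbFE /eqP ->; rewrite mul0rn mulr0.
- by move=> t /andP [_ d0]; rewrite bE eqxx.
- by move=> t t' ne; rewrite bE (negbTE ne).
Qed.

(** * Charts of the strict transform of the binomial variety *)

Section ToricChart.
Variables (N r s : nat) (k : fieldType) (O : group_order 'rV[int]_r).
Variables (w : {additive 'rV[int]_N -> 'rV[int]_r}).
Variables (m n : 'I_s -> 'X_{1..N}) (lambda : 'I_s -> k) (F : 'I_s -> mseries N k).
Hypothesis w_gen : forall phi, exists c : 'I_N -> int, phi = \sum_i wt w U_(i)%MM *~ c i.
Hypothesis hF : overweight_deformation O w m n lambda F.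
Local Notation X := 'X_{1..N}.
Local Notation J := (binomials m n lambda).
Local Notation Phi := 'rV[int]_r.
Variable a : 'I_N -> X.
Hypothesis a_unit : chart_mx a \in unitmx.
Hypothesis a_bin : forall l, (forall j, (cmn a (n l) j <= cmn a (m l) j)%N) \/
  (forall j, (cmn a (m l) j <= cmn a (n l) j)%N).
Variable c : 'I_N -> k.
Hypothesis c_neq0 : forall i, c i != 0.
Hypothesis J_mono : forall p q, wt w p = wt w q ->
  ideal_span J ('X_[p] - (mono c p / mono c q) *: 'X_[q]).
Hypothesis c_bin : forall l, mono c (m l) = lambda l * mono c (n l).
Implicit Types (p q b : X) (z : 'rV[int]_N) (phi psi : Phi) (j : 'I_N).

Definition torus_char z : k := \prod_i c i ^ (z 0 i).

Lemma torus_charD z z' : torus_char (z + z') = torus_char z * torus_char z'.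
Proof. by rewrite /torus_char -big_split; apply: eq_bigr => i _; rewrite mxE expfzDr. Qed.

Lemma torus_char_mono p : torus_char (zvec p) = mono c p.
Proof. by apply: eq_bigr => i _; rewrite mxE -exprnP. Qed.

(** The torus point [c] in the coordinates [y_j]. *)
Definition chart_point j : k := torus_char (zvec U_(j)%MM *m chart_inv a).
Local Notation cy := chart_point.
Local Notation wY := (wy a w).

Lemma chart_point_neq0 j : cy j != 0.
Proof. by apply/prodf_neq0 => i _; apply: expfz_neq0. Qed.

Lemma mono_chart b : mono cy b = torus_char (zvec b *m chart_inv a).
Proof.
elim/mnm_gen: b => [|j|p q hp hq].
- rewrite zvec0 mul0mx /mono /torus_char !big1 // => i _; first by rewrite mxE expr0z.
  by rewrite mnm0E expr0.
- rewrite /mono (bigD1 j) //= mnm1E eqxx expr1 big1 ?mulr1 // => i ne.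
  by rewrite mnm1E eq_sym (negbTE ne) expr0.
- by rewrite monoD hp hq zvecD mulmxDl torus_charD.
Qed.

Lemma mono_cmn p : mono cy (cmn a p) = mono c p.
Proof. by rewrite mono_chart zvec_cmn -mulmxA chart_mxK // mulmx1 torus_char_mono. Qed.

Lemma mpolyX_sum (I : finType) (f : I -> X) :
  'X_[\sum_i f i] = \prod_i 'X_[f i] :> {mpoly k[N]}.
Proof. exact: (big_morph _ (@mpolyXD _ _) (@mpolyX0 _ _)). Qed.

Lemma chart_mapX p : chart_map a 'X_[p] = 'X_[cmn a p] :> {mpoly k[N]}.
Proof.
rewrite /chart_map comp_mpolyX cmn_mono mpolyX_sum.
by apply: eq_bigr => i _; rewrite tnth_mktuple mpolyXn.
Qed.

Local Notation tt := (\prod_i 'X_[chart_mon a i] : {mpoly k[N]}).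
Local Notation closure := (closure_ideal (@chart_map N a k @` J) tt).
Local Notation A := (toric_strict a J).
Local Notation qA := (quo closure).

Lemma tt_powE e : tt ^+ e = 'X_[(\sum_i chart_mon a i) *+ e].
Proof. by rewrite -mpolyXn mpolyX_sum. Qed.

Lemma chart_map_span g : ideal_span J g -> ideal_span (@chart_map N a k @` J) (chart_map a g).
Proof.
move=> [d [e [f [fJ ->]]]]; have hs := span_ideal (@chart_map N a k @` J).
rewrite /chart_map rmorph_sum; apply: ideal_sum => // i _; rewrite rmorphM.
by apply: idealMl => //; apply: subset_span; exists (f i).
Qed.

(** Binomials pull back to binomials vanishing at [cy], and vanishing is insensitive to monomial
    factors. Conversely, a two-term relation between monomials of equal weight in the [y_j] is, up
    to a monomial factor, the pull-back of a relation in the ideal of [J], and the closure ideal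
    absorbs the factor. *)
Lemma toric_closureE g : closure g <-> vanish wY cy g.
Proof.
split=> [[e]|].
  rewrite tt_powE => h; apply: (vanish_mulX chart_point_neq0); move: h; apply: span_min.
    exact: vanish_ideal.
  move=> _ [_ [l _ <-] <-]; rewrite /lbinomial /chart_map comp_mpolyB comp_mpolyZ.
  rewrite -!/(@chart_map N a k _) !chart_mapX; apply: vanish_binomial.
    by rewrite !wy_cmn //; apply: wt_bin_eq hF l.
  by rewrite !mono_cmn.
move=> vg; apply: (vanish_sub (closure_idealP _ _) _ vg).
move=> p q pq; have [P [Q PE]] := chart_clear a_unit p; have [P' [Q' PE']] := chart_clear a_unit q.
have E1 : cmn a (P + Q')%MM = (cmn a (Q + Q') + p)%MM.
  by rewrite !cmnD PE; apply/mnmP => i; rewrite !mnmDE; lia.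
have E2 : cmn a (P' + Q)%MM = (cmn a (Q + Q') + q)%MM.
  by rewrite !cmnD PE'; apply/mnmP => i; rewrite !mnmDE; lia.
have wE : wt w (P + Q')%MM = wt w (P' + Q)%MM.
  by rewrite -!(wy_cmn a_unit w) E1 E2 !wtD pq.
have := chart_map_span (J_mono wE).
rewrite /chart_map comp_mpolyB comp_mpolyZ -!/(@chart_map N a k _) !chart_mapX -!mono_cmn E1 E2.
rewrite !monoD -mulf_div divff ?mul1r; last exact/mono_neq0/chart_point_neq0.
rewrite !mpolyXD scalerAr -mulrBr => h.
exists (mdeg (Q + Q')%MM); rewrite tt_powE.
have -> : ((\sum_i chart_mon a i) *+ mdeg (Q + Q') =
    ((\sum_i chart_mon a i) *+ mdeg (Q + Q') - cmn a (Q + Q')) + cmn a (Q + Q'))%MM.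
  rewrite submK //; apply/mnm_lepP => i; rewrite mulmnE mnm_sumE cmnE mulnC mdegE big_distrl /=.
  rewrite leq_sum // => t _; rewrite leq_mul2l; apply/orP; right.
  by rewrite (bigD1 t) //= mnmE leq_addr.
rewrite mpolyXD -mulrA; apply: idealMl => //; exact: span_ideal.
Qed.

Lemma toric_quo0 g : qA g = 0 <-> vanish wY cy g.
Proof. by rewrite closure_quo toric_closureE. Qed.

Lemma toric_monoE p q : wt wY p = wt wY q -> qA 'X_[p] = qA ((mono cy p / mono cy q)%:MP * 'X_[q]).
Proof.
move=> pq; apply/eqP; rewrite -subr_eq0 -rmorphB; apply/eqP/toric_quo0.
rewrite mul_mpolyC; apply: vanish_binomial => //.
by rewrite divfK // mono_neq0 //; apply: chart_point_neq0.
Qed.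

(** Defined by exponents alone: all charts are treated here, including those on which [nu] has no
    center and the weights of the [y_j] have no prescribed sign. *)
Definition toric_center j := [forall l, cmn a (m l) j == cmn a (n l) j].
Local Notation tau := toric_center.

(** A monomial of weight [0] involving exactly the [y_j] with [j] not in [tau]. *)
Definition chart_excess : X := (\sum_l ((cmn a (m l) - cmn a (n l)) + (cmn a (n l) - cmn a (m l))))%MM.
Local Notation EE := chart_excess.

Lemma chart_excess_gt0 j : (0 < EE j)%N = ~~ tau j.
Proof.
rewrite /EE mnm_sumE negb_forall lt0n sum_nat_eq0 negb_forall; apply: eq_existsb => l.
by rewrite /= mnmDE !mnmBE; lia.
Qed.

Lemma wt_chart_excess : wt wY EE = 0.
Proof.
rewrite /EE (big_morph (wt wY) (@wtD _ _ _) (wt0 _)) big1 // => l _.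
have wE : wt wY (cmn a (m l)) = wt wY (cmn a (n l)) by rewrite !wy_cmn //; apply: wt_bin_eq hF l.
case: (a_bin l) => h.
  have -> : (cmn a (n l) - cmn a (m l) = 0)%MM by apply/mnmP => j; rewrite mnmBE mnm0E; apply/eqP; rewrite subn_eq0.
  rewrite addm0; have le : (cmn a (n l) <= cmn a (m l))%MM by apply/mnm_lepP.
  have := wtD wY (cmn a (m l) - cmn a (n l))%MM (cmn a (n l)); rewrite submK // wE => /eqP.
  by rewrite -subr_eq subrr eq_sym => /eqP.
have -> : (cmn a (m l) - cmn a (n l) = 0)%MM by apply/mnmP => j; rewrite mnmBE mnm0E; apply/eqP; rewrite subn_eq0.
rewrite add0m; have le : (cmn a (m l) <= cmn a (n l))%MM by apply/mnm_lepP.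
have := wtD wY (cmn a (n l) - cmn a (m l))%MM (cmn a (m l)); rewrite submK // wE => /eqP.
  by rewrite -subr_eq subrr eq_sym => /eqP.
Qed.

Lemma toric_unitM (x y : A) : (exists t, t * x = 1) -> (exists t, t * y = 1) ->
  exists t, t * (x * y) = 1.
Proof. by move=> [t tx] [t' ty]; exists (t * t'); rewrite mulrACA tx ty mulr1. Qed.

(** [y_j] divides the monomial [y^EE], which has weight 0 and is therefore a nonzero constant on the
    strict transform. *)
Lemma toric_unit1 j : ~~ tau j -> exists t, t * qA 'X_j = 1.
Proof.
rewrite -chart_excess_gt0 => Ej; have le : (U_(j) <= EE)%MM by rewrite lep1mP -lt0n.
have cn0 := mono_neq0 chart_point_neq0 EE.
exists (qA ((mono cy EE)^-1%:MP * 'X_[EE - U_(j)])); rewrite -rmorphM -mulrA -mpolyXD submK // rmorphM /=.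
have -> : qA 'X_[EE] = qA (mono cy EE)%:MP.
  rewrite (@toric_monoE EE 0%MM) ?wt_chart_excess ?wt0 //.
  have -> : mono cy 0%MM = 1 by rewrite /mono big1 // => i _; rewrite mnm0E expr0.
  by rewrite divr1 mpolyX0 mulr1.
by rewrite -rmorphM -mpolyCM mulVf // mpolyC1 rmorph1.
Qed.

Lemma toric_unit p : (forall j, tau j -> p j = 0%N) -> exists t, t * qA 'X_[p] = 1.
Proof.
move=> hp; rewrite mpolyXE_id rmorph_prod.
apply: (big_ind (fun x => exists t, t * x = 1)).
- by exists 1; rewrite mulr1.
- exact: toric_unitM.
move=> j _; have [tj|tj] := boolP (tau j).
  by rewrite hp // expr0; exists 1; rewrite mul1r rmorph1.
rewrite rmorphXn; have [t tE] := toric_unit1 tj; exists (t ^+ p j).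
by rewrite -exprMn tE expr1n.
Qed.

(** Negative exponents are compensated by [K] copies of [EE], which leave the weight unchanged; [K]
    bounds all the entries of [e] in absolute value. *)
Lemma toric_mono (e : 'rV[int]_N) : exists P : X, (forall j, tau j -> P j = 0%N) /\
  wt wY P = \sum_(j | ~~ tau j) wt wY U_(j)%MM *~ e 0 j.
Proof.
pose K := (\sum_i absz (e 0%R i))%N.
pose P : X := [multinom if tau j then 0%N else absz (e 0%R j + (K * EE j)%N%:Z)%R | j < N].
have PE j : P j = if tau j then 0%N else absz (e 0%R j + (K * EE j)%N%:Z)%R by apply: mnmE.
exists P; split=> [j tj|]; first by rewrite PE tj.
have E0 : \sum_(j | ~~ tau j) wt wY U_(j)%MM *+ EE j = 0.
  have := wt_chart_excess; rewrite wtE (bigID tau) /= [X in X + _]big1 ?add0r // => j tj.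
  by have := chart_excess_gt0 j; rewrite tj lt0n => /negbFE /eqP ->.
rewrite wtE (bigID tau) /= [X in X + _]big1 ?add0r => [|j tj]; last by rewrite PE tj.
rewrite -[RHS]addr0 -[X in _ + X](mul0rn _ K) -[X in X *+ K]E0 -sumrMnl -big_split /=; apply: eq_bigr => j tj.
rewrite PE (negbTE tj) -mulrnA !(pmulrn (wt wY _)) -mulrzDr; congr (_ *~ _).
have Ej : (0 < EE j)%N by rewrite chart_excess_gt0.
have le : (absz (e 0%R j) <= K * EE j)%N.
  apply: (@leq_trans K); last by rewrite -{1}[K]muln1 leq_mul2l Ej orbT.
  by rewrite /K (bigD1 j) //= leq_addr.
by lia.
Qed.

Lemma has_duals_cat (I : eqType) (f : I -> X) (L : seq I) (Ps : seq X) : uniq L ->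
  (forall t, t \in L -> exists2 beta : {additive Phi -> int}, beta (wt wY (f t)) != 0 &
     (forall i, i \in L -> i != t -> beta (wt wY (f i)) = 0) /\
     forall P, P \in Ps -> beta (wt wY P) = 0) ->
  has_duals wY Ps -> has_duals wY (map f L ++ Ps).
Proof.
elim: L => //= t L IH /andP [tL uL] h hPs; split.
  have [beta b0 [bL bP]] := h t (mem_head _ _); exists beta => // P'.
  rewrite mem_cat => /orP [/mapP [i iL ->]|]; last exact: bP.
  by apply: bL; [rewrite inE iL orbT | apply: contraNneq tL => <-].
apply: IH => // i iL; have [|beta b0 [bL bP]] := h i; first by rewrite inE iL orbT.
by exists beta => //; split=> // i' i'L; apply: bL; rewrite inE i'L orbT.
Qed.

(** [A] is the semigroup algebra of [N^tau x G], where [G] is the free group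
    generated by the weights of the [y_j], [j] not in [tau], which are units. *)
Theorem toric_regular (p : set A) : prime_ideal p ->
  regular_at p /\ transversal_at (@toric_coord N a k J) p.
Proof.
move=> pp.
have [alpha [alphaB alphaP alphaE]] := weight_dual w_gen hF a_unit.
have alpha_om i j : tau j -> alpha (wt wY U_(i)%MM) 0 j = (i == j)%:R.
  move=> /forallP tj; rewrite [wt _ _]/(w _) alphaE; last by move=> l; apply/eqP.
  rewrite -mulmxA chart_invK // mulmx1 !mxE mnm1E.
  by case: eqP.
have [al alE] := choice (fun j => @additive_of Phi int (fun phi => alpha phi 0 j)
  ltac:(by move=> x y; rewrite alphaB !mxE)).
(* The rows outside [tau] span the lattice of weights of the invertible coordinates; the rows in
   [tau] are set to zero. *)
pose M : 'M[int]_(N, r) := \matrix_(j, t) (if tau j then 0 else wt wY U_(j)%MM 0 t).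
have rowM j : row j M = if tau j then 0 else wt wY U_(j)%MM.
  by apply/rowP => t; rewrite !mxE; case: ifP => //; rewrite mxE.
have [b [beta [Sel [bM Mb beta1 beta0]]]] := lattice_basis M.
have bP t : exists P : X, (forall j, tau j -> P j = 0%N) /\ (Sel t -> wt wY P = b t).
  have [St|_] := boolP (Sel t); last by exists 0%MM; split=> // j _; rewrite mnm0E.
  have [e ->] := bM t St; have [P [P0 PE]] := toric_mono e; exists P; split=> // _.
  rewrite PE mulmx_sum_row [RHS](bigID tau) /= [X in _ = X + _]big1 ?add0r.
    by apply: eq_bigr => j tj; rewrite rowM (negbTE tj) rowZ_int.
  by move=> j tj; rewrite rowM tj scaler0.
have {bP} [P PP] := choice bP.
have P0 t j : tau j -> P t j = 0%N by apply: (PP t).1.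
have PE t : Sel t -> wt wY (P t) = b t by apply: (PP t).2.
pose L := [seq j <- enum 'I_N | tau j]; pose T := [seq t <- enum 'I_r | Sel t].
have inL j : (j \in L) = tau j by rewrite mem_filter mem_enum andbT.
have inT t : (t \in T) = Sel t by rewrite mem_filter mem_enum andbT.
pose Ps := [seq U_(j)%MM | j <- L] ++ [seq P t | t <- T].
have duals : has_duals wY Ps.
  apply: has_duals_cat; first by rewrite filter_uniq // enum_uniq.
    move=> j; rewrite inL => tj; exists (al j); first by rewrite alE alpha_om // eqxx.
    split=> [i _ /negbTE ne|_ /mapP [t _ ->]]; first by rewrite alE alpha_om // ne.
    rewrite wtE raddf_sum big1 // => i _; rewrite raddfMn alE alpha_om //.
    by case: eqP => [->|_]; rewrite ?mul0rn // P0.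
  rewrite -[map P T]cats0; apply: has_duals_cat => //; first by rewrite filter_uniq // enum_uniq.
  move=> t; rewrite inT => St; exists (beta t); first by rewrite PE // beta1.
  by split=> // t'; rewrite inT => St' ne; rewrite PE // beta0.
have [B [theta [zs [zsE reg cst nz _]]]] := poly_tower chart_point_neq0 duals.
pose psi : {rmorphism B -> A} := qA \o theta.
have psiE x : psi x = qA (theta x) by [].
have psiM x y : psi (x * y) = psi x * psi y by apply: rmorphM.
have psiD x y : psi (x + y) = psi x + psi y by apply: rmorphD.
have psi_inj x : psi x = 0 -> x = 0.
  rewrite psiE => /toric_quo0 h; apply/eqP; apply: contraT => /nz [phi].
  by rewrite h eqxx.
have UP t : exists u, u * qA 'X_[P t] = 1 by apply: toric_unit; apply: P0.
have imX q : q \in Ps -> exists x, theta x = 'X_[q].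
  move=> qPs; have : 'X_[q] \in [seq theta x | x <- zs] by rewrite zsE; apply: (map_f (fun q => 'X_[q])).
  by case/mapP => x _ ->; exists x.
have psi_frac (z : A) : exists (d x : B), (exists u, u * psi d = 1) /\ psi d * z = psi x.
  pose Q (z : A) := exists (d x : B), (exists u, u * psi d = 1) /\ psi d * z = psi x.
  have Qim x : Q (psi x).
    by exists 1, x; rewrite rmorph1 mul1r; split=> //; exists 1; rewrite mulr1.
  have QD x y : Q x -> Q y -> Q (x + y).
    move=> [x0 [x1 [ux ex]]] [y0 [y1 [uy ey]]]; exists (x0 * y0), (y0 * x1 + x0 * y1).
    rewrite psiD !psiM -ex -ey; split; first exact: toric_unitM.
    by ring.
  have QM x y : Q x -> Q y -> Q (x * y).
    move=> [x0 [x1 [ux ex]]] [y0 [y1 [uy ey]]]; exists (x0 * y0), (x1 * y1).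
    rewrite !psiM -ex -ey; split; first exact: toric_unitM.
    by ring.
  have Qmon (f : 'I_r -> nat) : exists2 x, psi x = qA 'X_[\sum_(t | Sel t) P t *+ f t]
      & exists u, u * psi x = 1.
    pose h := (\sum_(t | Sel t) P t *+ f t)%MM.
    have [x xE] : exists x, theta x = 'X_[h].
      rewrite /h (big_morph _ (@mpolyXD _ _) (@mpolyX0 _ _)).
      apply: (big_ind (fun y => exists x, theta x = y)); first by exists 1; rewrite rmorph1.
        by move=> _ _ [x <-] [y <-]; exists (x * y); rewrite rmorphM.
      move=> t St; have [|x xE] := imX (P t); first by rewrite mem_cat [X in _ || X]map_f ?inT ?orbT.
      by exists (x ^+ f t); rewrite rmorphXn xE mpolyXn.
    exists x; rewrite psiE xE //; apply: toric_unit => j tj.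
    by rewrite mnm_sumE big1 // => t _; rewrite mulmnE P0.
  have Qy j : Q (qA 'X_j).
    have [tj|tj] := boolP (tau j).
      by have [|x <-] := imX U_(j)%MM; [rewrite mem_cat map_f ?inL | exact: Qim].
    (* The weight of [y_j] is a combination of the [b t], so [y_j] is a constant times a quotient of
       monomials in the units [X^(P t)]. *)
    have [f fE] := Mb j; rewrite rowM (negbTE tj) in fE.
    pose fp t := absz (Num.max (f t) 0)%R; pose fn t := absz (Num.max (- f t) 0)%R.
    have fpnE t : f t = (fp t)%:Z - (fn t)%:Z by rewrite /fp /fn; case: (ltP (f t) 0); lia.
    have [xp xpE _] := Qmon fp; have [xn xnE xnU] := Qmon fn.
    have wE : wt wY (\sum_(t | Sel t) P t *+ fn t + U_(j))%MM =
        wt wY (\sum_(t | Sel t) P t *+ fp t)%MM.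
      have ws (g : 'I_r -> nat) : wt wY (\sum_(t | Sel t) P t *+ g t)%MM = \sum_(t | Sel t) b t *+ g t.
        rewrite (big_morph (wt wY) (@wtD _ _ _) (wt0 _)); apply: eq_bigr => t St.
        by rewrite wtMn PE.
      rewrite wtD !ws fE -big_split; apply: eq_bigr => t _ /=.
      by rewrite fpnE mulrzBr addrC subrK.
    have [ee eE] : exists ee, qA 'X_[\sum_(t | Sel t) P t *+ fn t + U_(j)] =
        qA (ee%:MP * 'X_[\sum_(t | Sel t) P t *+ fp t]) by eexists; apply: toric_monoE wE.
    have [x xE] := cst ee; exists xn, (x * xp); split=> //.
    by rewrite psiM xpE (psiE x) xE xnE -!rmorphM -mpolyXD.
  have Qc e : Q (qA e%:MP) by have [x <-] := cst e; apply: Qim.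
  have QX q : Q (qA 'X_[q]).
    elim/mnm_gen: q => [|j|q q' hq hq']; [by rewrite mpolyX0; apply: Qc | exact: Qy |].
    by rewrite mpolyXD rmorphM; apply: QM.
  have [g <-] := quo_surj z; rewrite [g]mpolyE rmorph_sum; apply: (big_ind Q) => // [|q _].
    by rewrite -(rmorph0 psi); apply: Qim.
  by rewrite -mul_mpolyC rmorphM; apply: QM; [exact: Qc | exact: QX].
have noeth : noetherian A.
  by apply: noetherian_quotient; apply: noetherian_mpoly; exact: noetherian_field.
have [xs rp] := regular_localization psi_inj psi_frac noeth reg pp.
split; first by eexists; exact: rp.
exists xs; move: rp; set l1 := filter _ _; set l2 := map _ _; suff -> : l1 = l2 by [].
rewrite /l1 /l2 (map_comp qA theta) zsE -map_comp map_cat filter_cat.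
(* The [X^(P t)] are units, so none of them lies in [p]: they are auxiliary coordinates, not
   components of the boundary. *)
have -> : [seq x <- [seq (qA \o (fun q => 'X_[q])) i | i <- [seq P t | t <- T]] | `[< p x >]] = [::].
  apply/eqP; rewrite -[_ == _]negbK -has_filter; apply/negP => /hasP [x /mapP [q /mapP [t tT ->] ->] /asboolP].
  exact: unit_notin pp (UP t).
rewrite cats0 -map_comp filter_map /L -filter_predI; congr map; apply: eq_filter => j /=.
case: asboolP => //= pj; apply: contraT => tj.
by case: (unit_notin pp (toric_unit1 tj)).
Qed.

End ToricChart.

Theorem proposition3p3
  (RR : realType) (k : fieldType) (r N s : nat)
  (O : group_order 'rV[int]_r)
  (w : {additive 'rV[int]_N -> 'rV[int]_r})
  (hw : is_weight O w)
  (hw_gen : forall phi, exists c : 'I_N -> int, phi = \sum_i wt w U_(i) *~ c i)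
  (hw_pos : forall i : 'I_N, glt O 0 (wt w U_(i)))
  (m n : 'I_s -> 'X_{1..N}) (lambda : 'I_s -> k)
  (F : 'I_s -> mseries N k)
  (hF : overweight_deformation O w m n lambda F) :
  let S := mseries N k in
  let R : comPzRingType := quotient (range F) in
  let pi : S -> R := quo (range F) in
  let J := binomials m n lambda in
  exists (K : fieldType) (iota : {rmorphism R -> K}) (v : K -> 'rV[int]_r),
  [/\ is_fraction_field iota,
      (* a) *)
      [/\ forall x : R, x <> 0 -> is_max_weight O w pi x (v (iota x)),
          is_valuation O v,
          value_group_full v,
          rational_valuation O v iota
        & exists ini : 'rV[int]_r -> R -> quotient J,
          [/\ is_associated_graded O (@weight_ge N _ O w k)
                (@weight_gt N _ O w k) (@weight_part N _ w k),
              is_associated_graded O (val_ge O v iota) (val_gt O v iota) ini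
            & is_graded_map O
                (@weight_ge N _ O w k) (@weight_gt N _ O w k) (@weight_part N _ w k)
                (val_ge O v iota) (val_gt O v iota) ini
                pi (quo J)]]
    & (* b) *)
      GRing.closed_field_axiom k ->
      exists Sigma : {fset {fset 'X_{1..N}}},
      [/\ regular_fan RR Sigma,
          support_orthant RR Sigma,
          embedded_pseudo_resolution Sigma J,
          exists a (p : set (formal_strict a (range F))),
            is_chart Sigma a /\ is_center O iota v p
        & forall a (p : set (formal_strict a (range F))),
            is_chart Sigma a -> is_center O iota v p ->
            regular_at p /\ transversal_at (@formal_coord N a k (range F)) p]].
Proof.
move=> S R pi J.
have [gens gensP] := choice (fun l => dickson [set p | coef (F l - series_of_poly
  (lbinomial (m l) (n l) (lambda l))) p <> 0]).
have gens_supp l := (gensP l).1; have gens_le l := (gensP l).2.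
pose H := flatten [seq (zvec (m l) - zvec (n l)) :: [seq zvec (m l) - zvec g | g <- gens l]
  | l <- enum 'I_s].
have [Sigma gS HS] := exists_fan RR H.
have inH l h : h = zvec (m l) - zvec (n l) \/ (exists2 g, g \in gens l & h = zvec (m l) - zvec g) ->
    h \in H.
  move=> hh; apply/flattenP; exists ((zvec (m l) - zvec (n l)) :: [seq zvec (m l) - zvec g | g <- gens l]).
    by apply: (map_f (fun l => _ :: _)); rewrite mem_enum.
  case: hh => [->|[g gl ->]]; first exact: mem_head.
  by rewrite inE; apply/orP; right; apply: (map_f (fun g => zvec (m l) - zvec g)).
have chart_bin a : is_chart Sigma a -> forall l,
    (forall j, (cmn a (n l) j <= cmn a (m l) j)%N) \/ (forall j, (cmn a (m l) j <= cmn a (n l) j)%N).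
  by move=> ac l; apply: (is_chart_compat gS ac); apply: HS; apply: (inH l); left.
have chart_gens a : is_chart Sigma a -> forall l g, g \in gens l ->
    (forall j, (cmn a (m l) j <= cmn a g j)%N) \/ (forall j, (cmn a g j <= cmn a (m l) j)%N).
  move=> ac l g gl; have hc : compatible (zvec (m l) - zvec g) Sigma.
    by apply: HS; apply: (inH l); right; exists g.
  by case: (is_chart_compat gS ac hc) => h; [right|left].
(* The chart of the cone containing the weight. It is used for a) as well: the torus point and the
   normal forms are obtained on it, though their conclusions [J_mono] and [vt] no longer mention
   it. *)
have [a0 ac0 om0] := exists_chart gS (fun i => (hw_pos i).1).
have au0 := is_chart_unit gS ac0.
have [c [c0 J_mono c_bin]] := exists_torus_point hw_gen hw_pos hF au0 (chart_bin _ ac0) om0.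
have vt : val_theory w F c O.
  apply: (chart_val_theory hw_pos hF gens_supp gens_le au0 (chart_bin _ ac0)
    (chart_gens _ ac0) om0 c0 J_mono c_bin) => p q; exact: tau_order.
have JP g : ideal_span J g <-> vanish w c g.
  split; first exact: (binomials_vanish hF c_bin).
  by apply: vanish_sub => //; apply: span_ideal.
have [K [iota fracK]] := V_fraction_field c0 vt.
have [v [v_val vE]] := valuation_extends fracK (vt_ex vt) (vt_uniq vt) (vt_neq0 vt)
  (vt_mul vt) (vt_add vt).
have [iota_inj _] := fracK.
have sX0 p : iota (pi (sX k p)) != 0.
  apply/eqP => e; have := vt_neq0 vt (val_rel_mono w F c0 O p); apply.
  by apply: iota_inj; rewrite e rmorph0.
have vX p : v (iota (pi (sX k p))) = wt w p by apply: vE; apply: val_rel_mono.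
exists K, iota, v; split=> //.
  split=> //.
  - by move=> x; apply: (valuation_max_weight vt vE).
  - exact: (valuation_full hw_gen c0 vt fracK v_val vE).
  - exact: (valuation_rational hw_pos c0 vt fracK v_val vE).
  exists (graded_ini O w (F := F) J); split.
  - exact: (graded_series hw_pos vt).
  - exact: (graded_ring hw_pos vt JP vE).
  - exact: (graded_map vt JP vE).
move=> _; exists Sigma; split.
- exact: good_regular_fan.
- exact: good_support.
- move=> a ac p pp; apply: (toric_regular hw_gen hF (is_chart_unit gS ac) (chart_bin _ ac)
    c0 J_mono c_bin pp).
- have [f fE] := formal_map_exists au0 sX0; exists a0, [set g | valuation_max O v (f g)].
  split=> //; exists f; split=> //.
  apply: (@formal_map_generated _ _ _ _ _ _ _ _ fE (valuation_ring O v)) => [x|j|x y|x y].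
  + exact: (iota_valuation_ring hw_pos vt vE).
  + by right; rewrite (formal_map_weight au0 sX0 fE U_(j)%MM v_val vX).
  + exact: vringD.
  + exact: vringM.
move=> a p ac [f [fE fV pE]]; have au := is_chart_unit gS ac.
(* A center on the chart means that the [y_j] lie in the valuation ring, so their weights are
   nonnegative. *)
have om j : O 0 (wt (wy a w) U_(j)%MM).
  rewrite -(formal_map_weight au sX0 fE U_(j)%MM v_val vX); case: (fV (formal_coord a (range F) j)) => //.
  by move/eqP; rewrite (negbTE (formal_map_mono_neq0 au sX0 fE U_(j)%MM)).
exact: (formal_regular hw_gen hw_pos hF gens_supp gens_le au (chart_bin _ ac)
  (chart_gens _ ac) fracK sX0 fE om c0 J_mono c_bin v_val vX fV pE).
Qed.
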